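(* There exists a non-empty open subset $\mathcal{U}\subset\mathbb{R}^3$ such that for every $(u,v,w)\in\mathcal{U}$ there exists $f\in\mathcal{P}^{s0}_{3,6}$ satisfying: (1) $f(u,v,1)=f(w,1,1)=f(1,1,1)=0$; (2) $f$ is irreducible in $\mathbb{C}[a,b,c]$; (3) $f\in\mathcal{E}(\mathcal{P}_{3,6})\setminus\Sigma_{3,6}$; (4) the complex projective plane curve $V_{\mathbb{C}}(f)=\{f=0\}\subset\mathbb{P}^2_{\mathbb{C}}$ is an irreducible rational curve having 10 acnodes.
   Context: $\mathcal{H}_{3,6}$ is the real vector space of homogeneous polynomials of degree 6 in $\mathbb{R}[a,b,c]$. $\mathcal{P}_{3,6}=\{f\in\mathcal{H}_{3,6}: f(x)\ge0\ \forall x\in\mathbb{R}^3\}$; $\Sigma_{3,6}\subset\mathcal{P}_{3,6}$ is the cone of sums of squares of real cubic forms. $\mathcal{P}^{s0}_{3,6}$ is the set of $f\in\mathcal{P}_{3,6}$ that are symmetric (invariant under all permutations of $a,b,c$) and satisfy $f(1,1,1)=0$. For a closed convex cone $\mathcal{P}$, $f\in\mathcal{P}\setminus\{0\}$ is extremal if $f=g+h$ with $g,h\in\mathcal{P}$ forces $g,h\in\mathbb{R}_{\ge0}f$; $\mathcal{E}(\mathcal{P})$ denotes the set of extremal elements. An acnode is a real isolated singular point of a real plane curve (a node with complex conjugate tangents). *)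

(* Defs.v *)
From HB Require Import structures.
From mathcomp Require Import all_boot all_order all_algebra.
From mathcomp Require Import reals.
From mathcomp Require Import complex.
From mathcomp Require Import mpoly.

Set Implicit Arguments.
Unset Strict Implicit.
Unset Printing Implicit Defensive.

Import Order.TTheory GRing.Theory Num.Theory.
Local Open Scope ring_scope.

Section Sextics.
Variable R : realType.

Definition pt3 (a b c : R) : 'I_3 -> R := fun i => [:: a; b; c]`_i.

Definition form36 (f : {mpoly R[3]}) : Prop := f \is 6.-homog.

Definition psd36 (f : {mpoly R[3]}) : Prop :=
  form36 f /\ forall x : 'I_3 -> R, 0 <= f.@[x].

Definition sos36 (f : {mpoly R[3]}) : Prop :=
  exists gs : seq {mpoly R[3]},
    all (fun g => g \is 3.-homog) gs /\ f = \sum_(g <- gs) g ^+ 2.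

Definition psd36_s0 (f : {mpoly R[3]}) : Prop :=
  psd36 f /\ f \is symmetric /\ f.@[pt3 1 1 1] = 0.

Definition extremal_psd36 (f : {mpoly R[3]}) : Prop :=
  psd36 f /\ f != 0 /\
  forall g h : {mpoly R[3]}, psd36 g -> psd36 h -> f = g + h ->
    (exists c : R, 0 <= c /\ g = c *: f) /\ (exists c : R, 0 <= c /\ h = c *: f).

Definition cplx (f : {mpoly R[3]}) : {mpoly R[i][3]} :=
  map_mpoly (real_complex R) f.

Definition irreducible_mpoly {K : fieldType} {n : nat} (p : {mpoly K[n]}) : Prop :=
  (1 < msize p)%N /\
  forall g h : {mpoly K[n]}, p = g * h -> (msize g <= 1)%N \/ (msize h <= 1)%N.

(* The plane curve V_C(F) (F a ternary form over C) is rational: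
   it is birational to P^1, i.e. there is a rational map
   phi = (p0:p1:p2) : P^1 --> V_C(F) given by binary forms of a common
   degree d, and a rational map psi = (q0:q1) : P^2 --> P^1 given by
   ternary forms of a common degree e, such that phi lands in V_C(F)
   and psi o phi = id_{P^1} (as rational maps). *)
Definition rational_curve (F : {mpoly R[i][3]}) : Prop :=
  exists (d e : nat) (p : 3.-tuple {mpoly R[i][2]}) (q : 2.-tuple {mpoly R[i][3]}),
    (forall k, tnth p k \is d.-homog) /\
    (forall k, tnth q k \is e.-homog) /\
    F \mPo p = 0 /\
    'X_(0 : 'I_2) * (tnth q 1 \mPo p) = 'X_(1 : 'I_2) * (tnth q 0 \mPo p) /\
    ((tnth q 0 \mPo p) != 0 \/ (tnth q 1 \mPo p) != 0).

Definition proj_eq (x y : 'I_3 -> R) : Prop :=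
  exists t : R, t != 0 /\ forall k, x k = t * y k.

Definition hess_form (f : {mpoly R[3]}) (x v : 'I_3 -> R) : R :=
  \sum_(i < 3) \sum_(j < 3) (mderiv j (mderiv i f)).@[x] * v i * v j.

(* x (a nonzero real vector) is an acnode of the curve f = 0:
   a real singular point which is a node whose two tangents are complex
   conjugate, i.e. the tangent-cone quadratic form (the Hessian, which has
   x in its kernel by Euler's formula) is definite on R^3 / <x>. *)
Definition acnode (f : {mpoly R[3]}) (x : 'I_3 -> R) : Prop :=
  (exists k, x k != 0) /\
  f.@[x] = 0 /\
  (forall i : 'I_3, (mderiv i f).@[x] = 0) /\
  ((forall v, ~ (exists t : R, forall k, v k = t * x k) -> 0 < hess_form f x v) \/
   (forall v, ~ (exists t : R, forall k, v k = t * x k) -> hess_form f x v < 0)).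

Definition has_n_acnodes (n : nat) (f : {mpoly R[3]}) : Prop :=
  exists P : 'I_n -> 'I_3 -> R,
    (forall i, acnode f (P i)) /\
    (forall i j, i != j -> ~ proj_eq (P i) (P j)) /\
    (forall x, acnode f x -> exists i, proj_eq x (P i)).

Definition nonempty_open3 (U : R -> R -> R -> Prop) : Prop :=
  (exists u v w, U u v w) /\
  forall u v w, U u v w -> exists e : R, 0 < e /\
    forall u' v' w', `|u' - u| < e -> `|v' - v| < e -> `|w' - w| < e -> U u' v' w'.

End Sextics.

(* Main.v *)
(* A symmetric sextic in the variables e = h(a+b+c), P = |z|^2, Q = 2 Re z^3,
   where z = a + wb + w^2c, is quadratic in Q: its quotient by S_3 is a
   Weierstrass cubic.  Asking for zeros at (1,1,1), (w,1,1) and (u,v,1) makes the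
   cubic nodal, hence parametrised by polynomials e = Y + dX,
   P = X(kY + KX), Q = X(Y^2 + kKXY + 2K^2X^2) with K = 1 + k^2, and (u,v,w)
   determines k, d and h through rational functions and one square root.  A real
   point has Q^2 <= 4P^3, whereas Q^2 - 4P^3 is a square times a positive factor
   along the real part of the cubic; so the cubic meets the image of the real
   plane only at its node and where it touches the boundary, which gives f >= 0
   and exactly ten real zeros.

   Upstairs the curve is the image of s |-> (e, z, zbar) =
   (1 + (d-2k)s^3 - s^6, s - ks^4, ks^2 + s^5), with a quotient of two adjoint
   quartics as inverse.  Birationality implies that a form of degree at most 6
   vanishing along the curve is a multiple of f: on a general line zbar = mu e
   the curve has six distinct points, and after subtracting a multiple of f the
   form has degree at most 5 on every such line.  This yields irreducibility.  Each
   acnode comes from the two parameters s and -1/conj(s), which are 0 and infinity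
   for (1,1,1).  A nonnegative sextic vanishing at the ten points pulls back to a
   polynomial of degree at most 36 with 19 double roots, so it is a multiple of f;
   a cubic through them pulls back to degree at most 18 with 19 roots, so it is 0
   and f is not a sum of squares. *)

Require Import Defs.
From HB Require Import structures.
From mathcomp Require Import all_boot all_order all_algebra.
From mathcomp Require Import reals.
From mathcomp Require Import complex.
From mathcomp Require Import mpoly perm separable.
From mathcomp Require Import ring lra zify.
Import Order.TTheory GRing.Theory Num.Theory.
Local Open Scope ring_scope.
Set Implicit Arguments.
Unset Strict Implicit.
Unset Printing Implicit Defensive.

(** * Multivariate polynomials along parametrised curves *)

(** The orbits of (1,1,1), (w,1,1) and (u,v,1) have 1, 3 and 6 points, and ten double points are
    what a plane sextic, of arithmetic genus 10, needs to be rational. Only the orbit of six comes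
    from a singularity of the quotient cubic. The other two come from points where the cubic meets
    the branch curve q^2 = 4p^3 of the quotient by S_3 with even multiplicity: by [disc_par], q^2 -
    4p^3 is there a square times (y + 2kx)^2 + 4x^2. With x = ST and y + 2kx = S^2 - T^2 this last
    factor becomes (S^2 + T^2)^2, so z^3 and zbar^3, the roots of Z^2 - qZ + p^3, are forms in S and
    T. They are S^2 T (S - kT)^3 and S T^2 (kS + T)^3, hence cubes once S = s^3 and T = t^3. This is
    the origin of the parametrisation upstairs. Complex conjugation acts on its parameter without
    fixed points, so each real point of the curve is hit at least twice. *)

Lemma horner_mmap_polyC n (K : comNzRingType) (u : 'I_n -> {poly K})
    (p : {mpoly K[n]}) s :
  (mmap polyC u p).[s] = p.@[fun i => (u i).[s]].
Proof.
rewrite /mmap mevalE horner_sum; apply: eq_bigr => m _.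
rewrite hornerM hornerC horner_prod; congr (_ * _).
by apply: eq_bigr => i _; rewrite horner_exp.
Qed.

Lemma deriv_mmap_polyC n (K : comNzRingType) (u : 'I_n -> {poly K})
    (p : {mpoly K[n]}) :
  (mmap polyC u p)^`() = \sum_i mmap polyC u p^`M(i) * (u i)^`().
Proof.
pose P (q : {mpoly K[n]}) :=
  (mmap polyC u q)^`() = \sum_i mmap polyC u q^`M(i) * (u i)^`().
have PC c : P c%:MP.
  rewrite /P mmapC derivC big1 // => i _.
  by rewrite mderivC mmap0 mul0r.
have PM q r : P q -> P r -> P (q * r).
  move=> Pq Pr; rewrite /P rmorphM /= derivM Pq Pr mulr_suml mulr_sumr -big_split /=.
  apply: eq_bigr => i _; rewrite mderivM rmorphD !rmorphM /=; ring.
have PX i : P 'X_i.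
  rewrite /P mmapX mmap1U (bigD1 i) //= big1 => [|j ji].
    by rewrite mderivX mnm1E eqxx scale1r -[X in (X - _)%MM]add0m addmK mpolyX0 rmorph1 mul1r addr0.
  by rewrite mderivX mnm1E eq_sym (negPf ji) scale0r mmap0 mul0r.
rewrite -/(P p); elim/mpolyind: p => [|c m p _ _ Pp]; first by rewrite -mpolyC0.
have Pm : P 'X_[m].
  rewrite mpolyXE_id; apply: big_ind => // [|i _]; first by rewrite -mpolyC1.
  by elim: (m i) => [|k IHk]; rewrite ?expr0 -?mpolyC1 // exprS; apply: PM.
rewrite /P -mul_mpolyC; have {}Pm := PM _ _ (PC c) Pm.
rewrite rmorphD derivD Pm Pp -big_split /=; apply: eq_bigr => i _.
by rewrite -mulrDl -rmorphD mderivD.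
Qed.

Lemma meval_at0 n (K : comNzRingType) (p : {mpoly K[n]}) :
  p.@[fun=> 0] = p@_0.
Proof.
elim/mpolyind: p => [|c m p _ _ IHp]; first by rewrite meval0 mcoeff0.
rewrite mevalD mevalZ mevalX mcoeffD mcoeffZ IHp mcoeffX; congr (_ * _ + _).
case: (eqVneq m 0%MM) => [->|m0]; first by rewrite big1 // => i _; rewrite mnm0E.
have [i mi] : exists i, m i != 0%N.
  apply/existsP; apply: contraNT m0; rewrite negb_exists => /forallP m0.
  by apply/eqP/mnmP => i; rewrite mnm0E; apply/eqP; rewrite -[_ == _]negbK.
by rewrite (bigD1 i) //= expr0n (negPf mi) mul0r.
Qed.

(** A coefficient of positive degree is, up to a nonzero integer factor, a coefficient of lower
    degree of a partial derivative, and the partial derivatives vanish everywhere again; the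
    constant coefficient is the value at 0. *)
Lemma mpoly_eq0 n (K : numDomainType) (p : {mpoly K[n]}) :
  (forall x, p.@[x] = 0) -> p = 0.
Proof.
move=> p0; apply/mpolyP => m; rewrite mcoeff0.
have [N] := ubnP (mdeg m); elim: N m p p0 => // N IHN m p p0 /ltnSE mN.
have [/eqP|m_gt0] := posnP (mdeg m).
  by rewrite mdeg_eq0 => /eqP ->; rewrite -meval_at0.
have [i mi] : exists i, (0 < m i)%N.
  apply/existsP; apply: contraTT m_gt0; rewrite negb_exists => /forallP m0.
  rewrite -eqn0Ngt mdeg_eq0; apply/eqP/mnmP => i; rewrite mnm0E.
  by apply/eqP; rewrite eqn0Ngt.
have im : (U_(i) <= m)%MM by rewrite lep1mP -lt0n.
have mE : ((m - U_(i)) + U_(i) = m)%MM by rewrite submK.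
have dp0 x : (p^`M(i)).@[x] = 0.
  pose u j : {poly K} := (x j)%:P + (i == j)%:R *: 'X.
  have u0 : mmap polyC u p = 0.
    apply/eqP/negP => /negP pu0; have [t] : exists t, ~~ root (mmap polyC u p) t.
      pose rs := [seq k%:R : K | k <- iota 0 (size (mmap polyC u p))].
      have [|/allPn [t _ pt]] := boolP (all (root (mmap polyC u p)) rs); last by exists t.
      move=> /max_poly_roots - /(_ pu0); rewrite size_map size_iota ltnn => H.
      by have := H _; rewrite map_inj_uniq ?iota_uniq // => [/(_ isT)//|a b /eqP];
        rewrite eqr_nat => /eqP.
    by rewrite rootE horner_mmap_polyC p0 eqxx.
  have := deriv_mmap_polyC u p; rewrite u0 derivC => /(congr1 (fun q => q.[0])).
  rewrite horner0 horner_sum (bigD1 i) //= big1 => [|j ji].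
    rewrite hornerM derivD derivC add0r derivZ derivX eqxx scale1r hornerC mulr1 addr0.
    rewrite horner_mmap_polyC => ->; apply: meval_eq => j.
    by rewrite !hornerE.
  by rewrite hornerM derivD derivC add0r derivZ eq_sym (negPf ji) scale0r horner0 mulr0.
have := IHN (m - U_(i))%MM p^`M(i) dp0.
have mdegE : mdeg m = (mdeg (m - U_(i))).+1.
  by rewrite -[in LHS]mE mdegD mdeg1 addn1.
rewrite -mdegE => /(_ mN); rewrite mcoeff_mderiv mE => /eqP.
by rewrite mulrn_eq0 orFb => /eqP.
Qed.

(** Only the part of [p] of degree N and the coefficients of degree d of the substituted polynomials
    contribute in degree N d. With d = 1 this says that the top coefficient is the same on all
    parallel lines. *)
Lemma mmap_polyC_lead n (K : comNzRingType) (d N : nat) (u v : 'I_n -> {poly K})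
    (p : {mpoly K[n]}) :
    (forall i, (size (u i) <= d.+1)%N) -> (forall i, (size (v i) <= d.+1)%N) ->
    (forall i, (u i)`_d = (v i)`_d) -> (msize p <= N.+1)%N ->
  (size (mmap polyC u p) <= (N * d).+1)%N /\
  (mmap polyC u p)`_(N * d) = (mmap polyC v p)`_(N * d).
Proof.
pose L k (q r : {poly K}) :=
  [/\ (size q <= k.+1)%N, (size r <= k.+1)%N & q`_k = r`_k].
have LM k l q1 r1 q2 r2 : L k q1 r1 -> L l q2 r2 -> L (k + l)%N (q1 * q2) (r1 * r2).
  have sz (q r : {poly K}) : (size q <= k.+1)%N -> (size r <= l.+1)%N ->
      (size (q * r)%R <= (k + l).+1)%N.
    move=> qk rl; apply: leq_trans (size_polyMleq _ _) _.
    by rewrite -ltnS; case: (size q + size r)%N (leq_add qk rl) => //= s;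
      rewrite addSn addnS.
  have cf (q r : {poly K}) : (size q <= k.+1)%N -> (size r <= l.+1)%N ->
      (q * r)`_(k + l) = q`_k * r`_l.
    move=> qk rl; rewrite coefM (bigD1 (inord k)) //= inordK ?ltnS ?leq_addr //.
    rewrite addKn big1 ?addr0 // => j; rewrite -val_eqE /= inordK ?ltnS ?leq_addr // => jk.
    case: (ltngtP j k) jk => // jk _.
      rewrite [r`__]nth_default ?mulr0 //; apply: leq_trans rl _; lia.
    by rewrite nth_default ?mul0r //; apply: leq_trans qk _.
  move=> [? ? e1] [? ? e2]; split; rewrite ?sz //.
  by rewrite !cf // e1 e2.
move=> su sv euv; have Lm m : L (mdeg m * d)%N (mmap1 u m) (mmap1 v m).
  rewrite mdegE big_distrl /=; rewrite /mmap1.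
  elim/big_rec3: _ => [|i k q r _ IH]; first by split; rewrite ?size_poly1.
  apply: (LM) IH; elim: (m i) => [|e IHe]; first by split; rewrite ?expr0 ?size_poly1.
  by rewrite !exprS mulSn; apply: (LM) IHe; split.
move=> pN; suff [] : L (N * d)%N (mmap polyC u p) (mmap polyC v p) by [].
rewrite /mmap !big_seq; apply: (big_rec2 (fun q r => L (N * d)%N q r)).
  by split; rewrite ?size_poly0.
move=> m q r mp [sq sr e].
have [sm1 sm2 em] := Lm m; have mN : (mdeg m <= N)%N.
  by rewrite -ltnS; apply: leq_trans pN; apply: msize_mdeg_lt.
have mNd : (mdeg m * d <= N * d)%N by rewrite leq_mul2r mN orbT.
have szC (w : {poly K}) : (size w <= (mdeg m * d).+1)%N ->
    (size ((p@_m)%:P * w)%R <= (N * d).+1)%N.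
  move=> ws; rewrite mul_polyC; apply: leq_trans (size_scale_leq _ _) _.
  exact: leq_trans ws _.
split.
- by apply: leq_trans (size_polyD _ _) _; rewrite geq_max szC.
- by apply: leq_trans (size_polyD _ _) _; rewrite geq_max szC.
rewrite !coefD e !coefCM; congr (_ * _ + _).
move: mNd; rewrite leq_eqVlt => /predU1P[<-//|mNd].
by rewrite !nth_default //; [exact: leq_trans sm2 _|exact: leq_trans sm1 _].
Qed.

Lemma dhomog_mderiv n (K : comNzRingType) d i (p : {mpoly K[n]}) :
  p \is d.+1.-homog -> p^`M(i) \is d.-homog.
Proof.
move=> pd; apply/dhomogP => m mp; apply/eqP; apply: contraTT mp => md.
rewrite -mcoeff_eq0 mcoeff_mderiv (dhomog_nemf_coeff pd) ?mul0rn //.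
by rewrite /= mdegD mdeg1 addn1 eqSS.
Qed.

Lemma meval_homogZ n (K : comNzRingType) d t (x y : 'I_n -> K) (p : {mpoly K[n]}) :
  p \is d.-homog -> (forall i, y i = t * x i) -> p.@[y] = t ^+ d * p.@[x].
Proof.
move=> /dhomogP pd xy; rewrite !mevalE mulr_sumr !big_seq; apply: eq_bigr => m mp.
rewrite mulrCA; congr (_ * _).
under eq_bigr do rewrite xy exprMn.
by rewrite big_split /= -expr_sum -mdegE (pd m mp).
Qed.

Definition vec3 (A : nzRingType) (a b c : A) : 'I_3 -> A := fun i => [:: a; b; c]`_i.

Definition mline n (K : comNzRingType) (x v : 'I_n -> K) : 'I_n -> {poly K} :=
  fun i => (x i)%:P + v i *: 'X.

Lemma horner_mline n (K : comNzRingType) (x v : 'I_n -> K) t i :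
  (mline x v i).[t] = x i + t * v i.
Proof. by rewrite /mline !hornerE mulrC. Qed.

Lemma deriv_mline n (K : comNzRingType) (x v : 'I_n -> K) i :
  (mline x v i)^`() = (v i)%:P.
Proof. by rewrite /mline derivD derivC add0r derivZ derivX alg_polyC. Qed.

Lemma horner_deriv_mline n (K : comNzRingType) (x v : 'I_n -> K) (p : {mpoly K[n]}) t :
  (mmap polyC (mline x v) p)^`().[t] =
  \sum_i (p^`M(i)).@[fun i => x i + t * v i] * v i.
Proof.
rewrite deriv_mmap_polyC horner_sum; apply: eq_bigr => i _.
rewrite hornerM deriv_mline hornerC horner_mmap_polyC; congr (_ * _).
by apply: meval_eq => j; rewrite horner_mline.
Qed.

Lemma hess_formE (R : realType) (f : {mpoly R[3]}) x v :
  hess_form f x v = 2 * (mmap polyC (mline x v) f)`_2.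
Proof.
have -> : 2 * (mmap polyC (mline x v) f)`_2 = (mmap polyC (mline x v) f)^`()^`().[0].
  by rewrite horner_coef0 !coef_deriv -mulrnA mulr_natl.
rewrite deriv_mmap_polyC /hess_form raddf_sum horner_sum; apply: eq_bigr => i _ /=.
rewrite deriv_mline derivM derivC mulr0 addr0 hornerM hornerC horner_deriv_mline mulr_suml.
apply: eq_bigr => j _; rewrite -!mulrA [v i * _]mulrC; congr (_ * _).
by apply: meval_eq => k; rewrite mul0r addr0.
Qed.

(** On a coordinate line through [x] the polynomial is t (c + t s(t)), where c is the partial
    derivative and s is bounded by some b for |t| <= 1. Nonnegativity at t and at -t gives |c| <= b
    t for all small t > 0. *)
Lemma psd_mderiv_eq0 n (F : realFieldType) (p : {mpoly F[n]}) x :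
  (forall y, 0 <= p.@[y]) -> p.@[x] = 0 -> forall i, (p^`M(i)).@[x] = 0.
Proof.
move=> p_ge0 px0 i; pose v (j : 'I_n) : F := (i == j)%:R.
pose q := mmap polyC (mline x v) p.
have q_ge0 t : 0 <= q.[t] by rewrite horner_mmap_polyC.
have q0 : q.[0] = 0.
  rewrite horner_mmap_polyC -[RHS]px0; apply: meval_eq => j.
  by rewrite horner_mline mul0r addr0.
suff : q^`().[0] = 0.
  rewrite horner_deriv_mline (bigD1 i) //= big1 => [|j ji]; last first.
    by rewrite /v eq_sym (negPf ji) mulr0.
  rewrite /v eqxx mulr1 addr0 => <-.
  by apply: meval_eq => j; rewrite mul0r addr0.
have /factor_theorem[r qr] : root q 0 by apply/rootP.
rewrite subr0 in qr.
have /factor_theorem[s rs] : root (r - (r.[0])%:P) 0.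
  by rewrite rootE !hornerE subrr.
rewrite subr0 in rs.
have rE t : r.[t] = r.[0] + t * s.[t].
  have := congr1 (fun w => w.[t]) rs; rewrite !hornerE => /eqP.
  by rewrite subr_eq addrC mulrC => /eqP.
have qE t : q.[t] = t * (r.[0] + t * s.[t]).
  by rewrite qr !hornerE -rE mulrC.
have -> : q^`().[0] = r.[0].
  by rewrite qr derivM derivX !hornerE.
have [b sb] := poly_disk_bound s 1.
have b_ge0 : 0 <= b by apply: le_trans (sb 0 _); rewrite ?normr0.
have small t : `|t| <= 1 -> - b * t ^+ 2 <= t * r.[0].
  move=> t1; have := q_ge0 t; rewrite qE.
  by have := sb t t1; rewrite ler_norml => /andP[s1 s2]; nra.
apply/eqP; rewrite -normr_le0 leNgt; apply/negP => c_gt0.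
have [t [t_gt0 t1 tb]] : exists t : F, [/\ 0 < t, t <= 1 & b * t < `|r.[0]|].
  exists (`|r.[0]| / (b + `|r.[0]| + 1)); split.
  - by apply: divr_gt0 => //; lra.
  - by rewrite ler_pdivrMr; lra.
  - by rewrite mulrA ltr_pdivrMr; nra.
have h1 := small t; have h2 := small (- t); rewrite normrN in h2.
rewrite ger0_norm ?(ltW t_gt0) // in h1 h2; have {}h1 := h1 t1; have {}h2 := h2 t1.
have : `|r.[0]| <= b * t.
  by rewrite ler_norml; apply/andP; split; rewrite -(ler_pM2l t_gt0); nra.
by rewrite leNgt tb.
Qed.

(** The product over [rs] is separable, so its derivative does not vanish on [rs]; hence the
    cofactor of this product in [p] still has all of [rs] as roots, which is too many for its
    size. *)
Lemma double_roots_eq0 (F : fieldType) (p : {poly F}) (rs : seq F) :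
  uniq rs -> all (root p) rs -> all (root p^`()) rs ->
  (size p <= 2 * size rs)%N -> p = 0.
Proof.
move=> rs_uniq p_rs dp_rs p_size.
have /(uniq_roots_prod_XsubC p_rs)[q pq] : uniq_roots rs by rewrite uniq_rootsE.
have q_rs : all (root q) rs.
  apply/allP => z z_rs; have := allP dp_rs z z_rs.
  rewrite pq derivM rootE hornerD !hornerM.
  have /rootP -> : root (\prod_(z <- rs) ('X - z%:P)) z by rewrite root_prod_XsubC.
  rewrite mulr0 add0r mulf_eq0 => /orP[//|/rootP dz].
  have : separable_poly (\prod_(z <- rs) ('X - z%:P)) by rewrite separable_prod_XsubC.
  rewrite unlock => /coprimep_root pr.
  by have := pr z; rewrite root_prod_XsubC dz eqxx => /(_ z_rs).
have [q0|q_neq0] := eqVneq q 0; first by rewrite pq q0 mul0r.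
have q_size := max_poly_roots q_neq0 q_rs rs_uniq.
have pr0 : \prod_(z <- rs) ('X - z%:P) != 0 by rewrite -size_poly_gt0 size_prod_XsubC.
move: p_size; rewrite pq size_mul // size_prod_XsubC addnS /=.
by rewrite mul2n -addnn leq_add2r leqNgt q_size.
Qed.

(** * The weighted form and its positivity *)

Section SexticFamily.
Variable A : comNzRingType.
Implicit Types k d e p q a b c x y : A.

Definition kap k : A := 1 + k ^+ 2.
(** These are the coefficients that appear after substituting y = e - d x in the parametrisation: p
    = k e x - rho x^2 and q = e^2 x + quad e x^2 + cub x^3. The point y = k kap x, where the cubic
    touches the discriminant, is e = theta x. *)
Definition rho k d : A := k * d - kap k.
Definition theta k d : A := k * kap k + d.
Definition quad k d : A := k * kap k - 2 * d.
Definition cub k d : A := d ^+ 2 - k * kap k * d + 2 * kap k ^+ 2.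

Definition lin k d e p : A :=
  e * (k * kap k ^+ 3 * e ^+ 2
       - (2 * rho k d ^+ 2 * quad k d + 3 * k * rho k d * cub k d) * p).

(** The implicit equation of the parametrised cubic: rho^3 times the product of q - qpar(x) over the
    two roots x of rho x^2 - k e x + p. *)
Definition wsextic k d e p q : A :=
  rho k d ^+ 3 * q ^+ 2 - lin k d e p * q
  + p * (kap k ^+ 3 * e ^+ 4
         + (quad k d ^+ 2 * rho k d + k * quad k d * cub k d
            - 2 * rho k d * cub k d) * e ^+ 2 * p
         + cub k d ^+ 2 * p ^+ 2).

Definition pform a b c : A :=
  a ^+ 2 + b ^+ 2 + c ^+ 2 - a * b - b * c - c * a.

Definition qform a b c : A :=
  (2 * a - b - c) * (2 * b - c - a) * (2 * c - a - b).

Definition sextic k d h a b c : A :=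
  wsextic k d (h * (a + b + c)) (pform a b c) (qform a b c).

Definition ppar k x y : A := x * (k * y + kap k * x).
Definition qpar k x y : A :=
  x * (y ^+ 2 + k * kap k * x * y + 2 * kap k ^+ 2 * x ^+ 2).

Lemma wsextic_par k d x y :
  wsextic k d (y + d * x) (ppar k x y) (qpar k x y) = 0.
Proof.
rewrite /wsextic /lin /ppar /qpar /quad /cub /rho /kap; ring.
Qed.

(** For given e and p the parameter x is a root of rho x^2 - k e x + p, whose other root is (k y +
    kap x) / rho. The second factor is q - qpar at that root, multiplied by rho^3 to avoid the
    division. *)
Lemma wsextic_factor k d x y q :
  wsextic k d (y + d * x) (ppar k x y) q =
  (q - qpar k x y)
  * (rho k d ^+ 3 * q
     - qpar k (k * y + kap k * x)
              (rho k d * (y + d * x) - d * (k * y + kap k * x))).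
Proof.
by rewrite /wsextic /lin /ppar /qpar /quad /cub /rho /kap; ring.
Qed.

(** Completing the square in q. The discriminant is a linear factor times a square, which is the
    nodality of the cubic: the linear factor vanishes at the branch point of the projection to p,
    the squared one at the node. *)
Lemma wsextic_square k d e p q :
  4 * rho k d ^+ 3 * wsextic k d e p q =
    (2 * rho k d ^+ 3 * q - lin k d e p) ^+ 2
    + (4 * rho k d * p - k ^+ 2 * e ^+ 2)
      * (kap k ^+ 3 * e ^+ 2 - rho k d * cub k d * p) ^+ 2.
Proof. by rewrite /wsextic /lin /quad /cub /rho /kap; ring. Qed.

(** The squared factors locate the images of (1,1,1), at x = 0, and of (w,1,1), at e = theta x. *)
Lemma disc_par k x y :
  qpar k x y ^+ 2 - 4 * ppar k x y ^+ 3 =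
  x ^+ 2 * (y - k * kap k * x) ^+ 2 * ((y + 2 * k * x) ^+ 2 + 4 * x ^+ 2).
Proof. by rewrite /ppar /qpar /kap; ring. Qed.

Lemma disc_form a b c :
  4 * pform a b c ^+ 3 - qform a b c ^+ 2 =
  27 * ((a - b) * (b - c) * (c - a)) ^+ 2.
Proof. by rewrite /pform /qform; ring. Qed.

Lemma sexticC12 k d h a b c : sextic k d h b a c = sextic k d h a b c.
Proof.
have e1 : pform b a c = pform a b c by rewrite /pform; ring.
have e2 : qform b a c = qform a b c by rewrite /qform; ring.
by rewrite /sextic e1 e2 [b + a]addrC.
Qed.

Lemma sexticC23 k d h a b c : sextic k d h a c b = sextic k d h a b c.
Proof.
have e1 : pform a c b = pform a b c by rewrite /pform; ring.
have e2 : qform a c b = qform a b c by rewrite /qform; ring.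
by rewrite /sextic e1 e2 addrAC.
Qed.

End SexticFamily.

Section SexticMorph.
Variables (A B : comNzRingType) (f : {rmorphism A -> B}).

Lemma rmorph_kap k : f (kap k) = kap (f k).
Proof. by rewrite /kap rmorphD rmorph1 rmorphXn. Qed.

Lemma rmorph_rho k d : f (rho k d) = rho (f k) (f d).
Proof. by rewrite /rho rmorphB rmorphM rmorph_kap. Qed.

Lemma rmorph_quad k d : f (quad k d) = quad (f k) (f d).
Proof. by rewrite /quad rmorphB !rmorphM rmorph_kap rmorph_nat. Qed.

Lemma rmorph_cub k d : f (cub k d) = cub (f k) (f d).
Proof.
rewrite /cub -rmorph_kap; move: (kap k) => K.
by rewrite !(rmorphD, rmorphB, rmorphM, rmorphXn, rmorph1, rmorph_nat, rmorphN).
Qed.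

Lemma rmorph_pform a b c : f (pform a b c) = pform (f a) (f b) (f c).
Proof. by rewrite /pform !(rmorphB, rmorphD, rmorphM, rmorphXn). Qed.

Lemma rmorph_qform a b c : f (qform a b c) = qform (f a) (f b) (f c).
Proof. by rewrite /qform !(rmorphM, rmorphB) !rmorph_nat. Qed.

Lemma rmorph_lin k d e p : f (lin k d e p) = lin (f k) (f d) (f e) (f p).
Proof.
rewrite /lin -rmorph_kap -rmorph_rho -rmorph_quad -rmorph_cub.
move: (kap k) (rho k d) (quad k d) (cub k d) => K r q1 q2.
by rewrite !(rmorphB, rmorphD, rmorphM, rmorphXn, rmorph1, rmorph_nat, rmorphN).
Qed.

Lemma rmorph_wsextic k d e p q :
  f (wsextic k d e p q) = wsextic (f k) (f d) (f e) (f p) (f q).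
Proof.
rewrite /wsextic -rmorph_lin -rmorph_kap -rmorph_rho -rmorph_quad -rmorph_cub.
move: (lin k d e p) (kap k) (rho k d) (quad k d) (cub k d) => l K r q1 q2.
by rewrite !(rmorphB, rmorphD, rmorphM, rmorphXn, rmorph1, rmorph_nat, rmorphN).
Qed.

Lemma rmorph_sextic k d h a b c :
  f (sextic k d h a b c) = sextic (f k) (f d) (f h) (f a) (f b) (f c).
Proof.
by rewrite /sextic rmorph_wsextic rmorph_pform rmorph_qform rmorphM !rmorphD.
Qed.

End SexticMorph.

Section RealSextic.
Variable R : rcfType.
Implicit Types k d e p q : R.

(** For e nonzero, the node rho cub p = kap^3 e^2 has p > 0, and the last inequality says that 4 rho
    p > k^2 e^2 there: the two parameters of the node are complex conjugate, so it is isolated in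
    the real cubic. *)
Definition admissible k d : Prop :=
  [/\ 0 < k, 0 < rho k d, 0 < cub k d & k ^+ 2 * cub k d < 4 * kap k ^+ 3].

Lemma kap_gt0 k : 0 < kap k.
Proof. by rewrite /kap ltr_wpDr ?sqr_ge0. Qed.

Lemma theta_gt0 k d : admissible k d -> 0 < theta k d.
Proof.
case=> k0 r0 _ _; have K0 := kap_gt0 k.
have d0 : 0 < d by rewrite -(pmulr_rgt0 _ k0); rewrite /rho in r0; lra.
by rewrite /theta addr_gt0 // mulr_gt0.
Qed.

(* For [4 rho p < k^2 e^2] the roots [x, x'] of [rho x^2 - k e x + p] are
   real and [wsextic = rho^3 (q - qpar x) (q - qpar x')]; both factors are
   nonpositive because [qpar^2 >= 4 p^3 >= q^2] along the real quotient
   curve and [qpar >= 0] on [[0, k e / rho]]. *)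
Lemma qpar_ge k d e p q x : 0 < k -> 0 < rho k d ->
    0 <= x -> rho k d * x <= k * e -> rho k d * x ^+ 2 - k * e * x + p = 0 ->
    q ^+ 2 <= 4 * p ^+ 3 ->
  q <= qpar k x (e - d * x) /\
  (q = qpar k x (e - d * x) -> x = 0 \/ e = theta k d * x).
Proof.
move=> k0 r0 x0 xe px qp; have K0 := kap_gt0 k.
have pE : p = ppar k x (e - d * x).
  by rewrite /ppar; move: px; rewrite /rho /kap; nra.
have dq := disc_par k x (e - d * x).
have q_ge0 : 0 <= qpar k x (e - d * x).
  apply: mulr_ge0 => //; set y := e - d * x.
  have ky : 0 <= k * y + kap k * x by move: xe; rewrite /y /rho; lra.
  have h : 0 <= kap k * x * (k * y + kap k * x) by rewrite !mulr_ge0 // ltW.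
  have -> : y ^+ 2 + k * kap k * x * y + 2 * kap k ^+ 2 * x ^+ 2
     = y ^+ 2 + (kap k * x) ^+ 2 + kap k * x * (k * y + kap k * x) by ring.
  by rewrite !addr_ge0 // sqr_ge0.
have d_ge0 : 0 <= qpar k x (e - d * x) ^+ 2 - 4 * p ^+ 3.
  rewrite pE dq; apply: mulr_ge0; first by rewrite mulr_ge0 ?sqr_ge0.
  by rewrite addr_ge0 ?sqr_ge0 // mulr_ge0 ?sqr_ge0.
split=> [|qE].
  have [q_le0|/ltW q_gt0] := leP q 0; first exact: le_trans q_le0 q_ge0.
  by rewrite -(ler_pXn2r (n := 2)) //; lra.
have /eqP : qpar k x (e - d * x) ^+ 2 - 4 * p ^+ 3 = 0 by rewrite -qE in d_ge0 *; lra.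
rewrite pE dq; have [->|x_neq0] := eqVneq x 0; first by left.
have ?: 0 < x ^+ 2 by rewrite exprn_even_gt0.
rewrite mulf_eq0 orbC gt_eqF; last by rewrite ltr_wpDl ?sqr_ge0 // mulr_gt0.
rewrite mulf_eq0 !expf_eq0 (negPf x_neq0) /= subr_eq0 => /eqP yE; right.
by rewrite /theta; lra.
Qed.

(** The three alternatives describe the images of (1,1,1), of the contact point (w,1,1), and of the
    node (u,v,1). *)
Lemma wsextic_gt0e k d e p q : admissible k d -> 0 < e -> q ^+ 2 <= 4 * p ^+ 3 ->
  0 <= wsextic k d e p q /\
  (wsextic k d e p q = 0 ->
   [\/ p = 0,
       theta k d ^+ 2 * p = kap k ^+ 2 * e ^+ 2 /\
       theta k d ^+ 3 * q = 2 * kap k ^+ 3 * e ^+ 3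
     | rho k d * cub k d * p = kap k ^+ 3 * e ^+ 2 /\
       2 * rho k d ^+ 3 * q = lin k d e p]).
Proof.
move=> adm e0 qp; have [k0 r0 c0 kc] := adm; have K0 := kap_gt0 k.
have th0 := theta_gt0 adm.
have r30 : 0 < 4 * rho k d ^+ 3 by rewrite mulr_gt0 ?exprn_gt0.
have p0 : 0 <= p.
  rewrite leNgt; apply/negP => p_lt0.
  have p2 : 0 < p ^+ 2 by rewrite exprn_even_gt0 //= neq_lt p_lt0.
  by have := sqr_ge0 q; rewrite exprS in qp; nra.
(* Beyond the branch point both terms of [wsextic_square] are nonnegative, and they vanish together
   only at the node. *)
have [h|h] := ltP (k ^+ 2 * e ^+ 2) (4 * rho k d * p).
  have sq := wsextic_square k d e p q.
  set u := 2 * rho k d ^+ 3 * q - lin k d e p in sq.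
  set v := kap k ^+ 3 * e ^+ 2 - _ in sq.
  have u2 := sqr_ge0 u; have v2 := sqr_ge0 v.
  have h0 : 0 < 4 * rho k d * p - k ^+ 2 * e ^+ 2 by rewrite subr_gt0.
  have hv : 0 <= (4 * rho k d * p - k ^+ 2 * e ^+ 2) * v ^+ 2.
    by rewrite mulr_ge0 // ltW.
  split=> [|w0]; first by rewrite -(pmulr_rge0 _ r30) sq addr_ge0.
  rewrite w0 mulr0 in sq.
  have /eqP : u ^+ 2 = 0 by lra.
  rewrite expf_eq0 /= subr_eq0 => /eqP uE; apply: Or33 _ => //; split=> //.
  have /eqP : (4 * rho k d * p - k ^+ 2 * e ^+ 2) * v ^+ 2 = 0 by lra.
  by rewrite mulf_eq0 gt_eqF //= expf_eq0 /= subr_eq0 => /eqP.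
(* On the other side rho x^2 - k e x + p has real roots (k e - s) / (2 rho) and (k e + s) / (2 rho).
   Since 0 <= s <= k e, both lie in the interval to which [qpar_ge] applies, so [wsextic] is a
   product of two nonpositive factors and rho^3. *)
pose s := Num.sqrt (k ^+ 2 * e ^+ 2 - 4 * rho k d * p).
have s2 : s ^+ 2 = k ^+ 2 * e ^+ 2 - 4 * rho k d * p by rewrite sqr_sqrtr // subr_ge0.
have s0 : 0 <= s := sqrtr_ge0 _.
have ke0 : 0 <= k * e by rewrite mulr_ge0 ?ltW.
have rp0 : 0 <= rho k d * p by rewrite mulr_ge0 // ltW.
have ske : s <= k * e.
  by rewrite -(ler_pXn2r (n := 2)) // s2 exprMn; lra.
have r_unit : rho k d \is a GRing.unit by rewrite unitfE gt_eqF.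
have {r_unit} [x rx] : exists x, 2 * rho k d * x = k * e - s.
  by exists ((k * e - s) / (2 * rho k d)); field; rewrite gt_eqF.
have [x' rx'] : exists x', 2 * rho k d * x' = k * e + s.
  by exists ((k * e + s) / (2 * rho k d)); field; rewrite gt_eqF.
have r20 : 0 < 2 * rho k d by rewrite mulr_gt0.
have x0 : 0 <= x by rewrite -(pmulr_rge0 _ r20) rx subr_ge0.
have x'0 : 0 <= x' by rewrite -(pmulr_rge0 _ r20) rx' addr_ge0.
have r_neq0 : rho k d != 0 by rewrite gt_eqF.
have px : rho k d * x ^+ 2 - k * e * x + p = 0.
  have xE : x = (k * e - s) / (2 * rho k d) by rewrite -rx mulrAC mulfV ?mul1r ?gt_eqF.
  have pE : p = (k ^+ 2 * e ^+ 2 - s ^+ 2) / (4 * rho k d) by rewrite s2; field.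
  by rewrite pE xE; field.
have px' : rho k d * x' ^+ 2 - k * e * x' + p = 0.
  have xE : x' = (k * e + s) / (2 * rho k d) by rewrite -rx' mulrAC mulfV ?mul1r ?gt_eqF.
  have pE : p = (k ^+ 2 * e ^+ 2 - s ^+ 2) / (4 * rho k d) by rewrite s2; field.
  by rewrite pE xE; field.
have xx' : rho k d * x' = k * (e - d * x) + kap k * x by rewrite /rho in rx rx' *; lra.
have [q1 z1] : q <= qpar k x (e - d * x) /\
    (q = qpar k x (e - d * x) -> x = 0 \/ e = theta k d * x).
  by apply: qpar_ge px qp => //; lra.
have [q2 z2] : q <= qpar k x' (e - d * x') /\
    (q = qpar k x' (e - d * x') -> x' = 0 \/ e = theta k d * x').
  by apply: qpar_ge px' qp => //; lra.
have pE : p = ppar k x (e - d * x) by move: px; rewrite /ppar /rho; lra.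
have pE' : p = ppar k x' (e - d * x') by move: px'; rewrite /ppar /rho; lra.
have wE : wsextic k d e p q =
    rho k d ^+ 3 * ((q - qpar k x (e - d * x)) * (q - qpar k x' (e - d * x'))).
  have := wsextic_factor k d x (e - d * x) q.
  rewrite -pE -xx' subrK => ->; rewrite /qpar; ring.
split=> [|/eqP].
  rewrite wE; apply: mulr_ge0; first by rewrite exprn_ge0 // ltW.
  by rewrite -mulrNN mulr_ge0 // oppr_ge0 subr_le0.
have zero y : p = ppar k y (e - d * y) -> q = qpar k y (e - d * y) ->
    y = 0 \/ e = theta k d * y ->
    p = 0 \/ theta k d ^+ 2 * p = kap k ^+ 2 * e ^+ 2 /\
              theta k d ^+ 3 * q = 2 * kap k ^+ 3 * e ^+ 3.
  move=> -> -> [->|eE]; [left | right].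
    by rewrite /ppar mul0r.
  by rewrite /ppar /qpar eE /theta; split; rewrite /kap; ring.
rewrite wE mulf_eq0 expf_eq0 (negPf r_neq0) /= mulf_eq0 !subr_eq0.
case/orP=> /eqP qE.
  by case: (zero x pE qE (z1 qE)); [exact: Or31|exact: Or32].
by case: (zero x' pE' qE (z2 qE)); [exact: Or31|exact: Or32].
Qed.

Lemma wsexticN k d e p q : wsextic k d (- e) p (- q) = wsextic k d e p q.
Proof. by rewrite /wsextic /lin; ring. Qed.

Lemma wsextic_psd k d e p q : admissible k d -> q ^+ 2 <= 4 * p ^+ 3 ->
  0 <= wsextic k d e p q /\
  (wsextic k d e p q = 0 ->
   [\/ p = 0,
       theta k d ^+ 2 * p = kap k ^+ 2 * e ^+ 2 /\
       theta k d ^+ 3 * q = 2 * kap k ^+ 3 * e ^+ 3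
     | rho k d * cub k d * p = kap k ^+ 3 * e ^+ 2 /\
       2 * rho k d ^+ 3 * q = lin k d e p]).
Proof.
move=> adm qp; have [e_lt0|e_gt0|->] := ltrgtP e 0; last first.
- have [k0 r0 c0 _] := adm.
  have p0 : 0 <= p.
    rewrite leNgt; apply/negP => p_lt0.
    have p2 : 0 < p ^+ 2 by rewrite exprn_even_gt0 //= neq_lt p_lt0.
    by have := sqr_ge0 q; rewrite exprS in qp; nra.
  have -> : wsextic k d 0 p q = rho k d ^+ 3 * q ^+ 2 + cub k d ^+ 2 * p ^+ 3.
    by rewrite /wsextic /lin; ring.
  have h1 : 0 <= rho k d ^+ 3 * q ^+ 2 by rewrite mulr_ge0 ?sqr_ge0 // exprn_ge0 // ltW.
  have h2 : 0 <= cub k d ^+ 2 * p ^+ 3 by rewrite mulr_ge0 ?sqr_ge0 // exprn_ge0.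
  split=> [|w0]; first exact: addr_ge0.
  have /eqP : cub k d ^+ 2 * p ^+ 3 = 0 by lra.
  by rewrite mulf_eq0 !expf_eq0 /= gt_eqF //= => /eqP; exact: Or31.
- exact: wsextic_gt0e.
have Ne_gt0 : 0 < - e by rewrite oppr_gt0.
have Nqp : (- q) ^+ 2 <= 4 * p ^+ 3 by rewrite sqrrN.
have [w_ge0 w_eq0] := wsextic_gt0e adm Ne_gt0 Nqp.
rewrite wsexticN in w_ge0 w_eq0; split=> // /w_eq0[->|[h1 h2]|[h1 h2]].
- exact: Or31.
- apply: Or32 _; split; first by rewrite h1 sqrrN.
  by apply: oppr_inj; rewrite -mulrN h2; ring.
apply: Or33 _; split; first by rewrite h1 sqrrN.
by apply: oppr_inj; rewrite -mulrN h2 /lin; ring.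
Qed.

End RealSextic.

(** * The sextic as a symmetric form, and the list of its real zeros *)

Lemma ord3P (i : 'I_3) : [\/ i = 0, i = 1 | i = 2].
Proof.
by case: i => [[|[|[|//]]] i]; [apply: Or31|apply: Or32|apply: Or33]; apply: val_inj.
Qed.

Definition mpoly_sextic (K : comNzRingType) (k d h : K) : {mpoly K[3]} :=
  sextic k%:MP d%:MP h%:MP 'X_0 'X_1 'X_2.

Lemma meval_sextic (K : comNzRingType) (k d h : K) x :
  (mpoly_sextic k d h).@[x] = sextic k d h (x 0) (x 1) (x 2).
Proof. by rewrite rmorph_sextic /= !mevalC !mevalXU. Qed.

Lemma mmap_sextic (K : comNzRingType) (k d h : K) (y : 'I_3 -> {poly K}) :
  mmap polyC y (mpoly_sextic k d h) =
  sextic k%:P d%:P h%:P (y 0) (y 1) (y 2).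
Proof. by rewrite rmorph_sextic /= !mmapC !mmapX !mmap1U. Qed.

Lemma map_mpoly_sextic (K L : comNzRingType) (f : {rmorphism K -> L}) (k d h : K) :
  map_mpoly f (mpoly_sextic k d h) = mpoly_sextic (f k) (f d) (f h).
Proof. by rewrite rmorph_sextic /= !map_mpolyC !map_mpolyX. Qed.

Lemma dhomog_sextic (K : comNzRingType) (k d h : K) :
  mpoly_sextic k d h \is 6.-homog.
Proof.
have hX i : ('X_i : {mpoly K[3]}) \is 1.-homog by rewrite dhomogX /= mdeg1.
have hC (c : K) n (p : {mpoly K[3]}) : p \is n.-homog -> c%:MP * p \is n.-homog.
  by move=> pn; rewrite mul_mpolyC dhomogZ.
have hM m n (p q : {mpoly K[3]}) : p \is m.-homog -> q \is n.-homog ->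
  p * q \is (m + n).-homog by exact: dhomogM.
have hn m n (p : {mpoly K[3]}) : p \is m.-homog -> p ^+ n \is (m * n).-homog
  by exact: dhomogMn.
rewrite /mpoly_sextic /sextic.
set e := _ * (_ + _ + _); set p := pform _ _ _; set q := qform _ _ _.
have he : e \is 1.-homog by rewrite hC // !rpredD ?hX.
have hp : p \is 2.-homog.
  by rewrite /p /pform !(rpredB, rpredD) ?(hn 1%N 2%N) ?(hM 1%N 1%N).
have h2 i : 2 * ('X_i : {mpoly K[3]}) \is 1.-homog by rewrite mulr_natl rpredMn.
have hq : q \is 3.-homog.
  have hl (i j l : 'I_3) : (2 * 'X_i - 'X_j - 'X_l : {mpoly K[3]}) \is 1.-homog.
    by rewrite !rpredB ?h2 ?hX.
  by apply: (hM 2%N 1%N); first apply: (hM 1%N 1%N); exact: hl.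
clearbody e p q.
pose C3 c : {mpoly K[3]} := (c : K)%:MP.
have -> : wsextic k%:MP d%:MP e p q =
  C3 (rho k d ^+ 3) * q ^+ 2 - e * (C3 (k * kap k ^+ 3) * e ^+ 2 -
   C3 (2 * rho k d ^+ 2 * quad k d + 3 * k * rho k d * cub k d) * p) * q +
  p * (C3 (kap k ^+ 3) * e ^+ 4 + C3 (quad k d ^+ 2 * rho k d + k * quad k d * cub k d
            - 2 * rho k d * cub k d) * (e ^+ 2 * p) + C3 (cub k d ^+ 2) * p ^+ 2).
  rewrite /wsextic /lin -rmorph_kap -rmorph_rho -rmorph_quad -rmorph_cub /C3.
  move: (kap k) (rho k d) (quad k d) (cub k d) => K1 r1 q1 q2.
  by rewrite !(rmorphB, rmorphD, rmorphM, rmorphXn, rmorph1, rmorph_nat, rmorphN); ring.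
rewrite /C3 rpredD ?rpredB //.
- by apply/hC/(hn 3%N 2%N).
- by apply: (hM 3%N 3%N) => //; apply: (hM 1%N 2%N) => //;
    rewrite rpredB // hC // (hn 1%N 2%N).
apply: (hM 2%N 4%N) => //; rewrite !rpredD // hC //.
- exact: (hn 1%N 4%N).
- by apply: (hM 2%N 2%N) => //; apply: (hn 1%N 2%N).
- exact: (hn 2%N 2%N).
Qed.

Lemma sextic_perm (K : comNzRingType) (k d h : K) (x : 'I_3 -> K) (s : 'I_3 -> 'I_3) :
  injective s ->
  sextic k d h (x (s 0)) (x (s 1)) (x (s 2)) = sextic k d h (x 0) (x 1) (x 2).
Proof.
move=> s_inj.
have s01 : s 0 <> s 1 by move/s_inj.
have s02 : s 0 <> s 2 by move/s_inj.
have s12 : s 1 <> s 2 by move/s_inj.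
case: (ord3P (s 0)) s01 s02 => -> s01 s02; case: (ord3P (s 1)) s01 s12 => -> // _ s12;
  case: (ord3P (s 2)) s02 s12 => -> // _ _.
- by rewrite sexticC23.
- by rewrite sexticC12.
- by rewrite sexticC23 sexticC12.
- by rewrite sexticC12 sexticC23.
- by rewrite sexticC12 sexticC23 sexticC12.
Qed.

Lemma sym_sextic (K : comNzRingType) (k d h : K) :
  mpoly_sextic k d h \is symmetric.
Proof.
apply/issymP => s; rewrite /mpoly_sextic rmorph_sextic /=.
have msC (c : K) : msym s c%:MP = c%:MP :> {mpoly K[3]}.
  by rewrite -alg_mpolyC msymZ msym1.
have msX i : msym s 'X_i = 'X_(s i) :> {mpoly K[3]}.
  rewrite msymX; congr 'X_[_]; apply/mnmP => j; rewrite mnmE !mnm1E.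
  by rewrite -(inj_eq (@perm_inj _ s)) permKV.
rewrite !msC !msX.
by apply: (sextic_perm _ _ _ (fun i => 'X_i : {mpoly K[3]})); apply: perm_inj.
Qed.

(* The data of the theorem in the normalisation of the quotient curve: the
   three kinds of real zeros are [(1,1,1)], [(w,1,1)] (where the quotient curve
   touches the discriminant) and [(u,v,1)] (its node). *)
Record fitted (R : rcfType) (k d h u v w : R) : Prop := Fitted {
  fit_adm : admissible k d;
  fit_rho : rho k d != kap k ^+ 2;
  fit_h : h != 0;
  fit_w1 : w != 1;
  fit_w2 : w + 2 != 0;
  fit_w : kap k * h * (w + 2) = theta k d * (w - 1);
  fit_uv : u != v;
  fit_u1 : u != 1;
  fit_v1 : v != 1;
  fit_sum : u + v + 1 != 0;
  fit_p : rho k d * cub k d * pform u v 1 = kap k ^+ 3 * (h * (u + v + 1)) ^+ 2;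
  fit_q : 2 * rho k d ^+ 3 * qform u v 1 =
          lin k d (h * (u + v + 1)) (pform u v 1)
}.

(** Every representative has coordinate sum 1, which turns projective equality into equality of
    triples. *)
Definition zeros (R : rcfType) (u v w : R) : seq (R * R * R) :=
  let s := u + v + 1 in let t := w + 2 in
  [:: (u / s, v / s, 1 / s); (u / s, 1 / s, v / s); (v / s, u / s, 1 / s);
      (v / s, 1 / s, u / s); (1 / s, u / s, v / s); (1 / s, v / s, u / s);
      (w / t, 1 / t, 1 / t); (1 / t, w / t, 1 / t); (1 / t, 1 / t, w / t);
      (1 / 3, 1 / 3, 1 / 3)].

Lemma pform_eq0 (R : realDomainType) (a b c : R) :
  pform a b c = 0 -> a = b /\ b = c.
Proof.
rewrite /pform => p0.
have h : (a - b) ^+ 2 + (b - c) ^+ 2 + (c - a) ^+ 2 = 0.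
  by rewrite -(mulr0 2) -p0; ring.
have := (sqr_ge0 (a - b), sqr_ge0 (b - c), sqr_ge0 (c - a)) => -[[h1 h2] h3].
have /eqP : (a - b) ^+ 2 = 0 by lra.
have /eqP : (b - c) ^+ 2 = 0 by lra.
by rewrite !expf_eq0 /= !subr_eq0 => /eqP-> /eqP->.
Qed.

(** In characteristic 0 the sum, [pform] and [qform] determine the elementary symmetric functions,
    hence the monic cubic with roots a, b, c. *)
Lemma eq_invariants (F : numFieldType) (a b c u v n : F) :
    a + b + c = u + v + n -> pform a b c = pform u v n ->
    qform a b c = qform u v n ->
  (a, b, c) \in [:: (u, v, n); (u, n, v); (v, u, n); (v, n, u); (n, u, v); (n, v, u)].
Proof.
move=> e1 p1 q1.
have e2 : a * b + b * c + c * a = u * v + v * n + n * u.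
  apply: (mulfI (x := 3)); first by rewrite pnatr_eq0.
  have -> : 3 * (a * b + b * c + c * a) = (a + b + c) ^+ 2 - pform a b c.
    by rewrite /pform; ring.
  by rewrite e1 p1 /pform; ring.
have e3 : a * b * c = u * v * n.
  apply: (mulfI (x := 27)); first by rewrite pnatr_eq0.
  have -> : 27 * (a * b * c) = qform a b c - 2 * (a + b + c) ^+ 3
      + 9 * (a + b + c) * (a * b + b * c + c * a) by rewrite /qform; ring.
  by rewrite e1 e2 q1 /qform; ring.
have root x : x \in [:: a; b; c] -> (x - u) * (x - v) * (x - n) = 0.
  have -> : (x - u) * (x - v) * (x - n) = (x - a) * (x - b) * (x - c)
     + ((a + b + c) - (u + v + n)) * x ^+ 2
     - ((a * b + b * c + c * a) - (u * v + v * n + n * u)) * x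
     + (a * b * c - u * v * n) by ring.
  rewrite e1 e2 e3 !subrr !mul0r addr0 subr0 addr0 !inE.
  by move=> /or3P[] /eqP ->; rewrite subrr ?(mul0r, mulr0).
have two (x y s t : F) : x + y = s + t -> x * y = s * t ->
    (x, y) \in [:: (s, t); (t, s)].
  move=> sE tE; have /eqP : (x - s) * (x - t) = 0.
    have -> : (x - s) * (x - t) = x * (x + y - (s + t)) - (x * y - s * t) by ring.
    by rewrite sE tE !subrr mulr0 subrr.
  rewrite mulf_eq0 !subr_eq0 !inE !xpair_eqE => /orP[] /eqP xE; move: sE; rewrite xE.
    by move/addrI => ->; rewrite !eqxx.
  by rewrite [s + t]addrC => /addrI ->; rewrite !eqxx orbT.
have rest (x y z s t r : F) : x = r -> x + y + z = r + s + t ->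
    x * y + y * z + z * x = r * s + s * t + t * r -> (y, z) \in [:: (s, t); (t, s)].
  move=> -> h1 h2; have yz : y + z = s + t by move: h1; rewrite -!addrA => /addrI.
  apply: two => //.
  have -> : y * z = r * y + y * z + z * r - r * (y + z) by ring.
  by rewrite h2 yz; ring.
have := root a; rewrite mem_head => /(_ isT)/eqP.
rewrite !mulf_eq0 !subr_eq0 -orbA => /or3P[] /eqP aE.
- have := rest a b c v n u aE e1 e2.
  by rewrite !inE !xpair_eqE aE eqxx /= => /orP[] ->; rewrite ?orbT.
- have := rest a b c u n v aE; rewrite e1 e2 => /(_ _ _); rewrite !inE !xpair_eqE aE eqxx.
  case/(_ _ _)/orP; [ring|ring| |] => ->; rewrite ?andbT ?orbT //.
- have := rest a b c u v n aE; rewrite e1 e2 => /(_ _ _); rewrite !inE !xpair_eqE aE eqxx.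
  case/(_ _ _)/orP; [ring|ring| |] => ->; rewrite ?andbT ?orbT //.
Qed.

Lemma pformZ (K : comNzRingType) (t a b c : K) :
  pform (t * a) (t * b) (t * c) = t ^+ 2 * pform a b c.
Proof. by rewrite /pform; ring. Qed.

Lemma qformZ (K : comNzRingType) (t a b c : K) :
  qform (t * a) (t * b) (t * c) = t ^+ 3 * qform a b c.
Proof. by rewrite /qform; ring. Qed.

Lemma fitted_zeros (R : rcfType) (k d h u v w a b c : R) :
    fitted k d h u v w -> a + b + c = 1 -> sextic k d h a b c = 0 ->
  (a, b, c) \in zeros u v w.
Proof.
case=> adm rk h0 w1 w2 wE uv u1 v1 s0 pE qE abc f0.
have [k0 r0 c0 _] := adm; have K0 := kap_gt0 k; have th0 := theta_gt0 adm.
have qp : qform a b c ^+ 2 <= 4 * pform a b c ^+ 3.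
  by rewrite -subr_ge0 disc_form mulr_ge0 ?sqr_ge0.
(* The numbers theta (x - y) and kap h have equal squares and equal cubes, so they are equal without
   any ambiguity of sign; [fit_w] then identifies the point. *)
have twin x y : x + 2 * y = 1 -> theta k d ^+ 2 * (x - y) ^+ 2 = kap k ^+ 2 * h ^+ 2 ->
    theta k d ^+ 3 * (2 * (x - y) ^+ 3) = 2 * kap k ^+ 3 * h ^+ 3 ->
    x = w / (w + 2) /\ y = 1 / (w + 2).
  move=> xy1 h2 h3; have kh : (kap k * h) ^+ 2 != 0 by rewrite expf_eq0 mulf_neq0 // gt_eqF.
  have tE : theta k d * (x - y) = kap k * h.
    have sq : (theta k d * (x - y)) ^+ 2 = (kap k * h) ^+ 2 by rewrite !exprMn.
    have cu : (theta k d * (x - y)) ^+ 3 = (kap k * h) ^+ 3.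
      by apply: (mulfI (x := 2)); rewrite ?pnatr_eq0 // !exprMn mulrCA h3 -!mulrA.
    by apply: (mulIf kh); rewrite -[in LHS]sq -!exprS.
  have zE : (x - y) * (w + 2) = w - 1.
    by apply: (mulfI (lt0r_neq0 th0)); rewrite -wE -tE mulrA.
  have xE : x = 1 - 2 * y by lra.
  rewrite xE in zE *.
  by split; apply: (mulIf w2); rewrite divfK //; lra.
have [_ /(_ f0)] := wsextic_psd (h * (a + b + c)) adm qp.
rewrite abc mulr1 => -[/pform_eq0[ab bc]|[p1 q1]|[p1 q1]].
- have aE : a = 1 / 3 by subst; lra.
  by rewrite -bc -ab aE !inE eqxx !orbT.
(* The contact alternative gives q^2 = 4p^3, so two of the coordinates coincide. *)
- have : 27 * ((a - b) * (b - c) * (c - a)) ^+ 2 = 0.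
    apply: (mulfI (x := theta k d ^+ 6)); first by rewrite expf_eq0 gt_eqF.
    rewrite -disc_form mulr0.
    have -> : theta k d ^+ 6 * (4 * pform a b c ^+ 3 - qform a b c ^+ 2) =
      4 * (theta k d ^+ 2 * pform a b c) ^+ 3 - (theta k d ^+ 3 * qform a b c) ^+ 2.
      by ring.
    by rewrite p1 q1; ring.
  move/eqP; rewrite mulf_eq0 pnatr_eq0 /= expf_eq0 /= !mulf_eq0 !subr_eq0.
  case/orP=> [/orP[]|] /eqP xy; move: abc p1 q1; rewrite xy => abc p1 q1.
  - have [|||-> ->] := twin c b; first by lra.
    + by rewrite -p1 /pform; ring.
    + by rewrite -q1 /qform; ring.
    by rewrite !inE eqxx !orbT.
  - have [|||-> ->] := twin a c; first by lra.
    + by rewrite -p1 /pform; ring.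
    + by rewrite -q1 /qform; ring.
    by rewrite !inE eqxx !orbT.
  have [|||-> ->] := twin b a; first by lra.
  + by rewrite -p1 /pform; ring.
  + by rewrite -q1 /qform; ring.
  by rewrite !inE eqxx !orbT.
set s := u + v + 1 in s0 pE qE.
have uE : (u = s * (u / s)) * (v = s * (v / s)) * (1 = s * (1 / s)).
  by rewrite ![s * _]mulrC !divfK.
have pS : pform u v 1 = s ^+ 2 * pform (u / s) (v / s) (1 / s).
  by rewrite -pformZ -uE.2 -uE.1.1 -uE.1.2.
have qS : qform u v 1 = s ^+ 3 * qform (u / s) (v / s) (1 / s).
  by rewrite -qformZ -uE.2 -uE.1.1 -uE.1.2.
have p2 : pform a b c = pform (u / s) (v / s) (1 / s).
  apply: (mulfI (x := rho k d * cub k d)); first by rewrite mulf_neq0 ?gt_eqF.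
  rewrite p1; apply: (mulfI (x := s ^+ 2)); first by rewrite expf_eq0.
  transitivity (kap k ^+ 3 * (h * s) ^+ 2); first by ring.
  by rewrite -pE pS; ring.
have q2 : qform a b c = qform (u / s) (v / s) (1 / s).
  apply: (mulfI (x := 2 * rho k d ^+ 3)); first by rewrite mulf_neq0 ?expf_eq0 ?gt_eqF.
  rewrite q1; apply: (mulfI (x := s ^+ 3)); first by rewrite expf_eq0.
  transitivity (lin k d (h * s) (s ^+ 2 * pform a b c)); first by rewrite /lin; ring.
  have -> : s ^+ 2 * pform a b c = pform u v 1.
    by rewrite p2 pS.
  by rewrite -qE qS; ring.
have e1 : a + b + c = u / s + v / s + 1 / s by rewrite abc -!mulrDl divff.
have := eq_invariants e1 p2 q2; rewrite !inE.
by do 5![case/orP=> [->|]; rewrite ?orbT //]; move=> ->; rewrite ?orbT.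
Qed.

(** * Hessians at the real zeros *)

(* First-order part in [T] of [wsextic] at [(a, b + t, b - t)], where
   [z = a - b] and [T = t^2], see [wsextic_twin]. *)
Definition twin_part (A : comNzRingType) (k d e z : A) : A :=
  let c1 := 2 * rho k d ^+ 2 * quad k d + 3 * k * rho k d * cub k d in
  let c2 := quad k d ^+ 2 * rho k d + k * quad k d * cub k d
            - 2 * rho k d * cub k d in
  18 * z * lin k d e (z ^+ 2) - 72 * rho k d ^+ 3 * z ^+ 4
  + 6 * c1 * e * z ^+ 3 + 3 * kap k ^+ 3 * e ^+ 4
  + 6 * c2 * e ^+ 2 * z ^+ 2 + 9 * cub k d ^+ 2 * z ^+ 4.

(** At (a, b + t, b - t) one has p = z^2 + 3t^2 and q = 2z^3 - 18zt^2. On the mirror line T = 0 the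
    sextic has double zeros at z = 0, which is (1,1,1), and at theta z = kap e, the contact point;
    the coefficient of T decides the Hessian across the mirror. *)
Lemma wsextic_twin (A : comNzRingType) (k d e z T : A) :
  exists r,
  wsextic k d e (z ^+ 2 + 3 * T) (2 * z ^+ 3 - 18 * z * T) =
  z ^+ 2 * (theta k d * z - kap k * e) ^+ 2
    * (kap k * e ^+ 2 + 2 * d * e * z + ((d - 2 * k) ^+ 2 + 4) * z ^+ 2)
  + T * twin_part k d e z + T ^+ 2 * r.
Proof.
exists (324 * rho k d ^+ 3 * z ^+ 2
  - 54 * (2 * rho k d ^+ 2 * quad k d + 3 * k * rho k d * cub k d) * e * z
  + 9 * (quad k d ^+ 2 * rho k d + k * quad k d * cub k d
         - 2 * rho k d * cub k d) * e ^+ 2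
  + 27 * cub k d ^+ 2 * (z ^+ 2 + T)).
by rewrite /wsextic /twin_part /lin /quad /cub /rho /theta /kap; ring.
Qed.

(** The value at the contact point. The factor (kap^2 - rho)^2 explains the condition rho != kap^2
    in [fitted]: in the case of equality the quotient parametrisation has zero velocity at the
    contact point. *)
Lemma twin_partE (A : comNzRingType) (k d s : A) :
  twin_part k d (theta k d * s) (kap k * s) =
  27 * kap k ^+ 2 * s ^+ 4 * (kap k ^+ 2 - rho k d) ^+ 2
     * (theta k d ^+ 2 + rho k d ^+ 2).
Proof. by rewrite /twin_part /lin /quad /cub /rho /theta /kap /=; ring. Qed.

Lemma sexticZ (A : comNzRingType) (k d h t a b c : A) :
  sextic k d h (t * a) (t * b) (t * c) = t ^+ 6 * sextic k d h a b c.
Proof. by rewrite /sextic pformZ qformZ /wsextic /lin; ring. Qed.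

Section Hessian.
Variable R : rcfType.
Implicit Types k d h u v w a b c : R.

(** The restriction of the sextic to a line through (a,b,c), so that by [hess_formE] its coefficient
    of degree 2 is half the Hessian form. *)
Definition dline k d h a b c (v1 v2 v3 : R) : {poly R} :=
  sextic k%:P d%:P h%:P (a%:P + v1 *: 'X) (b%:P + v2 *: 'X) (c%:P + v3 *: 'X).

Lemma coef1M (p q : {poly R}) : (p * q)`_1 = p`_0 * q`_1 + p`_1 * q`_0.
Proof. by rewrite coefM !big_ord_recl big_ord0 addr0. Qed.

Lemma coef2M (p q : {poly R}) :
  (p * q)`_2 = p`_0 * q`_2 + p`_1 * q`_1 + p`_2 * q`_0.
Proof. by rewrite coefM !big_ord_recl big_ord0 addr0 addrA. Qed.

Lemma coef2_mul_sqr (p q : {poly R}) : p`_0 = 0 -> (q * p ^+ 2)`_2 = q`_0 * p`_1 ^+ 2.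
Proof.
move=> p0; rewrite coef2M expr2 coef2M coef1M coef0M p0.
by rewrite !(mul0r, mulr0, addr0, add0r) -expr2.
Qed.

Lemma coef1E (p : {poly R}) : p`_1 = p^`().[0].
Proof. by rewrite horner_coef0 coef_deriv. Qed.

(** By [wsextic_square] the restriction times 4 rho^3 is U^2 + M W^2, where U and W vanish at the
    node and M is positive there by the last inequality of [admissible]. If the quadratic part
    vanishes, the invariants e, p, q change to first order as under a scaling of the point; as a, b,
    c are distinct, these invariants are local coordinates, so the direction is radial. *)
Lemma dline_node k d h u v w a b c v1 v2 v3 :
    fitted k d h u v w -> a + b + c != 0 ->
    rho k d * cub k d * pform a b c = kap k ^+ 3 * (h * (a + b + c)) ^+ 2 ->
    2 * rho k d ^+ 3 * qform a b c = lin k d (h * (a + b + c)) (pform a b c) ->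
    a != b -> b != c -> c != a ->
  0 <= (dline k d h a b c v1 v2 v3)`_2 /\
  ((dline k d h a b c v1 v2 v3)`_2 = 0 ->
   exists t, [/\ v1 = t * a, v2 = t * b & v3 = t * c]).
Proof.
case=> adm _ h0 _ _ _ _ _ _ _ _ _ s0 p0 q0 ab bc ca.
have [k0 r0 c0 kc] := adm; have K0 := kap_gt0 k.
set x := a%:P + v1 *: 'X; set y := b%:P + v2 *: 'X; set z := c%:P + v3 *: 'X.
pose E := h%:P * (x + y + z); pose P := pform x y z; pose Q := qform x y z.
pose U := 2 * rho k%:P d%:P ^+ 3 * Q - lin k%:P d%:P E P.
pose M := 4 * rho k%:P d%:P * P - k%:P ^+ 2 * E ^+ 2.
pose W := kap k%:P ^+ 3 * E ^+ 2 - rho k%:P d%:P * cub k%:P d%:P * P.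
have rP : rho k%:P d%:P = (rho k d)%:P.
  by rewrite rmorph_rho.
have sq : (4 * rho k d ^+ 3)%:P * dline k d h a b c v1 v2 v3 = U ^+ 2 + M * W ^+ 2.
  rewrite -wsextic_square /dline -/x -/y -/z /sextic -/E -/P -/Q rP.
  by rewrite rmorphM rmorphXn rmorph_nat.
have hx : x.[0] = a by rewrite !hornerE.
have hy : y.[0] = b by rewrite !hornerE.
have hz : z.[0] = c by rewrite !hornerE.
have dx : x^`() = v1%:P by rewrite /x !derivE add0r alg_polyC.
have dy : y^`() = v2%:P by rewrite /y !derivE add0r alg_polyC.
have dz : z^`() = v3%:P by rewrite /z !derivE add0r alg_polyC.
clearbody x y z.
have hE : E.[0] = h * (a + b + c) by rewrite /E !hornerE hx hy hz.
have hP : P.[0] = pform a b c by rewrite /P /pform !hornerE hx hy hz.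
have hQ : Q.[0] = qform a b c by rewrite /Q /qform !hornerE hx hy hz.
have dE : E^`().[0] = h * (v1 + v2 + v3) by rewrite /E !(derivD, derivM, derivC) dx dy dz !hornerE; ring.
pose dp := (2 * a - b - c) * v1 + (2 * b - c - a) * v2 + (2 * c - a - b) * v3.
have dP : P^`().[0] = dp.
  rewrite /P /pform !expr2 !(derivB, derivD, derivM) dx dy dz.
  by rewrite !(hornerD, hornerN, hornerM, hornerC) hx hy hz /dp; ring.
pose dq := (2 * v1 - v2 - v3) * (2 * b - c - a) * (2 * c - a - b) 
  + (2 * a - b - c) * (2 * v2 - v3 - v1) * (2 * c - a - b)
  + (2 * a - b - c) * (2 * b - c - a) * (2 * v3 - v1 - v2).
have dQ : Q^`().[0] = dq.
  rewrite /Q /qform !mulr_natl !(derivB, derivD, derivM, derivMn) dx dy dz.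
  by rewrite !(hornerD, hornerN, hornerM, hornerMn, hornerC) hx hy hz /dq; ring.
clearbody E P Q.
have kapC : kap k%:P = (kap k)%:P by rewrite rmorph_kap.
have quadC : quad k%:P d%:P = (quad k d)%:P.
  by rewrite rmorph_quad.
have cubC : cub k%:P d%:P = (cub k d)%:P.
  by rewrite rmorph_cub.
pose c1 := 2 * rho k d ^+ 2 * quad k d + 3 * k * rho k d * cub k d.
have linC : lin k%:P d%:P E P = E * ((k * kap k ^+ 3)%:P * E ^+ 2 - c1%:P * P).
  rewrite /lin rP kapC quadC cubC /c1.
  by rewrite !(rmorphB, rmorphD, rmorphM, rmorph_nat, rmorphXn).
rewrite {}/U {}/W {}/M linC rP cubC kapC in sq.
set U := (X in X ^+ 2 + _) in sq; set M := (X in _ + X * _) in sq.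
set W := (X in _ + _ * X ^+ 2) in sq.
have e0 : h * (a + b + c) != 0 by rewrite mulf_neq0.
set e := h * (a + b + c) in p0 q0 hE e0; set de := h * (v1 + v2 + v3) in dE.
set p := pform a b c in p0 q0 hP; set q := qform a b c in q0 hQ.
pose heval := (hornerD, hornerN, hornerM, hornerMn, horner_exp, hornerC, hE, hP, hQ).
have U0 : U`_0 = 0.
  rewrite -horner_coef0 /U -!mulrA mulr_natl !heval.
  apply/eqP; rewrite subr_eq0; apply/eqP.
  by transitivity (2 * rho k d ^+ 3 * q); [ring | rewrite q0 /lin -/c1; ring].
have W0 : W`_0 = 0.
  by rewrite -horner_coef0 /W !heval -p0 subrr.
have M0 : 0 < M`_0.
  have -> : M`_0 = 4 * (rho k d * p) - k ^+ 2 * e ^+ 2.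
    by rewrite -horner_coef0 /M -!mulrA mulr_natl !heval; ring.
  rewrite subr_gt0 -(ltr_pM2l c0) -(ltr_pM2r (x := 1)) // !mulr1.
  have -> : cub k d * (4 * (rho k d * p)) = 4 * kap k ^+ 3 * e ^+ 2.
    by rewrite -mulrA -p0; ring.
  rewrite mulrA ltr_pM2r; last by rewrite exprn_even_gt0.
  by rewrite mulrC.
have d2 : (2 : {poly R})^`() = 0 by rewrite derivMn derivC mul0rn.
have v2' : (2 : {poly R}).[0] = 2 by rewrite hornerMn hornerC.
pose dev := (d2, derivB, derivD, derivM, derivC).
have U1 : U`_1 = 2 * rho k d ^+ 3 * dq - (de * (k * kap k ^+ 3 * e ^+ 2 - c1 * p)
     + e * (2 * k * kap k ^+ 3 * e * de - c1 * dp)).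
  rewrite coef1E /U !expr2 !exprS !expr0 !dev !(v2', heval) dE dP dQ.
  by ring.
have W1 : W`_1 = 2 * kap k ^+ 3 * e * de - rho k d * cub k d * dp.
  rewrite coef1E /W !exprS !expr0 !dev !heval dE dP.
  by ring.
have G2 : 4 * rho k d ^+ 3 * (dline k d h a b c v1 v2 v3)`_2 =
    U`_1 ^+ 2 + M`_0 * W`_1 ^+ 2.
  by rewrite -coefCM sq coefD coef2_mul_sqr // -[U ^+ 2]mul1r coef2_mul_sqr // coef1 mul1r.
have r30 : 0 < 4 * rho k d ^+ 3 by rewrite mulr_gt0 ?exprn_gt0.
have hM : 0 <= M`_0 * W`_1 ^+ 2 by rewrite mulr_ge0 ?sqr_ge0 // ltW.
split=> [|G0].
  by rewrite -(pmulr_rge0 _ r30) G2 addr_ge0 ?sqr_ge0.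
rewrite G0 mulr0 in G2; have hU := sqr_ge0 U`_1.
have /eqP : U`_1 ^+ 2 = 0 by lra.
have /eqP : M`_0 * W`_1 ^+ 2 = 0 by lra.
rewrite mulf_eq0 gt_eqF //= !expf_eq0 /= U1 W1 => /eqP w0 /eqP u0.
(* The rate of the scaling is read off from e; by their weights p and q must then change at the
   rates 2t and 3t. *)
pose t := (v1 + v2 + v3) / (a + b + c).
have deE : de = t * e by rewrite /de /t /e; field.
have dpE : dp = 2 * t * p.
  apply: (mulfI (x := rho k d * cub k d)); first by rewrite mulf_neq0 ?gt_eqF.
  have -> : rho k d * cub k d * dp = 2 * kap k ^+ 3 * e * de by lra.
  rewrite deE; transitivity (2 * t * (rho k d * cub k d * p)); last by ring.
  by rewrite p0; ring.
have dqE : dq = 3 * t * q.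
  apply: (mulfI (x := 2 * rho k d ^+ 3)); first by rewrite mulf_neq0 ?expf_eq0 ?gt_eqF.
  transitivity (3 * t * (2 * rho k d ^+ 3 * q)); last by ring.
  move: u0; rewrite q0 /lin -/c1 dpE deE => /eqP; rewrite subr_eq0 => /eqP ->; ring.
exists t.
have t1 : v1 + v2 + v3 = t * (a + b + c) by rewrite /t divfK.
have t2 : a * (v1 - t * a) + b * (v2 - t * b) + c * (v3 - t * c) = 0.
  move: dpE; rewrite /dp /p /pform => dpE; apply: (mulfI (x := 3)).
    by rewrite pnatr_eq0.
  rewrite mulr0.
  have -> : 3 * (a * (v1 - t * a) + b * (v2 - t * b) + c * (v3 - t * c)) =
   ((2 * a - b - c) * v1 + (2 * b - c - a) * v2 + (2 * c - a - b) * v3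
    - 2 * t * (a ^+ 2 + b ^+ 2 + c ^+ 2 - a * b - b * c - c * a))
   + (a + b + c) * (v1 + v2 + v3 - t * (a + b + c)) by ring.
  by rewrite dpE t1 !subrr mulr0 addr0.
(* What remains of the direction after removing its radial part is annihilated by the differentials
   of the sum, the sum of squares and the product of the coordinates. Elimination with distinct a,
   b, c makes it zero. *)
set x1 := v1 - t * a in t2; set x2 := v2 - t * b in t2; set x3 := v3 - t * c in t2.
have t3 : x1 + x2 + x3 = 0 by rewrite /x1 /x2 /x3; lra.
have t4 : b * c * x1 + c * a * x2 + a * b * x3 = 0.
  apply: (mulfI (x := 27)); first by rewrite pnatr_eq0.
  rewrite mulr0.
  have -> : 27 * (b * c * x1 + c * a * x2 + a * b * x3) = dq - 3 * t * q
     + (x1 + x2 + x3) * (- 6 * (a + b + c) ^+ 2 + 9 * (a * b + b * c + c * a)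
                         + 9 * (a + b + c) ^+ 2)
     - 9 * (a + b + c) * (a * x1 + b * x2 + c * x3).
    by rewrite /dq /q /qform /x1 /x2 /x3; ring.
  by rewrite dqE t2 t3; ring.
have x3E : x3 = - x1 - x2 by lra.
have x20 : x2 = 0.
  apply: (mulfI (x := (b - c) * (b - a))).
    by rewrite mulf_neq0 // subr_eq0 // eq_sym.
  rewrite mulr0 -[RHS](mulr0 b) -{1}t2 -[RHS]addr0 -{1}t4 x3E; ring.
have x10 : x1 = 0.
  apply: (mulfI (x := (a - c))); first by rewrite subr_eq0 eq_sym.
  by rewrite mulr0 -[RHS]t2 x3E x20; ring.
rewrite x20 x10 in x3E.
by split; apply/eqP; rewrite -subr_eq0; apply/eqP => //; rewrite -/x3 x3E; ring.
Qed.

(** Here p and q vanish to orders 2 and 3, so the term kap^3 e^4 p of the sextic alone gives the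
    quadratic part. *)
Lemma dline_center k d h a v1 v2 v3 :
    0 < kap k -> h != 0 -> a != 0 ->
  0 <= (dline k d h a a a v1 v2 v3)`_2 /\
  ((dline k d h a a a v1 v2 v3)`_2 = 0 ->
   exists t, [/\ v1 = t * a, v2 = t * a & v3 = t * a]).
Proof.
move=> K0 h0 a0.
pose E : {poly R} := h%:P * (a%:P + v1 *: 'X + (a%:P + v2 *: 'X) + (a%:P + v3 *: 'X)).
have P : pform (a%:P + v1 *: 'X) (a%:P + v2 *: 'X) (a%:P + v3 *: 'X) =
    'X^2 * (pform v1 v2 v3)%:P.
  by rewrite /pform -!mul_polyC; ring.
have Q : qform (a%:P + v1 *: 'X) (a%:P + v2 *: 'X) (a%:P + v3 *: 'X) =
    'X^3 * (qform v1 v2 v3)%:P.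
  rewrite /qform -!mul_polyC; ring.
have [r G] : exists r, dline k d h a a a v1 v2 v3 =
    'X^2 * ((kap k)%:P ^+ 3 * (pform v1 v2 v3)%:P * E ^+ 4 + 'X * r).
  rewrite /dline /sextic -/E P Q.
  set p := (pform _ _ _)%:P; set q := (qform _ _ _)%:P.
  have -> : (kap k)%:P = kap k%:P by rewrite rmorph_kap.
  exists (rho k%:P d%:P ^+ 3 * 'X^3 * q ^+ 2 - lin k%:P d%:P E ('X^2 * p) * q
    + p * ((quad k%:P d%:P ^+ 2 * rho k%:P d%:P
            + k%:P * quad k%:P d%:P * cub k%:P d%:P
            - 2 * rho k%:P d%:P * cub k%:P d%:P) * E ^+ 2 * ('X * p)
           + cub k%:P d%:P ^+ 2 * 'X^3 * p ^+ 2)).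
  by rewrite /wsextic; ring.
have E0 : E.[0] = 3 * h * a.
  by rewrite /E !(hornerM, hornerD, hornerZ, hornerX, hornerC); ring.
have -> : (dline k d h a a a v1 v2 v3)`_2 =
    kap k ^+ 3 * (3 * h * a) ^+ 4 * pform v1 v2 v3.
  rewrite G mulrC coefMXn /= -horner_coef0 hornerD [('X * r).[0]]hornerM hornerX mul0r addr0.
  by rewrite !(E0, hornerM, horner_exp, hornerC); ring.
have c0 : 0 < kap k ^+ 3 * (3 * h * a) ^+ 4.
  apply: mulr_gt0; first exact: exprn_gt0.
  by rewrite exprn_even_gt0 //= !mulf_neq0 ?pnatr_eq0.
have p0 : 0 <= 2 * pform v1 v2 v3.
  have -> : 2 * pform v1 v2 v3 = (v1 - v2) ^+ 2 + (v2 - v3) ^+ 2 + (v3 - v1) ^+ 2.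
    by rewrite /pform; ring.
  by rewrite !addr_ge0 ?sqr_ge0.
split=> [|/eqP].
  by rewrite mulr_ge0 ?(ltW c0) //; lra.
rewrite mulf_eq0 gt_eqF //= => /eqP/pform_eq0[-> ->].
by exists (v3 / a); rewrite divfK.
Qed.

(** The direction is split into a part along the mirror b = c and an antisymmetric part n. The
    sextic is even in n, so there is no mixed term: the mirror part contributes a positive multiple
    of L_1^2, where L = theta Z - kap E, and n contributes n^2 times [twin_part], positive by
    [twin_partE]. *)
Lemma dline_twin k d h u v w a b v1 v2 v3 :
    fitted k d h u v w -> a + 2 * b != 0 -> a != b ->
    theta k d * (a - b) = kap k * (h * (a + 2 * b)) ->
  0 <= (dline k d h a b b v1 v2 v3)`_2 /\
  ((dline k d h a b b v1 v2 v3)`_2 = 0 ->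
   exists t, [/\ v1 = t * a, v2 = t * b & v3 = t * b]).
Proof.
case=> adm rk h0 _ _ _ _ _ _ _ _ _ s0 ab tE.
have [k0 r0 c0 kc] := adm; have K0 := kap_gt0 k; have th0 := theta_gt0 adm.
pose m := (v2 + v3) / 2; pose n := (v2 - v3) / 2.
have v2E : v2 = m + n by rewrite /m /n; field.
have v3E : v3 = m - n by rewrite /m /n; field.
rewrite v2E v3E.
pose Z : {poly R} := (a - b)%:P + (v1 - m) *: 'X.
pose E : {poly R} := (h * (a + 2 * b))%:P + (h * (v1 + 2 * m)) *: 'X.
pose T : {poly R} := (n ^+ 2)%:P * 'X^2.
have GE : dline k d h a b b v1 (m + n) (m - n) =
    wsextic k%:P d%:P E (Z ^+ 2 + 3 * T) (2 * Z ^+ 3 - 18 * Z * T).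
  rewrite /dline /sextic; congr wsextic.
  - rewrite /E -!mul_polyC; ring.
  - rewrite /pform /Z /T -!mul_polyC; ring.
  rewrite /qform /Z /T -!mul_polyC; ring.
have [r] := wsextic_twin k%:P d%:P E Z T; rewrite -GE.
have rP : rho k%:P d%:P = (rho k d)%:P.
  by rewrite rmorph_rho.
have kapC : kap k%:P = (kap k)%:P by rewrite rmorph_kap.
have thC : theta k%:P d%:P = (theta k d)%:P.
  by rewrite /theta kapC !(rmorphD, rmorphM).
rewrite kapC thC => G.
have z0 : a - b != 0 by rewrite subr_eq0.
have Z0 : Z`_0 = a - b by rewrite -horner_coef0 /Z !(hornerD, hornerZ, hornerX, hornerC) mulr0 addr0.
have E0 : E`_0 = h * (a + 2 * b).
  by rewrite -horner_coef0 /E !(hornerD, hornerZ, hornerX, hornerC) mulr0 addr0.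
pose L := (theta k d)%:P * Z - (kap k)%:P * E.
have L0 : L`_0 = 0 by rewrite coefB !coefCM Z0 E0 tE subrr.
have L1 : L`_1 = theta k d * (v1 - m) - kap k * (h * (v1 + 2 * m)).
  rewrite coefB !coefCM /Z /E !coefD !coefC !coefZ !coefX /=; ring.
pose M : {poly R} := (kap k)%:P * E ^+ 2 + 2 * d%:P * E * Z
  + ((d%:P - 2 * k%:P) ^+ 2 + 4) * Z ^+ 2.
pose s := (a - b) / kap k.
have zE : a - b = kap k * s by rewrite /s mulrC divfK ?gt_eqF.
have eE : h * (a + 2 * b) = theta k d * s.
  apply: (mulfI (lt0r_neq0 K0)); rewrite -tE zE; ring.
have sn0 : s != 0 by apply: contraNneq z0 => s_0; rewrite zE s_0 mulr0.
have d0 : 0 < d by rewrite -(pmulr_rgt0 _ k0); rewrite /rho in r0; lra.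
have M0 : 0 < M`_0.
  have -> : M`_0 = kap k * (h * (a + 2 * b)) ^+ 2 + 2 * d * (h * (a + 2 * b)) * (a - b)
      + ((d - 2 * k) ^+ 2 + 4) * (a - b) ^+ 2.
    rewrite -horner_coef0 in Z0; rewrite -horner_coef0 in E0; rewrite -horner_coef0 /M.
    rewrite !(Z0, E0, hornerD, hornerM, hornerN, horner_exp, hornerC, hornerMn); ring.
  rewrite eE zE.
  have s2 : 0 < s ^+ 2 by rewrite exprn_even_gt0.
  have -> : kap k * (theta k d * s) ^+ 2 + 2 * d * (theta k d * s) * (kap k * s)
     + ((d - 2 * k) ^+ 2 + 4) * (kap k * s) ^+ 2 =
    s ^+ 2 * (kap k * (theta k d ^+ 2) + 2 * d * theta k d * kap k
      + ((d - 2 * k) ^+ 2 + 4) * kap k ^+ 2) by ring.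
  apply: mulr_gt0 => //; apply: ltr_wpDr; last first.
    by rewrite addr_gt0 // !mulr_gt0 ?exprn_gt0.
  by rewrite mulr_ge0 ?sqr_ge0 // addr_ge0 ?sqr_ge0.
pose N := twin_part k%:P d%:P E Z.
have N0 : N`_0 = 27 * kap k ^+ 2 * s ^+ 4 * (kap k ^+ 2 - rho k d) ^+ 2
     * (theta k d ^+ 2 + rho k d ^+ 2).
  rewrite -twin_partE -zE -eE -Z0 -E0 /N /twin_part /lin.
  have -> : cub k%:P d%:P = (cub k d)%:P.
    by rewrite rmorph_cub.
  have -> : quad k%:P d%:P = (quad k d)%:P.
    by rewrite rmorph_quad.
  rewrite kapC rP -!horner_coef0.
  by rewrite !(hornerD, hornerM, hornerN, horner_exp, hornerC, hornerMn); ring.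
have G2 : (dline k d h a b b v1 (m + n) (m - n))`_2 =
    M`_0 * (a - b) ^+ 2 * L`_1 ^+ 2 + n ^+ 2 * N`_0.
  have -> : dline k d h a b b v1 (m + n) (m - n) =
    (M * Z ^+ 2) * L ^+ 2 + 'X^2 * ((n ^+ 2)%:P * N + 'X * ('X * ((n ^+ 2)%:P ^+ 2 * r))).
    by rewrite G /M /L /N /T; ring.
  clearbody M L N.
  rewrite coefD coef2_mul_sqr // coefM big_ord1 expr2 coefM big_ord1 /= Z0.
  by rewrite coefXnM /= subnn coefD !coef0M coefX coefC /= mul0r addr0 -expr2.
have n2 := sqr_ge0 n; have N0_gt0 : 0 < N`_0.
  rewrite N0; apply: mulr_gt0; last by rewrite addr_gt0 ?exprn_gt0.
  apply: mulr_gt0; last by rewrite exprn_even_gt0 //= subr_eq0 eq_sym.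
  apply: mulr_gt0; last by rewrite exprn_even_gt0.
  by rewrite mulr_gt0 ?exprn_gt0.
have h1 : 0 <= M`_0 * (a - b) ^+ 2 * L`_1 ^+ 2.
  by rewrite mulr_ge0 ?sqr_ge0 // mulr_ge0 ?sqr_ge0 // ltW.
have h2 : 0 <= n ^+ 2 * N`_0 by rewrite mulr_ge0 // ltW.
rewrite G2; split=> [|G0]; first exact: addr_ge0.
have /eqP : n ^+ 2 * N`_0 = 0 by lra.
rewrite mulf_eq0 [N`_0 == 0]gt_eqF // orbF expf_eq0 /= => /eqP n0.
have /eqP : M`_0 * (a - b) ^+ 2 * L`_1 ^+ 2 = 0 by lra.
rewrite mulf_eq0 mulf_eq0 gt_eqF //= !expf_eq0 /= (negPf z0) /= L1 => /eqP l0.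
have ma : m * a = v1 * b.
  have /eqP : kap k * h * (m * a - v1 * b) = 0.
    apply: (mulfI (x := 3)); first by rewrite pnatr_eq0.
    rewrite mulr0.
    have -> : 3 * (kap k * h * (m * a - v1 * b)) =
      (theta k d * (v1 - m) - kap k * (h * (v1 + 2 * m))) * (b - a)
      + (theta k d * (a - b) - kap k * (h * (a + 2 * b))) * (v1 - m) by ring.
    by rewrite l0 tE subrr; ring.
  by rewrite !mulf_eq0 gt_eqF // (negPf h0) /= subr_eq0 => /eqP.
exists ((v1 + 2 * m) / (a + 2 * b)); rewrite n0 subr0 addr0.
by split; field: ma.
Qed.

End Hessian.

Section Zeros.
Variable R : rcfType.
Implicit Types k d h u v w a b c : R.

Lemma fitted_uv k d h u v w : fitted k d h u v w -> sextic k d h u v 1 = 0.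
Proof.
case=> -[k0 r0 _ _] _ _ _ _ _ _ _ _ _ pE qE.
have r30 : 4 * rho k d ^+ 3 != 0 by rewrite mulf_neq0 ?expf_eq0 ?gt_eqF.
apply: (mulfI r30); rewrite /sextic wsextic_square qE pE !subrr; ring.
Qed.

Lemma fitted_w11 k d h u v w : fitted k d h u v w -> sextic k d h w 1 1 = 0.
Proof.
case=> _ _ _ _ _ wE _ _ _ _ _ _.
have [r] := wsextic_twin k d (h * (w + 1 + 1)) (w - 1) 0.
have -> : theta k d * (w - 1) - kap k * (h * (w + 1 + 1)) = 0 by rewrite -wE; ring.
rewrite !mulr0 subr0 addr0 mul0r expr0n /= !mul0r mulr0 mul0r !addr0 => <-.
by rewrite /sextic; congr wsextic; rewrite /pform /qform; ring.
Qed.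

Lemma sextic111 k d h a : sextic k d h a a a = 0.
Proof.
have p0 : pform a a a = 0 by rewrite /pform; ring.
have q0 : qform a a a = 0 by rewrite /qform; ring.
by rewrite /sextic p0 q0 /wsextic; ring.
Qed.

Lemma zeros_root k d h u v w a b c :
  fitted k d h u v w -> (a, b, c) \in zeros u v w ->
  a + b + c = 1 /\ sextic k d h a b c = 0.
Proof.
move=> fit; have s0 := fit_sum fit; have t0 := fit_w2 fit.
have uv1 := fitted_uv fit; have w11 := fitted_w11 fit.
have Z x y z s : s != 0 -> x + y + z = s -> sextic k d h x y z = 0 ->
    x / s + y / s + z / s = 1 /\ sextic k d h (x / s) (y / s) (z / s) = 0.
  move=> s_neq0 xyz f0; rewrite -!mulrDl xyz divff //; split=> //.
  by rewrite ![_ / s]mulrC sexticZ f0 mulr0.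
have S3 : (3 : R) != 0 by rewrite pnatr_eq0.
rewrite !inE !xpair_eqE.
case/orP=> [/andP[/andP[/eqP-> /eqP->] /eqP->]|]; first by apply: Z.
case/orP=> [/andP[/andP[/eqP-> /eqP->] /eqP->]|].
  by apply: Z => //; [ring | rewrite sexticC23].
case/orP=> [/andP[/andP[/eqP-> /eqP->] /eqP->]|].
  by apply: Z => //; [ring | rewrite sexticC12].
case/orP=> [/andP[/andP[/eqP-> /eqP->] /eqP->]|].
  by apply: Z => //; [ring | rewrite sexticC23 sexticC12].
case/orP=> [/andP[/andP[/eqP-> /eqP->] /eqP->]|].
  by apply: Z => //; [ring | rewrite sexticC12 sexticC23].
case/orP=> [/andP[/andP[/eqP-> /eqP->] /eqP->]|].
  by apply: Z => //; [ring | rewrite sexticC12 sexticC23 sexticC12].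
case/orP=> [/andP[/andP[/eqP-> /eqP->] /eqP->]|].
  by apply: Z => //; ring.
case/orP=> [/andP[/andP[/eqP-> /eqP->] /eqP->]|].
  by apply: Z => //; [ring | rewrite sexticC12].
case/orP=> [/andP[/andP[/eqP-> /eqP->] /eqP->]|].
  by apply: Z => //; [ring | rewrite sexticC23 sexticC12].
case/andP=> /andP[/eqP-> /eqP->] /eqP->.
by apply: Z => //; [ring | exact: sextic111].
Qed.

Lemma zeros_uniq k d h u v w : fitted k d h u v w -> uniq (zeros u v w).
Proof.
move=> fit; have s0 := fit_sum fit; have t0 := fit_w2 fit.
have S3 : (3 : R) != 0 by rewrite pnatr_eq0.
rewrite /zeros; set s := u + v + 1 in s0 *; set t := w + 2 in t0 *.
have inj (x y r : R) : r != 0 -> (x / r == y / r) = (x == y).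
  by move=> r0; rewrite (inj_eq (mulIf _)) ?invr_eq0.
have uv : u / s <> v / s by apply/eqP; rewrite inj ?(fit_uv fit).
have u1 : u / s <> 1 / s by apply/eqP; rewrite inj ?(fit_u1 fit).
have v1 : v / s <> 1 / s by apply/eqP; rewrite inj ?(fit_v1 fit).
have w1 : w / t <> 1 / t by apply/eqP; rewrite inj ?(fit_w1 fit).
clearbody s t; move: (u / s) (v / s) (1 / s) (w / t) (1 / t) uv u1 v1 w1.
move=> u' v' n' w' m' uv u1 v1 w1 {inj S3 s0 t0 fit}.
rewrite /= !inE !xpair_eqE !negb_or.
rewrite -!andbA; do ?[apply/andP; split=> //];
  by apply/negP => /and3P[/eqP h1 /eqP h2 /eqP h3]; congruence.
Qed.

Lemma dline12 k d h a b c (v1 v2 v3 : R) :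
  dline k d h b a c v2 v1 v3 = dline k d h a b c v1 v2 v3.
Proof. exact: sexticC12. Qed.

Lemma dline23 k d h a b c (v1 v2 v3 : R) :
  dline k d h a c b v1 v3 v2 = dline k d h a b c v1 v2 v3.
Proof. exact: sexticC23. Qed.

Lemma zeros_hess k d h u v w a b c v1 v2 v3 :
    fitted k d h u v w -> (a, b, c) \in zeros u v w ->
  0 <= (dline k d h a b c v1 v2 v3)`_2 /\
  ((dline k d h a b c v1 v2 v3)`_2 = 0 ->
   exists t, [/\ v1 = t * a, v2 = t * b & v3 = t * c]).
Proof.
move=> fit; have s0 := fit_sum fit; have t0 := fit_w2 fit; have h0 := fit_h fit.
have K0 := kap_gt0 k.
have S3 : (3 : R) != 0 by rewrite pnatr_eq0.
have inj (x y r : R) : r != 0 -> (x / r == y / r) = (x == y).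
  by move=> r0; rewrite (inj_eq (mulIf _)) ?invr_eq0.
have node x y z : x + y + z = u + v + 1 -> pform x y z = pform u v 1 ->
    qform x y z = qform u v 1 -> x != y -> y != z -> z != x ->
  forall v1 v2 v3,
    let s := u + v + 1 in
    0 <= (dline k d h (x / s) (y / s) (z / s) v1 v2 v3)`_2 /\
    ((dline k d h (x / s) (y / s) (z / s) v1 v2 v3)`_2 = 0 ->
    exists t, [/\ v1 = t * (x / s), v2 = t * (y / s) & v3 = t * (z / s)]).
  move=> e1 e2 e3 xy yz zx r1 r2 r3 s.
  have sE : x / s + y / s + z / s = 1 by rewrite -!mulrDl e1 divff.
  apply: (dline_node _ _ _ fit); rewrite ?sE ?oner_neq0 ?inj //.
  - rewrite ![_ / s]mulrC pformZ e2 mulr1.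
    transitivity (s ^- 2 * (rho k d * cub k d * pform u v 1)); first by field.
    by rewrite (fit_p fit) -/s; field.
  rewrite ![_ / s]mulrC pformZ qformZ e2 e3 mulr1.
  transitivity (s ^- 3 * (2 * rho k d ^+ 3 * qform u v 1)); first by field.
  by rewrite (fit_q fit) -/s /lin; field.
have tw x y z r1 r2 r3 : x = w / (w + 2) -> y = 1 / (w + 2) -> z = y ->
    0 <= (dline k d h x y z r1 r2 r3)`_2 /\
    ((dline k d h x y z r1 r2 r3)`_2 = 0 ->
    exists t, [/\ r1 = t * x, r2 = t * y & r3 = t * z]).
  move=> xE yE ->; apply: (dline_twin _ _ _ fit).
  - rewrite xE yE.
    have -> : w / (w + 2) + 2 * (1 / (w + 2)) = 1 by field.
    exact: oner_neq0.
  - by rewrite xE yE inj ?(fit_w1 fit).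
  rewrite xE yE; apply: (mulIf t0).
  transitivity (theta k d * (w - 1)); first by field.
  by rewrite -(fit_w fit); field.
have uv := fit_uv fit; have u1 := fit_u1 fit; have v1' := fit_v1 fit.
rewrite !inE !xpair_eqE.
have P1 : pform u 1 v = pform u v 1 by rewrite /pform; ring.
have P2 : pform v u 1 = pform u v 1 by rewrite /pform; ring.
have P3 : pform v 1 u = pform u v 1 by rewrite /pform; ring.
have P4 : pform 1 u v = pform u v 1 by rewrite /pform; ring.
have P5 : pform 1 v u = pform u v 1 by rewrite /pform; ring.
have Q1 : qform u 1 v = qform u v 1 by rewrite /qform; ring.
have Q2 : qform v u 1 = qform u v 1 by rewrite /qform; ring.
have Q3 : qform v 1 u = qform u v 1 by rewrite /qform; ring.
have Q4 : qform 1 u v = qform u v 1 by rewrite /qform; ring.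
have Q5 : qform 1 v u = qform u v 1 by rewrite /qform; ring.
do 6![case/orP=> [/andP[/andP[/eqP-> /eqP->] /eqP->]|];
  first by apply: node => //; by [ring | rewrite // eq_sym]].
case/orP=> [/andP[/andP[/eqP-> /eqP->] /eqP->]|]; first exact: tw.
case/orP=> [/andP[/andP[/eqP-> /eqP->] /eqP->]|].
  rewrite dline12; have [H1 H2] := tw _ _ _ v2 v1 v3 (erefl _) (erefl _) (erefl _).
  by split=> // /H2[t [? ? ?]]; exists t.
case/orP=> [/andP[/andP[/eqP-> /eqP->] /eqP->]|].
  rewrite dline23 dline12; have [H1 H2] := tw _ _ _ v3 v1 v2 (erefl _) (erefl _) (erefl _).
  by split=> // /H2[t [? ? ?]]; exists t.
case/andP=> /andP[/eqP-> /eqP->] /eqP->.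
by apply: dline_center => //; rewrite mul1r invr_eq0.
Qed.
End Zeros.

(** * The rational parametrisation *)

Section Curve.
Variable A : comNzRingType.
Implicit Types k d h hi om e z y s t : A.

(* The eigencoordinates of the cyclic permutation: [3 e / h = a + b + c],
   [3 z = a + om b + om^2 c] and [3 y = a + om^2 b + om c]. *)
Definition eigpt hi om e z y : 'I_3 -> A :=
  vec3 (hi * e + z + y) (hi * e + om ^+ 2 * z + om * y)
       (hi * e + om * z + om ^+ 2 * y).

Definition ebin k d s t : A := s ^+ 6 + (d - 2 * k) * s ^+ 3 * t ^+ 3 - t ^+ 6.
Definition zbin k s t : A := s ^+ 2 * t * (s ^+ 3 - k * t ^+ 3).
Definition ybin k s t : A := s * t ^+ 2 * (k * s ^+ 3 + t ^+ 3).

(** In eigencoordinates the arguments of [wsextic] are 3e, 9zy and 27(z^3 + y^3); weighted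
    homogeneity of degree 6 gives the factor 3^6 = 729. *)
Lemma sextic_eigpt k d h hi om e z y :
    h * hi = 1 -> om ^+ 2 = - 1 - om ->
  let x := eigpt hi om e z y in
  sextic k d h (x 0) (x 1) (x 2) = 729 * wsextic k d e (z * y) (z ^+ 3 + y ^+ 3).
Proof.
move=> hh o2 x.
have -> : sextic k d h (x 0) (x 1) (x 2) =
    wsextic k d (3 * e) (9 * (z * y)) (27 * (z ^+ 3 + y ^+ 3)).
  rewrite /sextic /x /eigpt /vec3 /=; congr wsextic.
  - by ring: hh o2.
  - by rewrite /pform; ring: hh o2.
  by rewrite /qform; ring: hh o2.
by rewrite /wsextic /lin; ring.
Qed.

Lemma wsextic_bin k d s t :
  let z := zbin k s t in let y := ybin k s t in
  wsextic k d (ebin k d s t) (z * y) (z ^+ 3 + y ^+ 3) = 0.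
Proof.
rewrite -(wsextic_par k d (s ^+ 3 * t ^+ 3)
  (s ^+ 6 - 2 * k * (s ^+ 3 * t ^+ 3) - t ^+ 6)) /=.
by congr wsextic; rewrite /ebin /zbin /ybin /ppar /qpar /kap; ring.
Qed.

(* Two adjoint quartics whose quotient inverts the parametrisation
   [s |-> (ebin, zbin, ybin)]; they were found by solving the linear system
   [s * psi1 = t * psi0] for quartics that are eigenvectors of the cyclic
   permutation. *)
Definition psi0 k d e z y : A :=
  let K := kap k in let r := rho k d in let th := theta k d in
  K ^+ 3 * (e ^+ 3 * z - k * e ^+ 2 * y ^+ 2)
  + ((k ^+ 2 - 1) * d ^+ 2 - 4 * k * K * d + 2 * K ^+ 2) * K * (e * z ^+ 2 * y)
  + (r * (k * d ^+ 2 - 2 * K * d - k * K ^+ 2) - k * K * r ^+ 2 - r ^+ 2 * d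
     + 2 * K * r * th) * (z * y ^+ 3)
  - r ^+ 2 * d * z ^+ 4.

Definition psi1 k d e z y : A :=
  let K := kap k in let r := rho k d in let th := theta k d in
  K ^+ 3 * (e ^+ 2 * z ^+ 2)
  + (k * d ^+ 2 - 2 * K * d - k * K ^+ 2) * K * (e * z * y ^+ 2)
  + (k * r ^+ 2 * d - 2 * r * th * d - K * r ^+ 2
     - r * ((k ^+ 2 - 1) * d ^+ 2 - 4 * k * K * d + 2 * K ^+ 2)) * (z ^+ 3 * y)
  - K * r ^+ 2 * y ^+ 4.

Lemma psi_inverse k d s t :
  s * psi1 k d (ebin k d s t) (zbin k s t) (ybin k s t) =
  t * psi0 k d (ebin k d s t) (zbin k s t) (ybin k s t).
Proof. by rewrite /psi0 /psi1 /ebin /zbin /ybin /theta /rho /kap; ring. Qed.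

Lemma psi0Z k d l e z y :
  psi0 k d (l * e) (l * z) (l * y) = l ^+ 4 * psi0 k d e z y.
Proof. by rewrite /psi0; ring. Qed.

Lemma psi1Z k d l e z y :
  psi1 k d (l * e) (l * z) (l * y) = l ^+ 4 * psi1 k d e z y.
Proof. by rewrite /psi1; ring. Qed.

End Curve.

Section CurveMorph.
Variables (A B : comNzRingType) (f : {rmorphism A -> B}).

Lemma rmorph_ebin k d s t : f (ebin k d s t) = ebin (f k) (f d) (f s) (f t).
Proof. by rewrite /ebin !(rmorphB, rmorphD, rmorphM, rmorphXn, rmorph1). Qed.

Lemma rmorph_zbin k s t : f (zbin k s t) = zbin (f k) (f s) (f t).
Proof. by rewrite /zbin !(rmorphB, rmorphD, rmorphM, rmorphXn). Qed.

Lemma rmorph_ybin k s t : f (ybin k s t) = ybin (f k) (f s) (f t).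
Proof. by rewrite /ybin !(rmorphB, rmorphD, rmorphM, rmorphXn). Qed.

Lemma rmorph_psi0 k d e z y :
  f (psi0 k d e z y) = psi0 (f k) (f d) (f e) (f z) (f y).
Proof.
rewrite /psi0 /theta /rho /kap.
by rewrite !(rmorphB, rmorphD, rmorphM, rmorphXn, rmorph_nat, rmorph1).
Qed.

Lemma rmorph_psi1 k d e z y :
  f (psi1 k d e z y) = psi1 (f k) (f d) (f e) (f z) (f y).
Proof.
rewrite /psi1 /theta /rho /kap.
by rewrite !(rmorphB, rmorphD, rmorphM, rmorphXn, rmorph_nat, rmorph1).
Qed.

End CurveMorph.

Lemma dhomog_msize_le n (K : nzRingType) m (p : {mpoly K[n]}) :
  p \is m.-homog -> (msize p <= m.+1)%N.
Proof.
move=> /dhomogP hp; rewrite msizeE big_seq; elim/big_ind: _ => //.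
  by move=> x y hx hy; rewrite geq_max hx.
by move=> x /hp /= ->.
Qed.

(** * Polynomials vanishing on the cone over the curve *)

Section Kernel.
Variable C : numClosedFieldType.
Variables (k d h om : C).
Hypotheses (k_neq0 : k != 0) (K_neq0 : kap k != 0) (r_neq0 : rho k d != 0).
Hypotheses (h_neq0 : h != 0) (om2 : om ^+ 2 = - 1 - om).

Let F := mpoly_sextic k d h.
Let es : {poly C} := ebin k%:P d%:P 1 'X.
Let zs : {poly C} := zbin k%:P 1 'X.
Let ys : {poly C} := ybin k%:P 1 'X.

Lemma horner_es s : es.[s] = ebin k d 1 s.
Proof. by rewrite -/(horner_eval s es) rmorph_ebin /= /horner_eval !hornerE. Qed.

Lemma horner_zs s : zs.[s] = zbin k 1 s.
Proof. by rewrite -/(horner_eval s zs) rmorph_zbin /= /horner_eval !hornerE. Qed.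

Lemma horner_ys s : ys.[s] = ybin k 1 s.
Proof. by rewrite -/(horner_eval s ys) rmorph_ybin /= /horner_eval !hornerE. Qed.

(** The nonzero roots of [ys] satisfy s^3 = -k, where [es] equals -rho. So no cancellation occurs in
    ys / es, and a line y = mu e carries no spurious parameter with e = y = 0. *)
Lemma es_ys_coprime s : ys.[s] = 0 -> es.[s] != 0.
Proof.
rewrite horner_es horner_ys /ybin expr1n mul1r !mulr1 => /eqP.
rewrite mulf_eq0 expf_eq0 /= => /orP[/eqP->|/eqP s3].
  by rewrite /ebin !expr0n /= !mulr0 subr0 addr0 expr1n oner_neq0.
have s3E : s ^+ 3 = - k by apply/eqP; rewrite -addr_eq0 addrC s3.
have -> : ebin k d 1 s = - rho k d.
  have s6E : s ^+ 6 = k ^+ 2 by rewrite -[6%N]/(3 * 2)%N exprM s3E sqrrN.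
  by rewrite /ebin !expr1n mulr1 s6E s3E /rho /kap; ring.
by rewrite oppr_eq0.
Qed.

(** Its roots include the critical points of ys / es, the parameters where a line y = mu e fails to
    cut out a simple root; at the roots of [denom] the inverse map cannot be used to separate
    parameters. *)
Let wronskian := ys^`() * es - ys * es^`().
Let denom := psi0 k%:P d%:P es zs ys.

Lemma horner_denom s : denom.[s] = psi0 k d es.[s] zs.[s] ys.[s].
Proof. by rewrite -/(horner_eval s denom) rmorph_psi0 /= /horner_eval !hornerC. Qed.

Lemma wronskian_neq0 : wronskian != 0.
Proof.
have -> : wronskian = 'X * (2 * k%:P + 'X * ('X^2 * (5 - k%:P * (d%:P - 2 * k%:P)
    + 'X^3 * (2 * (d%:P - 2 * k%:P) + 4 * k%:P + 'X^3)))).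
  rewrite /wronskian /ys /es /ybin /ebin !expr1n !mul1r !mulr1.
  rewrite !(derivB, derivD, derivM, derivXn, derivX, derivC, derivMn) /=; ring.
rewrite mulf_neq0 ?polyX_eq0 //; apply/eqP => /(congr1 (fun p => p.[0])).
rewrite hornerD hornerM hornerMn !hornerC hornerM hornerX mul0r addr0 => /eqP.
by rewrite mulf_eq0 pnatr_eq0 (negPf k_neq0).
Qed.

(** Near s = 0 one has e = 1 + ..., z = s + ... and y = k s^2 + ..., so only the term kap^3 e^3 z of
    [psi0] contributes at order s. *)
Lemma denom_neq0 : denom != 0.
Proof.
pose u : {poly C} := 1 - k%:P * 'X^3; pose v : {poly C} := k%:P + 'X^3.
have [r rE] : exists r, denom = 'X * (kap k%:P ^+ 3 * es ^+ 3 * u + 'X * r).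
  exists ('X^2 * (- kap k%:P ^+ 3 * k%:P * es ^+ 2 * v ^+ 2
    + ((k%:P ^+ 2 - 1) * d%:P ^+ 2 - 4 * k%:P * kap k%:P * d%:P + 2 * kap k%:P ^+ 2)
      * kap k%:P * es * u ^+ 2 * v
    + (rho k%:P d%:P * (k%:P * d%:P ^+ 2 - 2 * kap k%:P * d%:P - k%:P * kap k%:P ^+ 2)
       - k%:P * kap k%:P * rho k%:P d%:P ^+ 2 - rho k%:P d%:P ^+ 2 * d%:P
       + 2 * kap k%:P * rho k%:P d%:P * theta k%:P d%:P) * 'X^3 * u * v ^+ 3
    - rho k%:P d%:P ^+ 2 * d%:P * u ^+ 4)).
  have zE : zs = 'X * u by rewrite /zs /zbin /u; ring.
  have yE : ys = 'X^2 * v by rewrite /ys /ybin /v; ring.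
  by rewrite /denom /psi0 zE yE; ring.
have kapC : kap k%:P = (kap k)%:P by rewrite rmorph_kap.
have D0 : (kap k%:P ^+ 3 * es ^+ 3 * u + 'X * r).[0] = kap k ^+ 3.
  rewrite kapC /u !(horner_es, hornerD, hornerM, hornerN, horner_exp, hornerX, hornerC).
  by rewrite /ebin; ring.
rewrite rE mulf_neq0 ?polyX_eq0 //; apply/eqP => /(congr1 (fun p => p.[0])).
by rewrite D0 horner0 => /eqP; rewrite expf_eq0 (negPf K_neq0).
Qed.

(** The polynomial ys - mu es has degree 6 with leading coefficient mu, since only [es] reaches
    degree 6, and its roots are simple away from the roots of [wronskian]. *)
Lemma fiber_roots mu : mu != 0 ->
    (forall s, (wronskian * denom).[s] = 0 -> ys.[s] != mu * es.[s]) ->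
  exists rs : seq C, [/\ uniq rs, (6 <= size rs)%N &
    forall s, s \in rs -> [/\ ys.[s] = mu * es.[s], es.[s] != 0 & denom.[s] != 0]].
Proof.
move=> mu0 hmu; pose N := ys - mu%:P * es.
have [rs NE] := closed_field_poly_normal N.
have hN s : N.[s] = ys.[s] - mu * es.[s].
  by rewrite /N !(horner_ys, horner_es, hornerD, hornerN, hornerM, hornerC).
have rsE s : s \in rs -> ys.[s] = mu * es.[s].
  rewrite -root_prod_XsubC => /rootP rs0; have : N.[s] = 0 by rewrite NE hornerZ rs0 mulr0.
  by rewrite hN => /eqP; rewrite subr_eq0 => /eqP.
have es0 s : s \in rs -> es.[s] != 0.
  move=> srs; have [e0|//] := eqVneq es.[s] 0.
  have := rsE s srs; rewrite e0 mulr0 => /es_ys_coprime.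
  by rewrite e0 eqxx.
have wd s : s \in rs -> (wronskian * denom).[s] != 0.
  by move=> srs; apply/eqP => /hmu; rewrite rsE // eqxx.
have N6 : N`_6 = mu.
  have -> : N = 'X^6 * mu%:P + 'X^5 + 'X^3 * (- mu * (d - 2 * k))%:P
      + 'X^2 * k%:P - mu%:P.
    by rewrite /N /ys /es /ybin /ebin; ring.
  by rewrite !coefB !coefD !coefXnM coefXn !coefC /= !addr0 subr0.
have lc0 : lead_coef N != 0.
  by rewrite lead_coef_eq0; apply: contraNneq mu0 => N0; rewrite -N6 N0 coef0.
exists rs; split=> [||s srs].
- rewrite -separable_prod_XsubC unlock; apply: Pdiv.ClosedField.root_coprimep => s.
  rewrite root_prod_XsubC => srs; have := wd s srs; apply: contraNneq => ds.
  have : N^`().[s] = 0 by rewrite NE derivZ hornerZ ds mulr0.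
  have -> : N^`() = ys^`() - mu%:P * es^`() 
    by rewrite /N; move: (ys) (es) => a b; rewrite derivB derivM derivC mul0r add0r.
  rewrite /wronskian; have := rsE s srs; move: (ys) (es) (denom) => a b q aE.
  rewrite !(hornerD, hornerN, hornerM, hornerC) aE => /eqP.
  by rewrite subr_eq0 => /eqP ->; apply/eqP; ring.
- have : (6 < size N)%N by rewrite ltnNge; apply: contra mu0 => N6'; rewrite -N6 nth_default.
  by rewrite NE size_scale // size_prod_XsubC.
split; [exact: rsE | exact: es0 |].
by have := wd s srs; rewrite hornerM mulf_eq0 negb_or => /andP[].
Qed.

Definition eigform_e : {mpoly C[3]} := h%:MP * ('X_0 + 'X_1 + 'X_2).
Definition eigform_y : {mpoly C[3]} := 'X_0 + (om ^+ 2)%:MP * 'X_1 + om%:MP * 'X_2.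

Lemma meval_eigform_e e z y :
  eigform_e.@[eigpt h^-1 om e z y] = 3 * e.
Proof.
rewrite /eigform_e mevalM !mevalD mevalC !mevalXU /eigpt /vec3 /=.
have hh : h * h^-1 = 1 by rewrite mulfV.
by ring: hh om2.
Qed.

Lemma meval_eigform_y e z y :
  eigform_y.@[eigpt h^-1 om e z y] = 3 * y.
Proof.
rewrite /eigform_y !mevalD !mevalM !mevalC !mevalXU /eigpt /vec3 /=.
by ring: om2.
Qed.

Lemma eigpt_surj (x : 'I_3 -> C) : exists e z y, x =1 eigpt h^-1 om e z y.
Proof.
exists (h * (x 0 + x 1 + x 2) / 3), ((x 0 + om * x 1 + om ^+ 2 * x 2) / 3),
  ((x 0 + om ^+ 2 * x 1 + om * x 2) / 3) => i.
by case: (ord3P i) => ->; rewrite /eigpt /vec3 /=; field: om2.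
Qed.

(** Only a degree bound is imposed, so that arbitrary factors of the sextic can be treated; this is
    why vanishing is asked on the whole cone, with the scaling l, and not on one lift of the
    curve. *)
Lemma kernel (g : {mpoly C[3]}) : (msize g <= 7)%N ->
    (forall l s, g.@[eigpt h^-1 om (l * ebin k d 1 s) (l * zbin k 1 s) (l * ybin k 1 s)] = 0) ->
  exists c, g = c *: F.
Proof.
move=> g7 g0.
(* These lines run in the direction of the eigencoordinate z, with e and y fixed, and are all
   parallel. *)
pose u e y : 'I_3 -> {poly C} := eigpt (h^-1)%:P om%:P e%:P 'X y%:P.
have uE e y z i : (u e y i).[z] = eigpt h^-1 om e z y i.
  by case: (ord3P i) => ->; rewrite /u /eigpt /vec3 /=
    !(hornerD, hornerM, horner_exp, hornerC, hornerX).
pose dir : 'I_3 -> C := vec3 1 (om ^+ 2) om.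
have uL e y i : u e y i = (dir i)%:P * 'X + (eigpt h^-1 om e 0 y i)%:P.
  by case: (ord3P i) => ->; rewrite /u /dir /eigpt /vec3 /=; ring.
have uS e y i : (size (u e y i) <= 2)%N.
  by rewrite uL size_MXaddC; case: ifP => // _; rewrite ltnS size_polyC_leq1.
have u1 e y i : (u e y i)`_1 = (u 0 0 i)`_1.
  by rewrite !uL !coefD !coefMX !coefC.
have F0 : (mmap polyC (u 0 0) F)`_6 != 0.
  rewrite mmap_sextic /u sextic_eigpt; last 2 first.
  - by rewrite -polyCM mulfV // polyC1.
  - by rewrite -polyC_exp om2; ring.
  have -> : wsextic k%:P d%:P 0%:P ('X * 0%:P) ('X ^+ 3 + 0%:P ^+ 3) =
      (rho k d ^+ 3)%:P * 'X^6.
    by rewrite /wsextic /lin /rho /kap; ring.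
  have -> : (729 : {poly C}) = 729%:P by rewrite rmorph_nat.
  by rewrite !coefCM coefXn /= mulr1 mulf_neq0 ?expf_eq0 ?pnatr_eq0.
(* This cancels the coefficient of z^6, which is common to all the parallel lines, so [p] has degree
   at most 5 on each of them. *)
pose c := (mmap polyC (u 0 0) g)`_6 / (mmap polyC (u 0 0) F)`_6.
pose p := g - c *: F; suff p0 : p = 0.
  by exists c; apply/eqP; rewrite -subr_eq0 -/p p0.
have p7 : (msize p <= 7)%N.
  apply: leq_trans (msizeD_le _ _) _; rewrite geq_max g7 msizeN.
  by apply: leq_trans (msizeZ_le _ _) _; apply: dhomog_msize_le; apply: dhomog_sextic.
have p_cone l s : p.@[eigpt h^-1 om (l * ebin k d 1 s) (l * zbin k 1 s) (l * ybin k 1 s)] = 0.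
  rewrite mevalB mevalZ g0 meval_sextic sextic_eigpt ?mulfV //.
  have -> : wsextic k d (l * ebin k d 1 s) (l * zbin k 1 s * (l * ybin k 1 s))
     ((l * zbin k 1 s) ^+ 3 + (l * ybin k 1 s) ^+ 3) = 
     l ^+ 6 * wsextic k d (ebin k d 1 s) (zbin k 1 s * ybin k 1 s)
     (zbin k 1 s ^+ 3 + ybin k 1 s ^+ 3) by rewrite /wsextic /lin; ring.
  by rewrite wsextic_bin !mulr0 subr0.
have p6 e y : (size (mmap polyC (u e y) p) <= 6)%N.
  have [sz cf] := mmap_polyC_lead (N := 6) (uS e y) (uS 0 0) (u1 e y) p7.
  rewrite muln1 in sz cf; apply/leq_sizeP => j; rewrite leq_eqVlt => /predU1P[<-|j6].
    by rewrite cf mmapB mmapZ coefB coefCM /c divfK // subrr.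
  by rewrite nth_default //; apply: leq_trans j6.
have [bad badE] := closed_field_poly_normal (wronskian * denom).
pose mus := [seq ys.[s] / es.[s] | s <- bad].
have wd0 : wronskian * denom != 0 by rewrite mulf_neq0 ?wronskian_neq0 ?denom_neq0.
have p_line e z mu : e != 0 -> mu != 0 -> mu \notin mus -> p.@[eigpt h^-1 om e z (mu * e)] = 0.
  move=> e0 mu0 mu_bad; have [|rs [rs_uniq rs6 rsP]] := fiber_roots mu0.
    move=> s wds; apply: contraNneq mu_bad => sE.
    have sbad : s \in bad.
      move: wds => /eqP; rewrite badE hornerZ mulf_eq0 lead_coef_eq0 (negPf wd0) /=.
      by rewrite -rootE root_prod_XsubC.
    apply/mapP; exists s => //; rewrite sE mulfK //.
    apply/eqP => es_0; have := es_ys_coprime (s := s); rewrite sE es_0 mulr0 eqxx.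
    by move/(_ erefl).
  pose q := mmap polyC (u e (mu * e)) p.
  suff q0 : q = 0.
    have : q.[z] = 0 by rewrite q0 horner0.
    by rewrite /q horner_mmap_polyC => <-; apply: meval_eq => i; rewrite uE.
  apply/eqP/negP => /negP q0.
  pose zl := [seq e * (zs.[s] / es.[s]) | s <- rs].
  have zl_root : all (root q) zl.
    apply/allP => _ /mapP[s /rsP[yE es0 _] ->]; rewrite rootE /q horner_mmap_polyC.
    apply/eqP; rewrite -[RHS](p_cone (e / es.[s]) s); apply: meval_eq => i; rewrite uE.
    rewrite -horner_es -horner_zs -horner_ys yE.
    by congr eigpt; field.
  have zl_uniq : uniq zl.
    (* On one line y = mu e, equal values of z / e mean proportional points of the curve, and the
       quotient of the adjoint quartics then recovers a single parameter. *)
    rewrite map_inj_in_uniq // => s t /rsP[sE es0 _] /rsP[tE et0 dt0] /(mulfI e0) st.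
    pose l := es.[s] / es.[t].
    have eE : ebin k d 1 s = l * ebin k d 1 t by rewrite -!horner_es /l divfK.
    have zE : zbin k 1 s = l * zbin k 1 t.
      by rewrite -!horner_zs /l -[LHS](divfK es0) st; field.
    have yE : ybin k 1 s = l * ybin k 1 t by rewrite -!horner_ys sE tE /l; field.
    have := psi_inverse k d 1 s; have := psi_inverse k d 1 t.
    rewrite eE zE yE psi0Z psi1Z !mul1r => -> /eqP.
    have nz : l ^+ 4 * psi0 k d (ebin k d 1 t) (zbin k 1 t) (ybin k 1 t) != 0.
      rewrite mulf_neq0 ?expf_eq0 ?mulf_neq0 ?invr_eq0 //.
      by rewrite -horner_es -horner_zs -horner_ys -horner_denom.
    by rewrite mulrCA (inj_eq (mulIf nz)) => /eqP.
  have := max_poly_roots q0 zl_root zl_uniq; rewrite size_map => szq.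
  by have := leq_trans (leq_ltn_trans rs6 szq) (p6 e (mu * e)); rewrite ltnn.
(* [D] vanishes on e = 0, on y = 0 and on the finitely many excluded lines, so p D vanishes at every
   point. *)
pose D := eigform_e * eigform_y * \prod_(mu <- mus) (eigform_y - mu *: eigform_e).
have three : (3 : C) != 0 by rewrite pnatr_eq0.
have D0 : D != 0.
  apply: mulf_neq0; first apply: mulf_neq0.
  - apply: contraNneq three => e0; have := meval_eigform_e 1 0 0.
    by rewrite e0 meval0 mulr1 => <-.
  - apply: contraNneq three => y0; have := meval_eigform_y 0 0 1.
    by rewrite y0 meval0 mulr1 => <-.
  rewrite prodf_seq_neq0; apply/allP => mu _ /=; apply: contraNneq three => y0.
  have := congr1 (meval (eigpt h^-1 om 0 0 1)) y0.
  by rewrite mevalB mevalZ meval_eigform_e meval_eigform_y meval0 !mulr0 subr0 mulr1 => ->.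
apply/eqP; have: p * D = 0; last by move/eqP; rewrite mulf_eq0 (negPf D0) orbF.
apply: mpoly_eq0 => x; have [e [z [y xE]]] := eigpt_surj x.
rewrite (meval_eq _ xE) mevalM {D0}/D mevalM [(eigform_e * _).@[_]]mevalM.
rewrite meval_eigform_e meval_eigform_y.
have [->|e0] := eqVneq e 0; first by rewrite mulr0 !mul0r mulr0.
have [->|y0] := eqVneq y 0; first by rewrite !(mulr0, mul0r).
have yE : y = y / e * e by rewrite divfK.
have [mu_bad|mu_good] := boolP (y / e \in mus); last first.
  by rewrite {1}yE p_line ?mul0r // mulf_neq0 ?invr_eq0.
have f0 : (eigform_y - (y / e) *: eigform_e).@[eigpt h^-1 om e z y] = 0.
  by rewrite mevalB mevalZ meval_eigform_e meval_eigform_y {1}yE; ring.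
by rewrite (big_rem _ mu_bad) /= mevalM f0 mul0r !mulr0.
Qed.

End Kernel.

(** * Irreducibility over the complex numbers *)

Section Irreducible.
Variable C : numClosedFieldType.
Variables (k d h om : C).
Hypotheses (k_neq0 : k != 0) (K_neq0 : kap k != 0) (r_neq0 : rho k d != 0).
Hypotheses (h_neq0 : h != 0) (om2 : om ^+ 2 = - 1 - om).

Let F := mpoly_sextic k d h.

Definition curve_map : 3.-tuple {mpoly C[2]} :=
  let x := eigpt (h^-1)%:MP om%:MP (ebin k%:MP d%:MP 'X_0 'X_1)
             (zbin k%:MP 'X_0 'X_1) (ybin k%:MP 'X_0 'X_1) in
  [tuple x 0; x 1; x 2].

Lemma mpolyC_om : (om%:MP : {mpoly C[2]}) ^+ 2 = - 1 - om%:MP.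
Proof. by rewrite -rmorphXn om2 rmorphB rmorphN rmorph1. Qed.

Lemma mpolyC_h : (h%:MP : {mpoly C[2]}) * (h^-1)%:MP = 1.
Proof. by rewrite -rmorphM mulfV // rmorph1. Qed.

Lemma sextic_curve_map : F \mPo curve_map = 0.
Proof.
rewrite rmorph_sextic /= !comp_mpolyC !comp_mpolyXU /=.
have := sextic_eigpt k%:MP d%:MP (ebin k%:MP d%:MP 'X_0 'X_1)
             (zbin k%:MP 'X_0 'X_1) (ybin k%:MP 'X_0 'X_1) mpolyC_h mpolyC_om.
by move=> /= ->; rewrite wsextic_bin mulr0.
Qed.

Lemma sextic_neq0 : F != 0.
Proof.
apply/eqP => F0; have := meval_sextic k d h (eigpt h^-1 om 0 1 0).
rewrite -/F F0 meval0 sextic_eigpt ?mulfV //.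
have -> : wsextic k d 0 (1 * 0) (1 ^+ 3 + 0 ^+ 3) = rho k d ^+ 3.
  by rewrite /wsextic /lin; ring.
by move/esym/eqP; rewrite mulf_eq0 pnatr_eq0 expf_eq0 (negPf r_neq0).
Qed.

Lemma msize_sextic : msize F = 7%N.
Proof.
have F0 := sextic_neq0; rewrite -mlead_deg //.
by have /dhomogP/(_ (mlead F)) /= -> := dhomog_sextic k d h; rewrite ?mlead_supp.
Qed.

Lemma curve_map_eq0 (g : {mpoly C[3]}) : (msize g <= 7)%N -> g \mPo curve_map = 0 ->
  exists c, g = c *: F.
Proof.
move=> g7 g0; apply: (kernel k_neq0 K_neq0 r_neq0 h_neq0 om2) => // l s.
(* The coordinates are binary forms of degree 6, so the scaling by l is reached by multiplying the
   parameters (1, s) by a sixth root of l. *)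
pose r := 6.-root l; have rE : r ^+ 6 = l by rewrite rootCK.
pose v : 'I_2 -> C := fun i => [:: r; r * s]`_i.
have := congr1 (meval v) g0; rewrite meval0 comp_mpoly_meval => <-.
apply: meval_eq => i.
have -> : l * ebin k d 1 s = ebin k d r (r * s) by rewrite -rE /ebin; ring.
have -> : l * zbin k 1 s = zbin k r (r * s) by rewrite -rE /zbin; ring.
have -> : l * ybin k 1 s = ybin k r (r * s) by rewrite -rE /ybin; ring.
have hv0 : (ebin k%:MP d%:MP 'X_0 'X_1).@[v] = ebin k d r (r * s).
  by rewrite rmorph_ebin /= !mevalC !mevalXU.
have hv1 : (zbin k%:MP 'X_0 'X_1).@[v] = zbin k r (r * s).
  by rewrite rmorph_zbin /= !mevalC !mevalXU.
have hv2 : (ybin k%:MP 'X_0 'X_1).@[v] = ybin k r (r * s).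
  by rewrite rmorph_ybin /= !mevalC !mevalXU.
rewrite (tnth_nth 0); case: (ord3P i) => -> /=; rewrite /eigpt /vec3 /= -hv0 -hv1 -hv2;
  by rewrite !(mevalD, mevalM, rmorphXn) /= !mevalC.
Qed.

(** Pulled back to binary forms, a product of factors is 0 in a domain, so one factor vanishes on
    the curve. By [curve_map_eq0] it is a multiple of the whole sextic, and no degree is left for
    the other. *)
Lemma irreducible_sextic : irreducible_mpoly F.
Proof.
split=> [|p q FE]; first by rewrite msize_sextic.
have F0 := sextic_neq0.
have factor (a b : {mpoly C[3]}) : F = a * b -> a \mPo curve_map = 0 -> (msize b <= 1)%N.
  move=> FE' ac; have a0 : a != 0 by apply: contraNneq F0 => a0; rewrite FE' a0 mul0r.
  have b0 : b != 0 by apply: contraNneq F0 => b0; rewrite FE' b0 mulr0.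
  have sz := msizeM a0 b0; rewrite -FE' msize_sextic in sz.
  have a1 : (0 < msize a)%N by rewrite lt0n msize_poly_eq0.
  have b1 : (0 < msize b)%N by rewrite lt0n msize_poly_eq0.
  have [|c aE] := curve_map_eq0 (g := a) _ ac; first by move: sz a1 b1; move: (msize a) (msize b) => x y sz a1 b1; lia.
  have c0 : c != 0 by apply: contraNneq a0 => c0; rewrite aE c0 scale0r.
  by move: sz b1; rewrite aE msizeZ // msize_sextic; move: (msize b) => x sz b1; lia.
have : (p \mPo curve_map) * (q \mPo curve_map) = 0.
  by rewrite -rmorphM /= -FE sextic_curve_map.
move=> /eqP; rewrite mulf_eq0 => /orP[/eqP pc|/eqP qc].
  by right; apply: factor FE pc.
by left; apply: factor qc; rewrite mulrC.
Qed.

End Irreducible.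

(** * Homogeneity of the maps, and rationality *)

Section Homogeneity.
Variables (n : nat) (K : comNzRingType).
Implicit Types (p q e z y : {mpoly K[n]}).

Lemma dhomog_mulC m c p : p \is m.-homog -> c%:MP * p \is m.-homog.
Proof. by move=> pm; rewrite mul_mpolyC dhomogZ. Qed.

Lemma dhomog1M p q : p \is 1.-homog -> q \is 1.-homog -> p * q \is 2.-homog.
Proof. exact: (@dhomogM _ _ _ 1 _ 1). Qed.

Lemma dhomog2M p q : p \is 2.-homog -> q \is 2.-homog -> p * q \is 4.-homog.
Proof. exact: (@dhomogM _ _ _ 2 _ 2). Qed.

Lemma dhomog12M p q : p \is 1.-homog -> q \is 2.-homog -> p * q \is 3.-homog.
Proof. exact: (@dhomogM _ _ _ 1 _ 2). Qed.

Lemma dhomog3M p q : p \is 3.-homog -> q \is 3.-homog -> p * q \is 6.-homog.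
Proof. exact: (@dhomogM _ _ _ 3 _ 3). Qed.

Lemma dhomog_bin (k d : K) p q : p \is 1.-homog -> q \is 1.-homog ->
  [/\ ebin k%:MP d%:MP p q \is 6.-homog, zbin k%:MP p q \is 6.-homog
    & ybin k%:MP p q \is 6.-homog].
Proof.
move=> hp hq.
have p2 := dhomog1M hp hp; have q2 := dhomog1M hq hq.
have p3 := dhomog12M hp p2; have q3 := dhomog12M hq q2.
have pq := dhomog1M hp hq.
have ppq := dhomog12M hp pq; have qpq := dhomog12M hq pq.
have -> : ebin k%:MP d%:MP p q = (p * (p * p)) * (p * (p * p))
  + (d - 2 * k)%:MP * ((p * (p * p)) * (q * (q * q)))
  - (q * (q * q)) * (q * (q * q)) by rewrite /ebin; ring.
have -> : zbin k%:MP p q = (p * (p * q)) * (p * (p * p) - k%:MP * (q * (q * q))).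
  by rewrite /zbin; ring.
have -> : ybin k%:MP p q = (q * (p * q)) * (k%:MP * (p * (p * p)) + q * (q * q)).
  by rewrite /ybin; ring.
split.
- apply: rpredB (dhomog3M q3 q3); apply: rpredD (dhomog3M p3 p3) _.
  exact: dhomog_mulC (dhomog3M p3 q3).
- by apply: dhomog3M ppq _; apply: rpredB p3 _; apply: dhomog_mulC.
by apply: dhomog3M qpq _; apply: rpredD _ q3; apply: dhomog_mulC.
Qed.

Lemma dhomog_psi (k d : K) e z y :
    e \is 1.-homog -> z \is 1.-homog -> y \is 1.-homog ->
  psi0 k%:MP d%:MP e z y \is 4.-homog /\ psi1 k%:MP d%:MP e z y \is 4.-homog.
Proof.
move=> he hz hy.
pose t := theta k d; pose r := rho k d; pose kk := kap k.
have ee := dhomog1M he he; have ez := dhomog1M he hz; have zz := dhomog1M hz hz.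
have zy := dhomog1M hz hy; have yy := dhomog1M hy hy.
have hD c p : p \is 4.-homog -> c%:MP * p \is 4.-homog := @dhomog_mulC 4 c p.
have -> : psi0 k%:MP d%:MP e z y = (kk ^+ 3)%:MP * ((e * e) * (e * z))
   - (kk ^+ 3 * k)%:MP * ((e * e) * (y * y))
   + (((k ^+ 2 - 1) * d ^+ 2 - 4 * k * kk * d + 2 * kk ^+ 2) * kk)%:MP
     * ((e * z) * (z * y))
   + (r * (k * d ^+ 2 - 2 * kk * d - k * kk ^+ 2) - k * kk * r ^+ 2 - r ^+ 2 * d
        + 2 * kk * r * t)%:MP * ((z * y) * (y * y))
   - (r ^+ 2 * d)%:MP * ((z * z) * (z * z)).
  by rewrite /psi0 /kk /r /t /theta /rho /kap; ring.
have -> : psi1 k%:MP d%:MP e z y = (kk ^+ 3)%:MP * ((e * e) * (z * z))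
   + ((k * d ^+ 2 - 2 * kk * d - k * kk ^+ 2) * kk)%:MP * ((e * z) * (y * y))
   + (k * r ^+ 2 * d - 2 * r * t * d - kk * r ^+ 2
        - r * ((k ^+ 2 - 1) * d ^+ 2 - 4 * k * kk * d + 2 * kk ^+ 2))%:MP
     * ((z * z) * (z * y))
   - (kk * r ^+ 2)%:MP * ((y * y) * (y * y)).
  by rewrite /psi1 /kk /r /t /theta /rho /kap; ring.
split.
- apply: rpredB; last by apply: hD; apply: dhomog2M.
  apply: rpredD; last by apply: hD; apply: dhomog2M.
  apply: rpredD; last by apply: hD; apply: dhomog2M.
  by apply: rpredB; apply: hD; apply: dhomog2M.
apply: rpredB; last by apply: hD; apply: dhomog2M.
apply: rpredD; last by apply: hD; apply: dhomog2M.
by apply: rpredD; apply: hD; apply: dhomog2M.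
Qed.

End Homogeneity.

Section Rational.
Variable C : numClosedFieldType.
Variables (k d h om : C).
Hypotheses (k_neq0 : k != 0) (K_neq0 : kap k != 0) (r_neq0 : rho k d != 0).
Hypotheses (h_neq0 : h != 0) (om2 : om ^+ 2 = - 1 - om).

Let le := eigform_e h.
Let ly := eigform_y om.
Let lz : {mpoly C[3]} := 'X_0 + om%:MP * 'X_1 + (om ^+ 2)%:MP * 'X_2.
Let eb : {mpoly C[2]} := ebin k%:MP d%:MP 'X_0 'X_1.
Let zb : {mpoly C[2]} := zbin k%:MP 'X_0 'X_1.
Let yb : {mpoly C[2]} := ybin k%:MP 'X_0 'X_1.

Definition curve_inv : 2.-tuple {mpoly C[3]} :=
  [tuple psi0 k%:MP d%:MP le lz ly; psi1 k%:MP d%:MP le lz ly].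

Lemma dhomog_X n (i : 'I_n) : ('X_i : {mpoly C[n]}) \is 1.-homog.
Proof. by rewrite dhomogX /= mdeg1. Qed.

Lemma dhomog_curve_map i : tnth (curve_map k d h om) i \is 6.-homog.
Proof.
have [he hz hy] := dhomog_bin k d (dhomog_X 0) (dhomog_X (1 : 'I_2)).
rewrite (tnth_nth 0).
have H a b : (h^-1)%:MP * eb + a%:MP * zb + b%:MP * yb \is 6.-homog.
  by apply: rpredD; [apply: rpredD|]; apply: dhomog_mulC.
have E0 : eigpt (h^-1)%:MP om%:MP eb zb yb 0 = (h^-1)%:MP * eb + 1%:MP * zb + 1%:MP * yb.
  by rewrite /eigpt /vec3 /= !mpolyC1 !mul1r.
have E1 : eigpt (h^-1)%:MP om%:MP eb zb yb 1 =
    (h^-1)%:MP * eb + (om ^+ 2)%:MP * zb + om%:MP * yb.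
  by rewrite /eigpt /vec3 /= rmorphXn.
have E2 : eigpt (h^-1)%:MP om%:MP eb zb yb 2 =
    (h^-1)%:MP * eb + om%:MP * zb + (om ^+ 2)%:MP * yb.
  by rewrite /eigpt /vec3 /= rmorphXn.
by case: (ord3P i) => ->; rewrite /curve_map /= -/eb -/zb -/yb ?E0 ?E1 ?E2; apply: H.
Qed.

Lemma dhomog_curve_inv i : tnth curve_inv i \is 4.-homog.
Proof.
have hl : le \is 1.-homog.
  by apply: dhomog_mulC; apply: rpredD; [apply: rpredD|]; apply: dhomog_X.
have hz : lz \is 1.-homog.
  apply: rpredD; [apply: rpredD|]; first exact: dhomog_X;
    by apply: dhomog_mulC; apply: dhomog_X.
have hy : ly \is 1.-homog.
  apply: rpredD; [apply: rpredD|]; first exact: dhomog_X;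
    by apply: dhomog_mulC; apply: dhomog_X.
have [h0 h1] := dhomog_psi k d hl hz hy.
by rewrite (tnth_nth 0); case: i => [[|[|//]] i].
Qed.

(** The linear forms [le], [lz], [ly] return 3e, 3z, 3y on an eigenpoint, whence 3^4 for
    quartics. *)
Lemma curve_inv_comp :
  tnth curve_inv 0 \mPo curve_map k d h om = 3 ^+ 4 * psi0 k%:MP d%:MP eb zb yb /\
  tnth curve_inv 1 \mPo curve_map k d h om = 3 ^+ 4 * psi1 k%:MP d%:MP eb zb yb.
Proof.
have hh := mpolyC_h h_neq0; have oo := mpolyC_om om2.
have eC : le \mPo curve_map k d h om = 3 * eb.
  rewrite /le /eigform_e rmorphM !rmorphD /= comp_mpolyC !comp_mpolyXU /=.
  by rewrite -/eb -/zb -/yb /eigpt /vec3 /=; move: eb zb yb => e z y; ring: hh oo.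
have zC : lz \mPo curve_map k d h om = 3 * zb.
  rewrite /lz !rmorphD !rmorphM /= !comp_mpolyC !comp_mpolyXU /=.
  by rewrite ?rmorphXn -/eb -/zb -/yb /eigpt /vec3 /=; move: eb zb yb => e z y; ring: oo.
have yC : ly \mPo curve_map k d h om = 3 * yb.
  rewrite /ly /eigform_y !rmorphD !rmorphM /= !comp_mpolyC !comp_mpolyXU /=.
  by rewrite ?rmorphXn -/eb -/zb -/yb /eigpt /vec3 /=; move: eb zb yb => e z y; ring: oo.
rewrite !(tnth_nth 0) /= rmorph_psi0 rmorph_psi1 /= eC zC yC !comp_mpolyC.
by rewrite psi0Z psi1Z.
Qed.

Lemma curve_inv_eq :
  'X_0 * (tnth curve_inv 1 \mPo curve_map k d h om) =
  'X_1 * (tnth curve_inv 0 \mPo curve_map k d h om).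
Proof.
have [-> ->] := curve_inv_comp.
by rewrite mulrCA psi_inverse mulrCA.
Qed.

Lemma curve_inv_neq0 : tnth curve_inv 0 \mPo curve_map k d h om != 0.
Proof.
have [-> _] := curve_inv_comp; have /closed_nonrootP[s] := denom_neq0 d K_neq0.
rewrite rootE horner_denom horner_es horner_zs horner_ys; apply: contraNneq => p0.
pose v : 'I_2 -> C := fun i => [:: 1; s]`_i.
have := congr1 (meval v) p0; rewrite meval0 mevalM rmorph_psi0 rmorph_ebin rmorph_zbin rmorph_ybin.
rewrite /= !mevalC !mevalXU /= => /eqP; rewrite mulf_eq0 => /orP[|//].
by rewrite rmorphXn rmorph_nat expf_eq0 pnatr_eq0.
Qed.

End Rational.

Lemma rational_sextic (R : realType) (k d h om : R[i]) :
    k != 0 -> kap k != 0 -> h != 0 -> om ^+ 2 = - 1 - om ->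
  rational_curve (mpoly_sextic k d h).
Proof.
move=> k0 K0 h0 om2; exists 6%N, 4%N, (curve_map k d h om), (curve_inv k d h om).
split; first exact: dhomog_curve_map.
split; first exact: dhomog_curve_inv.
split; first exact: sextic_curve_map.
split; first exact: curve_inv_eq.
by left; apply: curve_inv_neq0.
Qed.

(** * Extremality *)

Section Lift.
Variable C : numClosedFieldType.
Implicit Types k d e z y s l : C.

Lemma quadratic_root (a b c : C) : a != 0 -> exists x, a * x ^+ 2 + b * x + c = 0.
Proof.
move=> a0; exists ((sqrtC (b ^+ 2 - 4 * a * c) - b) / (2 * a)).
set r := sqrtC _; have r2 : r ^+ 2 = b ^+ 2 - 4 * a * c by rewrite sqrtCK.
have -> : c = (b ^+ 2 - r ^+ 2) / (4 * a) by rewrite r2; field.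
by field.
Qed.

(** Up to the common factor -1/s^6, the substitution s -> -1/s fixes e and exchanges z and y. As
    conjugation at a real point also exchanges z and y, the two together give the real structure on
    the parameter line. *)
Lemma ebinV k d s : s != 0 -> ebin k d 1 (- s^-1) = - ebin k d 1 s / s ^+ 6.
Proof. by move=> s0; rewrite /ebin; field. Qed.

Lemma zbinV k s : s != 0 -> zbin k 1 (- s^-1) = - ybin k 1 s / s ^+ 6.
Proof. by move=> s0; rewrite /zbin /ybin; field. Qed.

Lemma ybinV k s : s != 0 -> ybin k 1 (- s^-1) = - zbin k 1 s / s ^+ 6.
Proof. by move=> s0; rewrite /zbin /ybin; field. Qed.

(* The two branches of the parametrisation that are exchanged by the
   symmetries of the curve are matched by [s |-> zeta s] with [zeta^3 = 1]. *)
Lemma curve_lift_cube k d e z y s l :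
    e = l * ebin k d 1 s -> z * y = l ^+ 2 * (zbin k 1 s * ybin k 1 s) ->
    z ^+ 3 = (l * zbin k 1 s) ^+ 3 -> z * y != 0 ->
  exists s', [/\ e = l * ebin k d 1 s', z = l * zbin k 1 s' & y = l * ybin k 1 s'].
Proof.
move=> eE zyE z3 zy0.
have [z0 y0] : z != 0 /\ y != 0 by apply/andP; rewrite -negb_or -mulf_eq0.
have lz0 : l * zbin k 1 s != 0.
  by apply: contraNneq z0 => lz; move: z3 => /eqP; rewrite lz expr0n expf_eq0.
pose c := z / (l * zbin k 1 s).
have c3 : c ^+ 3 = 1 by rewrite expr_div_n z3 divff // expf_eq0.
have zE : z = c * (l * zbin k 1 s) by rewrite divfK.
exists (c * s).
have e1 : ebin k d 1 (c * s) = ebin k d 1 s.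
  by rewrite /ebin; ring: c3.
have z1 : zbin k 1 (c * s) = c * zbin k 1 s by rewrite /zbin; ring: c3.
have y1 : ybin k 1 (c * s) = c ^+ 2 * ybin k 1 s by rewrite /ybin; ring: c3.
rewrite e1 z1 y1; split=> //; first by rewrite {1}zE; ring.
apply: (mulfI z0); rewrite zyE {1}zE; ring: c3.
Qed.

(** Surjectivity of the parametrisation onto these zeros, by undoing its stages: the quotient
    parameter x, then m = s^3, then a cube root. *)
Lemma curve_lift k d e z y : rho k d != 0 -> e != 0 -> z * y != 0 ->
    wsextic k d e (z * y) (z ^+ 3 + y ^+ 3) = 0 ->
  exists s l, [/\ s != 0, l != 0, e = l * ebin k d 1 s, z = l * zbin k 1 s
    & y = l * ybin k 1 s].
Proof.
move=> r0 e0 zy0 w0.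
have [x [xP xQ]] : exists x, z * y = ppar k x (e - d * x) /\
    z ^+ 3 + y ^+ 3 = qpar k x (e - d * x).
  have [x xE] := quadratic_root (- k * e) (z * y) r0.
  have pE : z * y = ppar k x (e - d * x).
    have -> : z * y = - (rho k d * x ^+ 2 + - k * e * x) by apply/eqP; rewrite -subr_eq0 opprK addrC xE.
    by rewrite /ppar /rho; ring.
  have := wsextic_factor k d x (e - d * x) (z ^+ 3 + y ^+ 3).
  rewrite -pE subrK w0 => /esym/eqP; rewrite mulf_eq0 !subr_eq0.
  case/orP=> /eqP qE; first by exists x.
  (* If q does not come from x, it comes from the other root of the quadratic. *)
  pose x' := (k * (e - d * x) + kap k * x) / rho k d.
  have x'E : k * (e - d * x) + kap k * x = rho k d * x' by rewrite [RHS]mulrC divfK.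
  exists x'; split.
    rewrite pE /ppar x'E.
    apply: (mulfI r0); transitivity (rho k d * x' * (rho k d * x)); first by ring.
    have -> : rho k d * x = k * e - rho k d * x' by rewrite -x'E /rho; ring.
    by rewrite /ppar /rho; ring.
  apply: (mulfI (x := rho k d ^+ 3)); first by rewrite expf_eq0.
  by rewrite qE x'E /qpar; ring.
have x0 : x != 0 by apply: contraNneq zy0 => x_0; rewrite xP x_0 /ppar mul0r.
have Nx0 : - x != 0 by rewrite oppr_eq0.
(* With x = l m, the equation e = l (1 + (d - 2k) m - m^2) becomes this quadratic in m. *)
have [m mE] := quadratic_root ((d - 2 * k) * x - e) x Nx0.
have m0 : m != 0 by apply: contraNneq x0 => m_0; move/eqP: mE; rewrite m_0 expr0n !mulr0 !add0r.
pose s := 3.-root m; have s3 : s ^+ 3 = m by rewrite rootCK.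
have s0 : s != 0 by apply: contraNneq m0 => s_0; rewrite -s3 s_0 expr0n.
pose l := x / m; have lE : x = l * s ^+ 3 by rewrite s3 divfK.
have l0 : l != 0 by rewrite mulf_neq0 ?invr_eq0.
have eE : e = l * ebin k d 1 s.
  have s6 : s ^+ 6 = m ^+ 2 by rewrite -[6%N]/(3 * 2)%N exprM s3.
  apply: (mulIf m0); rewrite /ebin s6 s3 /l.
  have -> : e * m = x * (1 + (d - 2 * k) * m - m ^+ 2).
    by apply/eqP; rewrite -subr_eq0 -oppr_eq0 -[X in _ == X]mE; apply/eqP; ring.
  by field.
have zyE : z * y = l ^+ 2 * (zbin k 1 s * ybin k 1 s).
  by rewrite xP eE lE /ppar /ebin /zbin /ybin /kap; ring.
have qE : z ^+ 3 + y ^+ 3 = l ^+ 3 * (zbin k 1 s ^+ 3 + ybin k 1 s ^+ 3).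
  by rewrite xQ eE lE /qpar /ebin /zbin /ybin /kap; ring.
(* Both z^3 and the two cubes are roots of Z^2 - qZ + p^3. If z^3 matches the cube of [ybin], the
   parameter -1/s takes the place of s. *)
have : (z ^+ 3 - (l * zbin k 1 s) ^+ 3) * (z ^+ 3 - (l * ybin k 1 s) ^+ 3) = 0.
  have -> : (z ^+ 3 - (l * zbin k 1 s) ^+ 3) * (z ^+ 3 - (l * ybin k 1 s) ^+ 3) =
     z ^+ 3 * (z ^+ 3 + y ^+ 3 - l ^+ 3 * (zbin k 1 s ^+ 3 + ybin k 1 s ^+ 3))
     - ((z * y) ^+ 3 - (l ^+ 2 * (zbin k 1 s * ybin k 1 s)) ^+ 3) by ring.
  by rewrite qE zyE !subrr mulr0 subr0.
have fin s1 l1 : l1 != 0 -> e = l1 * ebin k d 1 s1 ->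
    z * y = l1 ^+ 2 * (zbin k 1 s1 * ybin k 1 s1) -> z ^+ 3 = (l1 * zbin k 1 s1) ^+ 3 ->
    exists s l, [/\ s != 0, l != 0, e = l * ebin k d 1 s, z = l * zbin k 1 s
    & y = l * ybin k 1 s].
  move=> l10 e1 zy1 z1; have [s2 [e2 z2 y2]] := curve_lift_cube e1 zy1 z1 zy0.
  exists s2, l1; split=> //; apply: contraNneq zy0 => s20.
  by rewrite z2 s20 /zbin; apply/eqP; ring.
move/eqP; rewrite mulf_eq0 !subr_eq0 => /orP[/eqP z3|/eqP z3]; first exact: fin z3.
apply: (fin (- s^-1) (- l * s ^+ 6)).
- by rewrite mulf_neq0 ?oppr_eq0 ?expf_eq0.
- by rewrite ebinV // eE; field.
- by rewrite zbinV // ybinV // zyE; field.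
- by rewrite zbinV // z3; field.
Qed.

End Lift.

Lemma meval_map_mpoly n (K L : comNzRingType) (f : {rmorphism K -> L})
    (p : {mpoly K[n]}) x :
  (map_mpoly f p).@[fun i => f (x i)] = f p.@[x].
Proof.
elim/mpolyind: p => [|c m p _ _ IHp]; first by rewrite rmorph0 !meval0 rmorph0.
rewrite rmorphD !mevalD rmorphD IHp; congr (_ + _).
rewrite -mul_mpolyC rmorphM /= map_mpolyC map_mpolyX !mevalM rmorphM /= !mevalC !mevalX.
by rewrite rmorph_prod; congr (_ * _); apply: eq_bigr => i _; rewrite rmorphXn.
Qed.

Lemma map_mpoly_mderiv n (K L : comNzRingType) (f : {rmorphism K -> L})
    (p : {mpoly K[n]}) i :
  (map_mpoly f p)^`M(i) = map_mpoly f p^`M(i).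
Proof.
by apply/mpolyP => m; rewrite mcoeff_mderiv !mcoeff_map_mpoly mcoeff_mderiv raddfMn.
Qed.

Lemma dhomog_map_mpoly n (K L : nzRingType) (f : {rmorphism K -> L}) m
    (p : {mpoly K[n]}) : p \is m.-homog -> map_mpoly f p \is m.-homog.
Proof.
move=> pm; apply/dhomogP => j; apply: contraTeq => jm.
by rewrite -mcoeff_eq0 mcoeff_map_mpoly (dhomog_nemf_coeff pm jm) raddf0.
Qed.

(** * The two parameters over a real zero *)

Section RealPoints.
Variable R : realType.
Local Notation toC := (real_complex R).
Implicit Types (k d h u v w a b c : R).

Definition omega : R[i] := Complex (- 1 / 2) (Num.sqrt 3 / 2).

Lemma omega2 : omega ^+ 2 = - 1 - omega.
Proof.
have s3 : Num.sqrt (3 : R) ^+ 2 = 3 by rewrite sqr_sqrtr.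
rewrite expr2 /omega; apply/eqP; rewrite eq_complex /=; apply/andP; split; apply/eqP.
  by field: s3.
by field.
Qed.

Lemma conj_omega : conjc omega = omega ^+ 2.
Proof.
rewrite omega2; apply/eqP; rewrite eq_complex /=; apply/andP; split; apply/eqP; lra.
Qed.

Definition cpt k d h (s : R[i]) : 'I_3 -> R[i] :=
  eigpt (toC h)^-1 omega (ebin (toC k) (toC d) 1 s) (zbin (toC k) 1 s) (ybin (toC k) 1 s).

Definition lies_over k d h (x : R * R * R) (s : R[i]) : Prop :=
  exists2 l, l != 0 & forall i, toC (pt3 x.1.1 x.1.2 x.2 i) = l * cpt k d h s i.

Lemma lies_over_uniq k d h (x y : R * R * R) s :
  x.1.1 + x.1.2 + x.2 = 1 -> y.1.1 + y.1.2 + y.2 = 1 ->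
  lies_over k d h x s -> lies_over k d h y s -> x = y.
Proof.
case: x y => [[x1 x2] x3] [[y1 y2] y3] /= sx sy [l l0 lx] [m m0 my].
pose S := cpt k d h s 0 + cpt k d h s 1 + cpt k d h s 2.
have lS : l * S = 1.
  rewrite /S; move: lx; move: (cpt k d h s) => q lx.
  by rewrite !mulrDr -!lx /pt3 /= -!rmorphD sx rmorph1.
have mS : m * S = 1.
  rewrite /S; move: my; move: (cpt k d h s) => q my.
  by rewrite !mulrDr -!my /pt3 /= -!rmorphD sy rmorph1.
have S0 : S != 0 by apply: contraNneq (oner_neq0 R[i]) => S0; rewrite -lS S0 mulr0.
have lm : l = m by apply: (mulIf S0); rewrite lS mS.
have e i : pt3 x1 x2 x3 i = pt3 y1 y2 y3 i.
  by apply: complexI; rewrite lx my lm.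
by have := (e 0, e 1, e 2); rewrite /pt3 /= => -[[-> ->] ->].
Qed.

Lemma lies_over_exists k d h (x : R * R * R) :
    rho k d != 0 -> h != 0 -> x.1.1 + x.1.2 + x.2 != 0 ->
    pform x.1.1 x.1.2 x.2 != 0 -> sextic k d h x.1.1 x.1.2 x.2 = 0 ->
  exists s t, [/\ s != 0, t != 0, s != t, lies_over k d h x s & lies_over k d h x t].
Proof.
case: x => [[a b] c] /= r0 h0 s0 p0 f0.
have Ch0 : toC h != 0 by rewrite (inj_eq (@complexI _)).
have om2 := omega2.
pose z := (toC a + omega * toC b + omega ^+ 2 * toC c) / 3.
pose y := (toC a + omega ^+ 2 * toC b + omega * toC c) / 3.
pose e := toC (h * (a + b + c) / 3).
have eE : e = toC h * (toC a + toC b + toC c) / 3.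
  by rewrite /e fmorph_div rmorph_nat rmorphM !rmorphD.
have ptE i : toC (pt3 a b c i) = eigpt (toC h)^-1 omega e z y i.
  case: (ord3P i) => ->; rewrite /pt3 /eigpt /vec3 /= eE /z /y; field: om2; by rewrite ?Ch0.
have e0 : e != 0.
  rewrite /e (inj_eq (@complexI _)) mulf_neq0 ?invr_eq0 ?pnatr_eq0 //.
  by rewrite mulf_neq0.
have zyE : z * y = toC (pform a b c) / 9.
  rewrite /z /y /pform !(rmorphB, rmorphD, rmorphM, rmorphXn).
  by field: om2.
have zy0 : z * y != 0.
  by rewrite zyE mulf_neq0 ?invr_eq0 ?pnatr_eq0 // (inj_eq (@complexI _)).
have Cr0 : rho (toC k) (toC d) != 0.
  have -> : rho (toC k) (toC d) = toC (rho k d).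
    by rewrite rmorph_rho.
  by rewrite (inj_eq (@complexI _)).
have w0 : wsextic (toC k) (toC d) e (z * y) (z ^+ 3 + y ^+ 3) = 0.
  apply: (mulfI (x := 729)); first by rewrite pnatr_eq0.
  rewrite mulr0 -(sextic_eigpt _ _ _ _ _ (mulfV Ch0) om2) -!ptE /pt3 /=.
  by rewrite -rmorph_sextic f0.
have [s [l [sn0 l0 es zs ys]]] := curve_lift Cr0 e0 zy0 w0.
have cz : conjc z = y.
  have cbz (p : {rmorphism R[i] -> R[i]}) : p = conjc :> (R[i] -> R[i]) -> p z = y.
    move=> pE; have pR x : p (toC x) = toC x by rewrite pE conjc_real.
    have po : p omega = omega ^+ 2 by rewrite pE conj_omega.
    rewrite /z /y fmorph_div rmorph_nat !rmorphD !rmorphM !pR !po.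
    by congr (_ / 3); ring: om2.
  exact: cbz.
have ce : conjc e = e by rewrite /e conjc_real.
have cb (p : {rmorphism R[i] -> R[i]}) : p = conjc :> (R[i] -> R[i]) ->
    [/\ p (ebin (toC k) (toC d) 1 s) = ebin (toC k) (toC d) 1 (conjc s),
        p (zbin (toC k) 1 s) = zbin (toC k) 1 (conjc s) &
        p (ybin (toC k) 1 s) = ybin (toC k) 1 (conjc s)].
  by move=> pE; rewrite rmorph_ebin rmorph_zbin rmorph_ybin rmorph1 pE !conjc_real.
have [ceb czb cyb] := cb _ (erefl (conjc : R[i] -> R[i])).
have cs0 : conjc s != 0 by rewrite conjc_eq0.
exists s, (- (conjc s)^-1); split=> //.
- by rewrite oppr_eq0 invr_eq0.
(* Equality would make s times its conjugate equal to -1. *)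
- apply/eqP => sE; have := mulcJ_ge0 s; rewrite {1}sE mulNr mulVf //.
  by rewrite oppr_ge0 ler10.
- by exists l => // i; rewrite ptE es zs ys; case: (ord3P i) => ->;
    rewrite /cpt /eigpt /vec3 /=; ring.
exists (- conjc l * conjc s ^+ 6).
  by rewrite mulf_neq0 ?oppr_eq0 ?expf_eq0 ?conjc_eq0 // (negPf l0).
have e2 : e = (- conjc l * conjc s ^+ 6) * ebin (toC k) (toC d) 1 (- (conjc s)^-1).
  by rewrite ebinV // -ce es rmorphM ceb; field.
have y2 : y = (- conjc l * conjc s ^+ 6) * ybin (toC k) 1 (- (conjc s)^-1).
  by rewrite ybinV // -cz zs rmorphM czb; field.
have z2 : z = (- conjc l * conjc s ^+ 6) * zbin (toC k) 1 (- (conjc s)^-1).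
  by rewrite zbinV // -[z]conjcK cz ys rmorphM cyb; field.
move=> i; rewrite ptE e2 z2 y2; case: (ord3P i) => ->;
  rewrite /cpt /eigpt /vec3 /=; ring.
Qed.

End RealPoints.

(** * Root counts for pullbacks: uniqueness, extremality, no sum of squares *)

Section Extremal.
Variable R : realType.
Local Notation toC := (real_complex R).
Variables (k d h u v w : R).
Hypothesis fit : fitted k d h u v w.

Let f := mpoly_sextic k d h.
Let pt (x : R * R * R) : 'I_3 -> R := pt3 x.1.1 x.1.2 x.2.

Lemma params_over (ps : seq (R * R * R)) : uniq ps ->
    (forall p, p \in ps -> p \in zeros u v w /\ pform p.1.1 p.1.2 p.2 != 0) ->
  exists rs, [/\ uniq rs, size rs = (2 * size ps)%N, 0 \notin rs &
    forall s, s \in rs -> exists2 p, p \in ps & lies_over k d h p s].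
Proof.
have [[k0 r0 _ _] h0] := (fit_adm fit, fit_h fit).
elim: ps => [|p ps IHps]; first by exists [::].
move=> /= /andP[p_ps ps_uniq] ps_zero.
have [q qps|rs [rs_uniq rs_size rs0 rsP]] := IHps ps_uniq.
  by apply: ps_zero; rewrite inE qps orbT.
have sum1 q : q \in p :: ps -> q.1.1 + q.1.2 + q.2 = 1 /\ sextic k d h q.1.1 q.1.2 q.2 = 0.
  by case: q => [[a b] c] /ps_zero[/(zeros_root fit)].
have pin : p \in p :: ps by rewrite mem_head.
have [p1 p0] := sum1 p pin; have [_ pf] := ps_zero p pin.
have p1' : p.1.1 + p.1.2 + p.2 != 0 by rewrite p1 oner_neq0.
have [s [t [s0 t0 st ps_s ps_t]]] := lies_over_exists (lt0r_neq0 r0) h0 p1' pf p0.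
have new r : lies_over k d h p r -> r \notin rs.
  move=> pr; apply/negP => /rsP[q qps qr].
  have [q1 _] : q.1.1 + q.1.2 + q.2 = 1 /\ sextic k d h q.1.1 q.1.2 q.2 = 0.
    by apply: sum1; rewrite inE qps orbT.
  by move: p_ps; rewrite (lies_over_uniq p1 q1 pr qr) qps.
exists [:: s, t & rs]; split.
- by rewrite /= inE negb_or st !new.
- by rewrite /= rs_size mulnS.
- by rewrite !inE !negb_or ![0 == _]eq_sym s0 t0.
move=> r; rewrite !inE => /or3P[/eqP->|/eqP->|/rsP[q qps qr]].
- by exists p.
- by exists p.
by exists q => //; rewrite inE qps orbT.
Qed.

(** Nine zeros have p nonzero and give 18 nonzero parameters; (1,1,1) adds s = 0, its other
    parameter being infinity, which is invisible to polynomials in s. *)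
Lemma params19 : exists rs : seq R[i], [/\ uniq rs, size rs = 19%N &
  forall s, s \in rs -> exists2 p, p \in zeros u v w & lies_over k d h p s].
Proof.
have zE : zeros u v w = rcons (take 9 (zeros u v w)) (1 / 3, 1 / 3, 1 / 3) by [].
have := zeros_uniq fit; rewrite {1}zE rcons_uniq => /andP[c9 uniq9].
have [p p9|rs [rs_uniq rs_size rs0 rsP]] := params_over uniq9.
  have pz : p \in zeros u v w by apply: mem_take p9.
  split=> //; apply: contraNneq c9 => /pform_eq0[e1 e2].
  case: p p9 pz e1 e2 => [[a b] c] /= p9 pz ab bc.
  have [abc _] := zeros_root fit pz.
  have cE : c = 1 / 3 by rewrite ab bc in abc; lra.
  by move: p9; rewrite ab bc cE.
exists (0 :: rs); split=> [||s]; first by rewrite /= rs0.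
  by rewrite /= rs_size.
rewrite inE => /predU1P[->|/rsP[p p9 ps]]; last first.
  by exists p => //; apply: mem_take p9.
exists (1 / 3, 1 / 3, 1 / 3); first by rewrite zE mem_rcons mem_head.
have h0 := fit_h fit; have Ch0 : toC h != 0 by rewrite (inj_eq (@complexI _)).
exists (toC h / 3) => [|i]; first by rewrite mulf_neq0 ?invr_eq0 ?pnatr_eq0.
have -> : toC (pt3 (1 / 3) (1 / 3) (1 / 3) i) = 1 / 3.
  by case: (ord3P i) => ->; rewrite /pt3 /= fmorph_div rmorph_nat rmorph1.
have e1 : ebin (toC k) (toC d) 1 0 = 1 by rewrite /ebin; ring.
have z0 : zbin (toC k) 1 0 = 0 by rewrite /zbin; ring.
have y0 : ybin (toC k) 1 0 = 0 by rewrite /ybin; ring.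
by rewrite /cpt e1 z0 y0; case: (ord3P i) => ->; rewrite /eigpt /vec3 /=; field.
Qed.

Lemma cplx_meval (g : {mpoly R[3]}) x : (cplx g).@[fun i => toC (x i)] = toC g.@[x].
Proof. exact: (meval_map_mpoly (real_complex R)). Qed.

Lemma over_meval n (g : {mpoly R[3]}) p s :
  g \is n.-homog -> g.@[pt p] = 0 -> lies_over k d h p s -> (cplx g).@[cpt k d h s] = 0.
Proof.
move=> gn gp [l l0 lx]; have gC : cplx g \is n.-homog by exact: dhomog_map_mpoly.
have := cplx_meval g (pt p); rewrite gp rmorph0.
rewrite (meval_homogZ gC lx) => /eqP.
by rewrite mulf_eq0 expf_eq0 (negPf l0) andbF => /eqP.
Qed.

Let cpoly (i : 'I_3) : {poly R[i]} :=
  eigpt ((toC h)^-1)%:P (omega R)%:P (ebin (toC k)%:P (toC d)%:P 1 'X)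
    (zbin (toC k)%:P 1 'X) (ybin (toC k)%:P 1 'X) i.

Lemma horner_cpoly s i : (cpoly i).[s] = cpt k d h s i.
Proof.
rewrite /cpoly /cpt -horner_es -horner_zs -horner_ys.
move: (ebin _ _ _ _) (zbin _ _ _) (ybin _ _ _) => a b c.
by case: (ord3P i) => ->; rewrite /eigpt /vec3 /= !(hornerD, hornerM, horner_exp, hornerC).
Qed.

Lemma size_cpoly i : (size (cpoly i) <= 7)%N.
Proof.
have D (p q : {poly R[i]}) : (size p <= 7 -> size q <= 7 -> size (p + q)%R <= 7)%N.
  by move=> hp hq; apply: leq_trans (size_polyD _ _) _; rewrite geq_max hp.
have Z c (p : {poly R[i]}) : (size p <= 7)%N -> (size (c%:P * p)%R <= 7)%N.
  by move=> hp; rewrite mul_polyC; apply: leq_trans (size_scale_leq _ _) _.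
have X n c : (n <= 6)%N -> (size ((c : R[i])%:P * 'X^n)%R <= 7)%N.
  by move=> n6; apply: Z; rewrite size_polyXn ltnS.
have H p q a b : p = a%:P -> q = b%:P ->
    (size (((toC h)^-1)%:P * ebin (toC k)%:P (toC d)%:P 1 'X
    + p * zbin (toC k)%:P 1 'X + q * ybin (toC k)%:P 1 'X)%R <= 7)%N.
  move=> -> ->.
  have -> : ebin (toC k)%:P (toC d)%:P 1 'X = 1%:P * 'X^0
    + (toC d - 2 * toC k)%:P * 'X^3 + (- 1)%:P * 'X^6 by rewrite /ebin; ring.
  have -> : zbin (toC k)%:P 1 'X = 1%:P * 'X^1 + (- toC k)%:P * 'X^4 by rewrite /zbin; ring.
  have -> : ybin (toC k)%:P 1 'X = (toC k)%:P * 'X^2 + 1%:P * 'X^5 by rewrite /ybin; ring.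
  apply: (D); first (apply: (D); apply: Z).
  - by apply: (D); [apply: (D)|]; apply: X.
  - by apply: (D); apply: X.
  by apply: Z; apply: (D); apply: X.
have E0 := H 1 1 1 1 (esym (polyC1 _)) (esym (polyC1 _)); rewrite !mul1r in E0.
have E1 := H _ _ _ _ (esym (polyC_exp 2 (omega R))) (erefl (omega R)%:P).
have E2 := H _ _ _ _ (erefl (omega R)%:P) (esym (polyC_exp 2 (omega R))).
by case: (ord3P i) => ->; [exact: E0 | exact: E1 | exact: E2].
Qed.

Lemma cplx_inj : injective (@cplx R).
Proof.
move=> p q pq; apply/mpolyP => m; apply: (@complexI R).
rewrite -[LHS](mcoeff_map_mpoly (real_complex R)) -[RHS](mcoeff_map_mpoly (real_complex R)).
by rewrite -/(cplx p) pq.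
Qed.

Lemma cone_kernel n (g : {mpoly R[3]}) : g \is n.-homog -> (n <= 6)%N ->
    mmap polyC cpoly (cplx g) = 0 -> exists c, cplx g = c *: cplx f.
Proof.
have [[k0 r0 _ _] h0] := (fit_adm fit, fit_h fit).
have nz (x : R) : x != 0 -> toC x != 0 by move=> x0; rewrite (inj_eq (@complexI _)).
have kapC : kap (toC k) = toC (kap k) by rewrite rmorph_kap.
have rhoC : rho (toC k) (toC d) = toC (rho k d).
  by rewrite rmorph_rho.
move=> gn n6 g0; have gC : cplx g \is n.-homog by exact: dhomog_map_mpoly.
rewrite /f /cplx map_mpoly_sextic.
apply: (kernel (nz _ (lt0r_neq0 k0)) _ _ (nz _ h0) (omega2 R)).
- by rewrite kapC nz // gt_eqF // kap_gt0.
- by rewrite rhoC nz // gt_eqF.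
- by apply: leq_trans (dhomog_msize_le gC) _; rewrite ltnS.
move=> l s; have := congr1 (fun p => p.[s]) g0; rewrite horner0 horner_mmap_polyC.
rewrite (meval_eq _ (horner_cpoly s)) => gs.
rewrite (@meval_homogZ _ _ n l (cpt k d h s)) ?gs ?mulr0 // => i.
by rewrite /cpt; case: (ord3P i) => ->; rewrite /eigpt /vec3 /=; ring.
Qed.

Lemma size_cone n (g : {mpoly R[3]}) : g \is n.-homog ->
  (size (mmap polyC cpoly (cplx g)) <= (n * 6).+1)%N.
Proof.
move=> gn; have gC : cplx g \is n.-homog by exact: dhomog_map_mpoly.
by have [] := mmap_polyC_lead size_cpoly size_cpoly (fun=> erefl) (dhomog_msize_le gC).
Qed.

Lemma cubic_eq0 (g : {mpoly R[3]}) : g \is 3.-homog ->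
  (forall p, p \in zeros u v w -> g.@[pt p] = 0) -> g = 0.
Proof.
move=> g3 g0; have [rs [rs_uniq rs_size rsP]] := params19.
have G0 : mmap polyC cpoly (cplx g) = 0.
  apply/eqP/negP => /negP G0.
  have : all (root (mmap polyC cpoly (cplx g))) rs.
    apply/allP => s /rsP[p pz ps]; rewrite rootE horner_mmap_polyC.
    by rewrite (meval_eq _ (horner_cpoly s)) (over_meval g3 (g0 p pz) ps).
  move=> /(max_poly_roots G0) /(_ rs_uniq); rewrite rs_size ltnNge.
  by rewrite (size_cone g3).
(* A multiple of the sextic that is also homogeneous of degree 3 must be 0. *)
have [c gc] := cone_kernel g3 isT G0.
have [_ r0 _ _] := fit_adm fit; have h0 := fit_h fit.
apply: cplx_inj; rewrite [RHS]rmorph0; apply/eqP/negP => /negP gn0.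
have g3C : cplx g \is 3.-homog by exact: dhomog_map_mpoly.
have g6C : cplx g \is 6.-homog.
  by rewrite gc dhomogZ //; apply: dhomog_map_mpoly; apply: dhomog_sextic.
by have := dhomog_uniq gn0 g3C g6C.
Qed.

(** At this point e = q = 0 and p = 3, so only the term cub^2 p^3 survives. The value serves to
    normalise the scalar in [sextic_unique]. *)
Lemma sextic_pos : 0 < f.@[pt3 1 (- 1) 0].
Proof.
have [_ _ c0 _] := fit_adm fit; rewrite meval_sextic /pt3 /=.
have -> : sextic k d h 1 (- 1) 0 = 27 * cub k d ^+ 2.
  by rewrite /sextic /wsextic /lin /pform /qform; ring.
by rewrite mulr_gt0 // exprn_gt0.
Qed.

(** By the chain rule the pullback of [g] has a double root at each of the 19 parameters. The
    resulting scalar is complex a priori; evaluation at a real point where [f] is positive shows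
    that it is real. *)
Lemma sextic_unique (g : {mpoly R[3]}) : g \is 6.-homog ->
    (forall p, p \in zeros u v w -> g.@[pt p] = 0) ->
    (forall p i, p \in zeros u v w -> (g^`M(i)).@[pt p] = 0) ->
  g = (g.@[pt3 1 (- 1) 0] / f.@[pt3 1 (- 1) 0]) *: f.
Proof.
move=> g6 g0 dg0; have [rs [rs_uniq rs_size rsP]] := params19.
have G0 : mmap polyC cpoly (cplx g) = 0.
  apply: (double_roots_eq0 rs_uniq).
  - apply/allP => s /rsP[p pz ps]; rewrite rootE horner_mmap_polyC.
    by rewrite (meval_eq _ (horner_cpoly s)) (over_meval g6 (g0 p pz) ps).
  - apply/allP => s /rsP[p pz ps]; rewrite rootE deriv_mmap_polyC horner_sum.
    apply/eqP; apply: big1 => i _; rewrite hornerM horner_mmap_polyC.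
    rewrite (meval_eq _ (horner_cpoly s)) /cplx map_mpoly_mderiv.
    by rewrite (over_meval (dhomog_mderiv i g6) (dg0 p i pz) ps) mul0r.
  by rewrite rs_size; apply: leq_trans (size_cone g6) _.
have [c gc] := cone_kernel g6 isT G0.
set x := pt3 1 (- 1) 0; have f0 := sextic_pos; rewrite -/x in f0.
have cE : c = toC (g.@[x] / f.@[x]).
  have fx : toC f.@[x] != 0 by rewrite (inj_eq (@complexI _)) gt_eqF.
  by rewrite fmorph_div /=; apply: (mulIf fx); rewrite divfK // -!cplx_meval gc mevalZ.
by apply: cplx_inj; rewrite gc cE /cplx [RHS](map_mpolyZ (real_complex R)).
Qed.

Lemma sextic_ge0 x : 0 <= f.@[x].
Proof.
rewrite meval_sextic; have adm := fit_adm fit.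
have qp : qform (x 0) (x 1) (x 2) ^+ 2 <= 4 * pform (x 0) (x 1) (x 2) ^+ 3.
  by rewrite -subr_ge0 disc_form mulr_ge0 ?sqr_ge0.
by have [] := wsextic_psd (h * (x 0 + x 1 + x 2)) adm qp.
Qed.

Lemma sextic_psd36 : psd36 f.
Proof. by split; [exact: dhomog_sextic | exact: sextic_ge0]. Qed.

Lemma meval_zeros p : p \in zeros u v w -> f.@[pt p] = 0.
Proof. by case: p => [[a b] c] /(zeros_root fit)[_]; rewrite meval_sextic. Qed.

Lemma sextic_extremal : extremal_psd36 f.
Proof.
have prop (g g' : {mpoly R[3]}) : psd36 g -> psd36 g' -> f = g + g' -> exists c, 0 <= c /\ g = c *: f.
  move=> [g6 g_ge0] [_ g'_ge0] fE.
  (* A nonnegative summand lies between 0 and [f], so it vanishes at the zeros of [f] and, having a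
     minimum there, to first order as well. *)
  have g0 p : p \in zeros u v w -> g.@[pt p] = 0.
    move=> pz; have := meval_zeros pz; rewrite fE mevalD.
    by have := (g_ge0 (pt p), g'_ge0 (pt p)) => -[]; lra.
  have dg0 p i : p \in zeros u v w -> (g^`M(i)).@[pt p] = 0.
    by move=> pz; apply: psd_mderiv_eq0 => //; apply: g0.
  exists (g.@[pt3 1 (- 1) 0] / f.@[pt3 1 (- 1) 0]); split; last exact: sextic_unique.
  by rewrite divr_ge0 // ltW // sextic_pos.
split; first exact: sextic_psd36.
split=> [|g g' gP g'P fE].
  by apply: contraTneq sextic_pos => ->; rewrite meval0 ltxx.
by split; [apply: prop fE | apply: (prop _ g) => //; rewrite addrC].
Qed.

Lemma sextic_not_sos : ~ sos36 f.
Proof.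
case=> gs [gs3 fE].
have gs0 g : g \in gs -> g = 0.
  move=> ggs; apply: cubic_eq0 => [|p pz]; first exact: (allP gs3).
  have := meval_zeros pz; rewrite fE raddf_sum /= => /eqP.
  rewrite psumr_eq0 => [/allP/(_ g ggs)|q _]; last by rewrite rmorphXn sqr_ge0.
  by rewrite rmorphXn expf_eq0 => /eqP.
have := sextic_pos; rewrite fE big_seq big1 ?meval0 ?ltxx // => g /gs0 ->.
by rewrite expr0n.
Qed.

End Extremal.

(** * The ten acnodes *)

Section Acnodes.
Variable R : realType.
Variables (k d h u v w : R).
Hypothesis fit : fitted k d h u v w.

Let f := mpoly_sextic k d h.
Let pt (x : R * R * R) : 'I_3 -> R := pt3 x.1.1 x.1.2 x.2.

Lemma pt_inj_proj p q : p \in zeros u v w -> q \in zeros u v w ->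
  proj_eq (pt p) (pt q) -> p = q.
Proof.
case: p q => [[a b] c] [[a' b'] c'] /(zeros_root fit)[s1 _] /(zeros_root fit)[s2 _].
case=> t [_ e]; have := (e 0, e 1, e 2); rewrite /pt /pt3 /= => -[[aE bE] cE].
have t1 : t = 1 by rewrite -s1 aE bE cE -!mulrDr s2 mulr1.
by rewrite aE bE cE t1 !mul1r.
Qed.

Lemma acnode_zero p : p \in zeros u v w -> acnode f (pt p).
Proof.
move=> pz; have f0 : f.@[pt p] = 0 by exact: (meval_zeros fit pz).
case: p pz f0 => [[a b] c] pz f0; have [abc _] := zeros_root fit pz.
split.
  have [a0|a0] := eqVneq a 0; last by exists 0; exact: a0.
  have [b0|b0] := eqVneq b 0; last by exists 1; exact: b0.
  by exists 2; rewrite /pt /pt3 /=; apply/eqP => c0; move/eqP: abc; rewrite a0 b0 c0 !addr0 eq_sym oner_eq0.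
split=> //; split=> [i|].
  by apply: psd_mderiv_eq0 => //; exact: (sextic_ge0 fit).
left=> x x_not; rewrite hess_formE mulr_gt0 // mmap_sextic.
have [G_ge0 G_eq0] := zeros_hess (x 0) (x 1) (x 2) fit pz.
rewrite lt_neqAle G_ge0 andbT; apply/eqP => /esym /G_eq0 [t [x0 x1 x2]].
by apply: x_not; exists t => i; case: (ord3P i) => ->.
Qed.

Lemma real_zero (x : 'I_3 -> R) : (exists i, x i != 0) -> f.@[x] = 0 ->
  exists2 p, p \in zeros u v w & proj_eq x (pt p).
Proof.
move=> [i xi]; rewrite meval_sextic => f0; have adm := fit_adm fit.
have [k0 r0 c0 _] := adm; have th0 := theta_gt0 adm.
set a := x 0 in f0 *; set b := x 1 in f0 *; set c := x 2 in f0 *.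
(* On the line e = 0 each alternative of [wsextic_psd] gives p = 0, so the sextic has no real zero
   there and every real zero can be scaled to sum 1. *)
have s0 : a + b + c != 0.
  apply: contraNneq xi => s_0.
  have qp : qform a b c ^+ 2 <= 4 * pform a b c ^+ 3.
    by rewrite -subr_ge0 disc_form mulr_ge0 ?sqr_ge0.
  have p0 : pform a b c = 0.
    have [_ /(_ f0)] := wsextic_psd (h * (a + b + c)) adm qp.
    rewrite s_0 mulr0 expr0n /= !mulr0 => -[//|[/eqP]|[/eqP]].
      by rewrite mulf_eq0 expf_eq0 gt_eqF //= => /eqP.
    by rewrite mulf_eq0 gt_eqF ?mulr_gt0 //= => /eqP.
  have [ab bc] := pform_eq0 p0.
  have c_0 : c = 0 by rewrite ab bc in s_0; lra.
  by case: (ord3P i) => ->; rewrite -/a -/b -/c ?ab ?bc c_0.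
pose s := a + b + c.
have fs : sextic k d h (a / s) (b / s) (c / s) = 0.
  by rewrite ![_ / s]mulrC sexticZ f0 mulr0.
exists (a / s, b / s, c / s).
  by apply: fitted_zeros fit _ fs; rewrite -!mulrDl divff.
exists s; split=> // j.
by case: (ord3P j) => ->; rewrite /pt /pt3 /= mulrC divfK.
Qed.

Lemma ten_acnodes : has_n_acnodes 10 f.
Proof.
pose P (i : 'I_10) := pt (nth (0, 0, 0) (zeros u v w) i).
have Pz (i : 'I_10) : nth (0, 0, 0) (zeros u v w) i \in zeros u v w by apply: mem_nth.
exists P; split; first by move=> i; apply: acnode_zero.
split=> [i j ij PP|x [x0 [f0 _]]].
  have /eqP := pt_inj_proj (Pz i) (Pz j) PP.
  by rewrite nth_uniq ?(zeros_uniq fit) // (inj_eq val_inj) (negPf ij).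
have [p pz xp] := real_zero x0 f0.
have pi : (index p (zeros u v w) < 10)%N by rewrite -[10%N]/(size (zeros u v w)) index_mem.
by exists (Ordinal pi); rewrite /P /= nth_index.
Qed.

End Acnodes.

(** * From the points to the parameters *)

Section Continuity.
Variable R : realFieldType.
Implicit Types (F G : R -> R -> R -> R) (u v w : R).

Definition cont3 F u v w : Prop := forall e, 0 < e -> exists2 d, 0 < d &
  forall u' v' w', `|u' - u| < d -> `|v' - v| < d -> `|w' - w| < d ->
    `|F u' v' w' - F u v w| < e.

Lemma cont3_cst c u v w : cont3 (fun _ _ _ => c) u v w.
Proof. by move=> e e0; exists 1 => // *; rewrite subrr normr0. Qed.

Lemma cont3_fst u v w : cont3 (fun x _ _ => x) u v w.
Proof. by move=> e e0; exists e. Qed.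

Lemma cont3_snd u v w : cont3 (fun _ y _ => y) u v w.
Proof. by move=> e e0; exists e. Qed.

Lemma cont3_thd u v w : cont3 (fun _ _ z => z) u v w.
Proof. by move=> e e0; exists e. Qed.

Lemma cont3_both F G u v w e e' : cont3 F u v w -> cont3 G u v w -> 0 < e -> 0 < e' ->
  exists2 d, 0 < d & forall u' v' w', `|u' - u| < d -> `|v' - v| < d -> `|w' - w| < d ->
    `|F u' v' w' - F u v w| < e /\ `|G u' v' w' - G u v w| < e'.
Proof.
move=> cF cG e0 e'0; have [d d0 dF] := cF e e0; have [d' d'0 dG] := cG e' e'0.
exists (Num.min d d') => [|u' v' w']; first by rewrite lt_min d0.
by rewrite !lt_min => /andP[? ?] /andP[? ?] /andP[? ?]; split; [apply: dF | apply: dG].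
Qed.

Lemma cont3D F G u v w : cont3 F u v w -> cont3 G u v w ->
  cont3 (fun x y z => F x y z + G x y z) u v w.
Proof.
move=> cF cG e e0; have e2 : 0 < e / 2 by lra.
have [d d0 dFG] := cont3_both cF cG e2 e2; exists d => // x y z hx hy hz.
have [h1 h2] := dFG x y z hx hy hz.
rewrite opprD addrACA; apply: le_lt_trans (ler_normD _ _) _; lra.
Qed.

Lemma cont3M F G u v w : cont3 F u v w -> cont3 G u v w ->
  cont3 (fun x y z => F x y z * G x y z) u v w.
Proof.
move=> cF cG e e0; set a := F u v w; set b := G u v w.
pose M := 1 + `|a| + `|b|; have M0 : 0 < M by rewrite /M ltr_wpDr // ltr_wpDr.
pose m := Num.min 1 (e / M).
have m0 : 0 < m by rewrite lt_min ltr01 divr_gt0.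
have [d d0 dFG] := cont3_both cF cG m0 m0; exists d => // x y z hx hy hz.
have [] := dFG x y z hx hy hz; rewrite -/a -/b.
set p := F x y z; set q := G x y z => h1 h2.
have -> : p * q - a * b = (p - a) * (q - b) + (p - a) * b + a * (q - b) by ring.
have m1 : m <= 1 by rewrite ge_min lexx.
have mM : m * M <= e by rewrite -ler_pdivlMr // ge_min lexx orbT.
have h : `|(p - a) * (q - b)| < m.
  rewrite normrM -[m]mulr1; apply: ltr_pM => //; exact: lt_le_trans h2 m1.
have h3 : `|(p - a) * b| <= m * `|b| by rewrite normrM ler_wpM2r // ltW.
have h4 : `|a * (q - b)| <= `|a| * m by rewrite normrM ler_wpM2l // ltW.
have := ler_normD ((p - a) * (q - b) + (p - a) * b) (a * (q - b)).
have := ler_normD ((p - a) * (q - b)) ((p - a) * b).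
by rewrite /M in mM; lra.
Qed.

Lemma cont3B F G u v w : cont3 F u v w -> cont3 G u v w ->
  cont3 (fun x y z => F x y z - G x y z) u v w.
Proof.
move=> cF cG e e0; have [d d0 h] := cont3D cF (cont3M (@cont3_cst (-1) u v w) cG) e0.
by exists d => // x y z hx hy hz; have := h x y z hx hy hz; rewrite !mulN1r.
Qed.

Lemma cont3V F u v w : F u v w != 0 -> cont3 F u v w ->
  cont3 (fun x y z => (F x y z)^-1) u v w.
Proof.
move=> a0 cF e e0; set a := F u v w in a0.
have na : 0 < `|a| by rewrite normr_gt0.
pose m := Num.min (`|a| / 2) (e * `|a| ^+ 2 / 2).
have m0 : 0 < m by rewrite lt_min !divr_gt0 // mulr_gt0 // exprn_gt0.
have [d d0 dF] := cF m m0; exists d => // x y z hx hy hz.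
have := dF x y z hx hy hz; rewrite -/a; set p := F x y z => pa.
have [m1 m2] : m <= `|a| / 2 /\ m <= e * `|a| ^+ 2 / 2 by rewrite !ge_min !lexx orbT.
have p_gt : `|a| / 2 < `|p|.
  by have := ler_normD p (a - p); rewrite addrC subrK [`|a - p|]distrC; lra.
have p0 : p != 0 by rewrite -normr_gt0; lra.
have -> : p^-1 - a^-1 = (a - p) / (p * a) by field; rewrite a0 p0.
rewrite normrM normfV normrM ltr_pdivrMr ?mulr_gt0 ?normr_gt0 // distrC.
apply: lt_le_trans pa _; apply: le_trans m2 _.
by rewrite -mulrA ler_pM2l // expr2 mulrAC ler_wpM2r // ltW.
Qed.

Lemma cont3X F n u v w : cont3 F u v w -> cont3 (fun x y z => F x y z ^+ n) u v w.
Proof.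
move=> cF; elim: n => [|n IHn] e e0.
  by exists 1 => // *; rewrite !expr0 subrr normr0.
have [d d0 dF] := cont3M cF IHn e0; exists d => // x y z hx hy hz.
by rewrite !exprS; apply: dF.
Qed.

Definition near3 (P : R -> R -> R -> Prop) u v w : Prop := exists2 d, 0 < d &
  forall u' v' w', `|u' - u| < d -> `|v' - v| < d -> `|w' - w| < d -> P u' v' w'.

Lemma near3_and P Q u v w : near3 P u v w -> near3 Q u v w ->
  near3 (fun x y z => P x y z /\ Q x y z) u v w.
Proof.
move=> [d d0 dP] [d' d'0 dQ]; exists (Num.min d d') => [|x y z].
  by rewrite lt_min d0.
by rewrite !lt_min => /andP[? ?] /andP[? ?] /andP[? ?]; split; [apply: dP | apply: dQ].
Qed.

Lemma near3_gt0 F u v w : 0 < F u v w -> cont3 F u v w ->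
  near3 (fun x y z => 0 < F x y z) u v w.
Proof.
move=> F0 /(_ _ F0)[d d0 dF]; exists d => // x y z hx hy hz.
by have := dF x y z hx hy hz; rewrite ltr_norml => /andP[]; lra.
Qed.

Lemma near3_neq0 F u v w : F u v w != 0 -> cont3 F u v w ->
  near3 (fun x y z => F x y z != 0) u v w.
Proof.
rewrite -normr_gt0 => F0 /(_ _ F0)[d d0 dF]; exists d => // x y z hx hy hz.
have := dF x y z hx hy hz; apply: contraTneq => ->.
by rewrite sub0r normrN ltxx.
Qed.

End Continuity.

(** * Solving for k, d and h on an open set *)

Section Fitting.
Variable R : realType.
Implicit Types u v w : R.

(** The condition [fit_w] says h = (theta / kap) hval. In the units of [pnode] and [qnode], the
    image of (w,1,1) is (p,q) = (1,2), whatever w is. *)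
Definition hval w : R := (w - 1) / (w + 2).
Definition pnode u v w : R := pform u v 1 / ((u + v + 1) * hval w) ^+ 2.
Definition qnode u v w : R := qform u v 1 / ((u + v + 1) * hval w) ^+ 3.
(** The scaled cubic parametrised before [fit_node] has its coefficients fixed by tangency to q^2 =
    4p^3 at (1,2), where x = 1. At a node (p,q) the two parameters have sum 1 + g and product p g,
    and reducing q(x) modulo this quadratic must leave the constant q. The constant term gives
    [bval]; eliminating b from the linear term leaves an equation linear in g, solved by [gval]. *)
Definition gden u v w : R := pnode u v w + pnode u v w ^+ 2 - qnode u v w.
Definition gval u v w : R :=
  pnode u v w * (3 * pnode u v w - 1 - qnode u v w) / gden u v w.
Definition bval u v w : R :=
  (pnode u v w * gval u v w * (1 + gval u v w) - qnode u v w)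
  / (pnode u v w * gval u v w * (gval u v w - 1)).
(** Positivity of [epsval] makes k real, as [fit_node] takes its square root; positivity of [posval]
    makes the two parameters of the node non-real. *)
Definition epsval u v w : R := bval u v w - ((1 + gval u v w) / gval u v w) ^+ 2.
Definition posval u v w : R := 4 * pnode u v w * gval u v w - (1 + gval u v w) ^+ 2.

(** Only strict inequalities and nonvanishing of rational functions occur: the square root is taken
    after this point, so openness reduces to continuity of rational functions and one sample point
    shows that the set is not empty. *)
Definition good u v w : Prop :=
  ((w - 1 != 0 /\ w + 2 != 0) /\ (u - v != 0 /\ u - 1 != 0)) /\
  ((v - 1 != 0 /\ u + v + 1 != 0) /\ (gden u v w != 0 /\ gval u v w - 1 != 0)) /\
  ((0 < gval u v w /\ 0 < epsval u v w) /\ 0 < posval u v w).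

Lemma good_near u v w : good u v w -> near3 good u v w.
Proof.
move=> G; have [[[w1 w2] [uv u1]] [[[v1 s0] [den0 g1]] [[g0 eps0] pos0]]] := G.
have cu := @cont3_fst R u v w; have cv := @cont3_snd R u v w; have cw := @cont3_thd R u v w.
have c c0 : cont3 (fun _ _ _ => c0 : R) u v w := @cont3_cst R c0 u v w.
have h0 : hval w != 0 by rewrite mulf_neq0 ?invr_eq0.
have sh0 : (u + v + 1) * hval w != 0 by rewrite mulf_neq0.
have ch : cont3 (fun _ _ z => hval z) u v w.
  exact: cont3M (cont3B cw (c 1)) (cont3V w2 (cont3D cw (c 2))).
have cs := cont3D (cont3D cu cv) (c 1).
have csh := cont3M cs ch.
have cpf : cont3 (fun x y _ => pform x y 1) u v w.
  exact: cont3B (cont3B (cont3B (cont3D (cont3D (cont3X 2 cu) (cont3X 2 cv))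
    (cont3X 2 (c 1))) (cont3M cu cv)) (cont3M cv (c 1))) (cont3M (c 1) cu).
have cqf : cont3 (fun x y _ => qform x y 1) u v w.
  exact: cont3M (cont3M (cont3B (cont3B (cont3M (c 2) cu) cv) (c 1))
    (cont3B (cont3B (cont3M (c 2) cv) (c 1)) cu))
    (cont3B (cont3B (cont3M (c 2) (c 1)) cu) cv).
have cp : cont3 (@pnode) u v w.
  by apply: cont3M cpf (cont3V _ (cont3X 2 csh)); rewrite expf_eq0.
have cq : cont3 (@qnode) u v w.
  by apply: cont3M cqf (cont3V _ (cont3X 3 csh)); rewrite expf_eq0.
have cden : cont3 (@gden) u v w := cont3B (cont3D cp (cont3X 2 cp)) cq.
have cg : cont3 (@gval) u v w.
  exact: cont3M (cont3M cp (cont3B (cont3B (cont3M (c 3) cp) (c 1)) cq)) (cont3V den0 cden).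
have p0 : pnode u v w != 0.
  apply: contraTneq pos0 => p0; rewrite /posval p0 mulr0 mul0r sub0r oppr_gt0.
  by rewrite -leNgt sqr_ge0.
have cb : cont3 (@bval) u v w.
  apply: cont3M (cont3B (cont3M (cont3M cp cg) (cont3D (c 1) cg)) cq)
    (cont3V _ (cont3M (cont3M cp cg) (cont3B cg (c 1)))).
  by apply: mulf_neq0 g1; apply: mulf_neq0 p0 _; rewrite gt_eqF.
have ceps : cont3 (@epsval) u v w.
  apply: cont3B cb (cont3X 2 (cont3M (cont3D (c 1) cg) (cont3V _ cg))).
  by rewrite gt_eqF.
have cpos : cont3 (@posval) u v w :=
  cont3B (cont3M (cont3M (c 4) cp) cg) (cont3X 2 (cont3D (c 1) cg)).
apply: near3_and.
  apply: near3_and; apply: near3_and.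
  - exact: near3_neq0 w1 (cont3B cw (c 1)).
  - exact: near3_neq0 w2 (cont3D cw (c 2)).
  - exact: near3_neq0 uv (cont3B cu cv).
  exact: near3_neq0 u1 (cont3B cu (c 1)).
apply: near3_and.
  apply: near3_and; apply: near3_and.
  - exact: near3_neq0 v1 (cont3B cv (c 1)).
  - exact: near3_neq0 s0 cs.
  - exact: near3_neq0 den0 cden.
  exact: near3_neq0 g1 (cont3B cg (c 1)).
apply: near3_and; first by apply: near3_and; apply: near3_gt0.
exact: near3_gt0.
Qed.

Lemma good_sample : good 0 (1 / 2) 0.
Proof.
have hE : hval 0 = - (1 / 2) by rewrite /hval; field.
have pE : pnode 0 (1 / 2) 0 = 4 / 3 by rewrite /pnode hE /pform; field.
have qE : qnode 0 (1 / 2) 0 = 0 by rewrite /qnode hE /qform; field.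
have dE : gden 0 (1 / 2) 0 = 28 / 9 by rewrite /gden pE qE; field.
have gE : gval 0 (1 / 2) 0 = 9 / 7 by rewrite /gval pE qE dE; field.
have bE : bval 0 (1 / 2) 0 = 8 by rewrite /bval gE pE qE; field.
have eE : epsval 0 (1 / 2) 0 = 392 / 81 by rewrite /epsval bE gE; field.
rewrite /good /posval dE eE gE pE; do ![split]; lra.
Qed.

End Fitting.

Section Fit.
Variable R : rcfType.
Implicit Types g b p q r : R.

(* With [r = 1 / g], the scaled quotient curve is
   [x |-> ((1 + r) x - r x^2, b x + (3 + 3 r - 2 b) x^2 + (b - 1 - 3 r) x^3)],
   and the hypotheses on [p] and [q] say that its node is at [(p, q)]. *)
Lemma fit_node g b p q :
    0 < g -> g - 1 != 0 -> 0 < b - ((1 + g) / g) ^+ 2 ->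
    0 < 4 * p * g - (1 + g) ^+ 2 ->
    g * (p + p ^+ 2 - q) = p * (3 * p - 1 - q) ->
    b * (p * g * (g - 1)) = p * g * (1 + g) - q ->
  exists k d, [/\ admissible k d, rho k d != kap k ^+ 2,
    rho k d * cub k d * p = kap k * theta k d ^+ 2 &
    2 * rho k d ^+ 3 * q = lin k d (theta k d / kap k) p].
Proof.
move=> g0 g1 eps0 pos0 gE bE.
have gn0 : g != 0 by rewrite gt_eqF.
have p0 : 0 < p.
  have := sqr_ge0 (1 + g) => h; rewrite -(pmulr_lgt0 _ g0); lra.
have pn0 : p != 0 by rewrite gt_eqF.
pose r := g^-1; have r0 : 0 < r by rewrite invr_gt0.
have rE : (1 + g) / g = 1 + r by rewrite mulrDl mul1r divff // addrC.
have gr : g = r^-1 by rewrite invrK.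
rewrite rE in eps0; set eps := b - _ in eps0.
(* The coefficient b of x in the scaled q is theta^2 / kap^3 = (1 + r)^2 (1 + 1/k^2), which forces
   eps = (1 + r)^2 / k^2. *)
pose k := (1 + r) / Num.sqrt eps.
have se0 : 0 < Num.sqrt eps by rewrite sqrtr_gt0.
have k0 : 0 < k by rewrite divr_gt0 // addr_gt0.
have kn0 : k != 0 by rewrite gt_eqF.
have k2 : eps = (1 + r) ^+ 2 / k ^+ 2.
  rewrite /k expr_div_n sqr_sqrtr ?ltW // invf_div mulrC divfK //.
  by rewrite expf_eq0 /= gt_eqF // addr_gt0.
have K0 := kap_gt0 k; have Kn0 : kap k != 0 by rewrite gt_eqF.
(* Chosen so that rho = kap^2 r; then k theta = kap^2 (1 + r), which matches the scaled p. *)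
pose d := (kap k ^+ 2 * r + kap k) / k.
have rhoE : rho k d = kap k ^+ 2 * r by rewrite /rho /d; field.
have thE : theta k d = kap k ^+ 2 * (1 + r) / k.
  by rewrite /theta /d /kap; field.
(* This is the vanishing of the linear term when q(x) is reduced modulo the quadratic of the
   node. *)
have I1 : (b - 1 - 3 * r) * p = g * eps.
  have J : ((1 + g) ^+ 2 - p * (g + 3) - (g - p) * b * g) * (p * (g - 1)) = 0.
    have -> : ((1 + g) ^+ 2 - p * (g + 3) - (g - p) * b * g) * (p * (g - 1)) =
      ((1 + g) ^+ 2 - p * (g + 3)) * (p * (g - 1)) - (g - p) * (b * (p * g * (g - 1))) by ring.
    rewrite bE.
    have -> : ((1 + g) ^+ 2 - p * (g + 3)) * (p * (g - 1)) - (g - p) * (p * g * (1 + g) - q)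
      = p * (3 * p - 1 - q) - g * (p + p ^+ 2 - q) by ring.
    by rewrite gE subrr.
  move/eqP: J; rewrite mulf_eq0 (negPf (mulf_neq0 pn0 g1)) orbF => /eqP J.
  apply: (mulfI gn0); apply/eqP; rewrite -subr_eq0; apply/eqP.
  by rewrite -[RHS]J /eps gr; field; rewrite gt_eqF.
have bE2 : b = (1 + r) ^+ 2 * kap k / k ^+ 2.
  have -> : b = eps + (1 + r) ^+ 2 by rewrite /eps subrK.
  by rewrite k2 /kap; field.
have b3_gt0 : 0 < b - 1 - 3 * r by rewrite -(pmulr_lgt0 _ p0) I1 mulr_gt0.
have cubE : cub k d = kap k ^+ 3 * (b - 1 - 3 * r).
  by rewrite bE2 /cub /d /kap; field.
exists k, d; split.
- split=> //.
  + by rewrite rhoE mulr_gt0 // exprn_gt0.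
  + by rewrite cubE mulr_gt0 // exprn_gt0.
  (* Multiplied by p, the last inequality of [admissible] becomes (1 + g)^2 / g < 4p, the positivity
     hypothesis on the node. *)
  rewrite cubE mulrCA mulrC ltr_pM2r ?exprn_gt0 // -(ltr_pM2r p0) -mulrA I1 k2.
  have -> : k ^+ 2 * (g * ((1 + r) ^+ 2 / k ^+ 2)) = (1 + g) ^+ 2 / g.
    by rewrite gr; field; rewrite kn0 gt_eqF.
  by rewrite ltr_pdivrMr // -subr_gt0.
- rewrite rhoE -subr_eq0.
  have -> : kap k ^+ 2 * r - kap k ^+ 2 = - (kap k ^+ 2 * r * (g - 1)) by rewrite gr; field; rewrite gt_eqF.
  by rewrite oppr_eq0 !mulf_neq0 ?expf_eq0 // gt_eqF.
- rewrite rhoE cubE thE.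
  transitivity (kap k ^+ 5 * r * ((b - 1 - 3 * r) * p)); first by ring.
  by rewrite I1 k2 gr; field; rewrite kn0 gt_eqF.
have qE : q = p * g * (1 + g) - b * (p * g * (g - 1)) by rewrite bE; ring.
have b30 : b - 1 - 3 * r != 0 by rewrite gt_eqF.
have pE : p = g * eps / (b - 1 - 3 * r) by apply: (mulIf b30); rewrite divfK // -I1 mulrC.
have quadE : quad k d = (k ^+ 2 * kap k - 2 * kap k ^+ 2 * r - 2 * kap k) / k.
  by rewrite /quad /d; field.
have rn0 : r != 0 by rewrite gt_eqF.
rewrite qE pE k2 gr /lin cubE rhoE quadE thE bE2 in b30 *.
rewrite /kap in Kn0 b30 *.
field; rewrite Kn0 kn0 rn0 andbT /=.
have -> : (1 + r) ^+ 2 * (1 + k ^+ 2) + -1 * k ^+ 2 + - (3 * r) * k ^+ 2 =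
  ((1 + r) ^+ 2 * (1 + k ^+ 2) / k ^+ 2 - 1 - 3 * r) * k ^+ 2 by field.
by rewrite mulf_neq0 // expf_eq0.
Qed.

End Fit.

Lemma good_fitted (R : realType) (u v w : R) :
  good u v w -> exists k d h, fitted k d h u v w.
Proof.
case=> [[[w1 w2] [uv u1]] [[[v1 s0] [den0 g1]] [[g0 eps0] pos0]]].
have hv0 : hval w != 0 by rewrite mulf_neq0 ?invr_eq0.
have p0 : pnode u v w != 0.
  apply: contraTneq pos0 => p0; rewrite /posval p0 mulr0 mul0r sub0r oppr_gt0.
  by rewrite -leNgt sqr_ge0.
have gE : gval u v w * (pnode u v w + pnode u v w ^+ 2 - qnode u v w) =
    pnode u v w * (3 * pnode u v w - 1 - qnode u v w).
  by rewrite -/(gden u v w) /gval divfK.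
have bE : bval u v w * (pnode u v w * gval u v w * (gval u v w - 1)) =
    pnode u v w * gval u v w * (1 + gval u v w) - qnode u v w.
  by rewrite /bval divfK //; apply: mulf_neq0 g1; apply: mulf_neq0 p0 _; rewrite gt_eqF.
have [k [d [adm rk pE qE]]] := fit_node g0 g1 eps0 pos0 gE bE.
have K0 := kap_gt0 k; have th0 := theta_gt0 adm.
have Kn0 : kap k != 0 by rewrite gt_eqF.
pose t := (u + v + 1) * hval w.
have t0 : t != 0 by rewrite mulf_neq0.
have hE : theta k d / kap k * hval w * (u + v + 1) = theta k d / kap k * t.
  by rewrite /t; ring.
have pfE : pform u v 1 = pnode u v w * t ^+ 2 by rewrite /pnode divfK // expf_eq0.
have qfE : qform u v 1 = qnode u v w * t ^+ 3 by rewrite /qnode divfK // expf_eq0.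
exists k, d, (theta k d / kap k * hval w); split=> //.
- by rewrite !mulf_neq0 ?invr_eq0 // gt_eqF.
- by rewrite -subr_eq0.
- by rewrite /hval; field; rewrite w2 Kn0.
- by rewrite -subr_eq0.
- by rewrite -subr_eq0.
- by rewrite -subr_eq0.
- by rewrite hE pfE mulrA pE; field.
rewrite hE pfE qfE mulrA qE /lin; ring.
Qed.

Theorem theorem1p5 (R : realType) :
  exists U : R -> R -> R -> Prop,
    nonempty_open3 U /\
    forall u v w : R, U u v w ->
      exists f : {mpoly R[3]},
        psd36_s0 f /\
        (f.@[pt3 u v 1] = 0 /\ f.@[pt3 w 1 1] = 0 /\ f.@[pt3 1 1 1] = 0) /\
        irreducible_mpoly (cplx f) /\
        (extremal_psd36 f /\ ~ sos36 f) /\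
        (irreducible_mpoly (cplx f) /\ rational_curve (cplx f) /\ has_n_acnodes 10 f).
Proof.
exists (@good R); split.
  split=> [|u v w /good_near[e e0 near]]; last by exists e.
  by exists 0, (1 / 2), 0; apply: good_sample.
move=> u v w /good_fitted[k [d [h fit]]].
have [[k0 r0 _ _] h0] := (fit_adm fit, fit_h fit).
have nz (x : R) : x != 0 -> real_complex R x != 0.
  by move=> x0; rewrite (inj_eq (@complexI _)).
have kapC : kap (real_complex R k) = real_complex R (kap k).
  by rewrite rmorph_kap.
have rhoC : rho (real_complex R k) (real_complex R d) = real_complex R (rho k d).
  by rewrite rmorph_rho.
have K0 : kap (real_complex R k) != 0 by rewrite kapC nz // gt_eqF // kap_gt0.
have R0 : rho (real_complex R k) (real_complex R d) != 0 by rewrite rhoC nz // gt_eqF.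
have irr : irreducible_mpoly (cplx (mpoly_sextic k d h)).
  rewrite /cplx map_mpoly_sextic.
  exact: (irreducible_sextic (nz _ (lt0r_neq0 k0)) K0 R0 (nz _ h0) (omega2 R)).
exists (mpoly_sextic k d h); split.
  split; first exact: (sextic_psd36 fit).
  by split; [exact: sym_sextic | rewrite meval_sextic; exact: sextic111].
split.
  split; first by rewrite meval_sextic; exact: (fitted_uv fit).
  split; first by rewrite meval_sextic; exact: (fitted_w11 fit).
  by rewrite meval_sextic; exact: sextic111.
split=> //; split; first by split; [exact: (sextic_extremal fit) | exact: (sextic_not_sos fit)].
split=> //; split; last exact: (ten_acnodes fit).
rewrite /cplx map_mpoly_sextic.
exact: (rational_sextic _ (nz _ (lt0r_neq0 k0)) K0 (nz _ h0) (omega2 R)).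
Qed.
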